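(* Let $m,n\ge 2$ be integers and let $R=[0,m-1]\times[0,n-1]\subset\mathbb{R}^2$. The number of tilings of $R$ by the tiles described in the context is $2^\beta+2^\omega-2$, where $c=\gcd(m+1,n+1)-1$, $2\beta=c+(c \bmod 2)$ and $2\omega=c-(c\bmod 2)$.
   Context: The tiles are the following closed polygons, where $a,b$ denote arbitrary positive integers; each tile may be translated and rotated by integer multiples of $\pi/2$. (T1) An axis-parallel square of side $2$. (T2) A square of side $\sqrt2$ with sides in the diagonal directions, e.g. with vertices $(0,0),(1,1),(0,2),(-1,1)$. (T3) The octagon with vertices $(0,0),(2,0),(2+a,a),(2+a,a+2),(2+a-b,a+b+2),(a-b,a+b+2),(-b,b+2),(-b,b)$ (all angles $3\pi/4$; horizontal and vertical sides of length $2$, diagonal sides of lengths $a\sqrt2$ and $b\sqrt2$). (T4) The hexagon with vertices $(0,0),(2,0),(2,2),(2-a,2+a),(-a,2+a),(-a,a)$. (T5) The trapezoid with vertices $(0,0),(2a+2,0),(a+2,a),(a,a)$, whose long base (the side from $(0,0)$ to $(2a+2,0)$) is called dashed. (T6) The right isosceles triangle with vertices $(0,0),(a,0),(0,a)$, whose two legs are called dashed. A tiling of $R$ is a covering of $R$ by finitely many such tiles with pairwise disjoint interiors, such that every dashed side of every tile is contained in the boundary $\partial R$. *)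

(* Defs.v *)
From mathcomp Require Import all_boot all_order all_algebra.
From mathcomp Require Import all_classical all_reals all_analysis.

Set Implicit Arguments.
Unset Strict Implicit.
Unset Printing Implicit Defensive.

Import GRing.Theory Num.Theory numFieldNormedType.Exports.

Local Open Scope classical_set_scope.
Local Open Scope ring_scope.

Variant prototile :=
  | Square
  | Diamond
  | Octagon of nat & nat
  | Hexagon of nat
  | Trapezoid of nat
  | Triangle of nat.

Definition positive_params (t : prototile) : bool :=
  match t with
  | Square | Diamond => true
  | Octagon a b => (0 < a)%N && (0 < b)%N
  | Hexagon a | Trapezoid a | Triangle a => (0 < a)%N
  end.

Section Plane.
Variable R : realType.
Local Notation plane := (R * R)%type.

Definition hull (s : seq plane) : set plane :=
  smallest (@convex_set R plane) [set` s].

(* Vertices in counterclockwise order. All these polygons are convex, so the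
   closed polygon is the hull of its vertices. *)
Definition vertices (t : prototile) : seq plane :=
  match t with
  | Square => [:: (0, 0); (2, 0); (2, 2); (0, 2)]
  | Diamond => [:: (0, 0); (1, 1); (0, 2); (-1, 1)]
  | Octagon a' b' => let a := a'%:R in let b := b'%:R in
      [:: (0, 0); (2, 0); (2 + a, a); (2 + a, a + 2);
          (2 + a - b, a + b + 2); (a - b, a + b + 2); (- b, b + 2); (- b, b)]
  | Hexagon a' => let a := a'%:R in
      [:: (0, 0); (2, 0); (2, 2); (2 - a, 2 + a); (- a, 2 + a); (- a, a)]
  | Trapezoid a' => let a := a'%:R in
      [:: (0, 0); (2 * a + 2, 0); (a + 2, a); (a, a)]
  | Triangle a' => let a := a'%:R in
      [:: (0, 0); (a, 0); (0, a)]
  end.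

(* Side i joins vertex i to the cyclically next vertex. *)
Definition side (s : seq plane) (i : nat) : set plane :=
  hull [:: nth 0 s i; nth 0 s (i.+1 %% size s)].

(* Indices of the dashed sides: the long base of the trapezoid and the two legs
   of the triangle. *)
Definition dashed (t : prototile) : seq nat :=
  match t with
  | Trapezoid _ => [:: 0%N]
  | Triangle _ => [:: 0%N; 2%N]
  | _ => [::]
  end.

Definition quarter_turn (p : plane) : plane := (- p.2, p.1).

Definition motion (k : nat) (v p : plane) : plane := iter k quarter_turn p + v.

Definition boundary (Q : set plane) : set plane := closure Q `\` interior Q.

(* A tile is identified with the region it covers; this region determines the
   kind of tile, its parameters and its dashed sides. *)
Definition is_tile (Q P : set plane) : Prop :=
  exists (t : prototile) (k : nat) (v : plane),
    [/\ positive_params t,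
        P = motion k v @` hull (vertices t)
      & forall i, i \in dashed t ->
          motion k v @` side (vertices t) i `<=` boundary Q].

Definition is_tiling (Q : set plane) (T : set (set plane)) : Prop :=
  [/\ finite_set T,
      forall P, T P -> is_tile Q P,
      \bigcup_(P in T) P = Q
    & trivIset T (fun P => interior P)].

Definition rectangle (m n : nat) : set plane :=
  `[0, m%:R - 1] `*` `[0, n%:R - 1].

End Plane.

Arguments rectangle : clear implicits.

(* Main.v *)
(* Put s = x + y + 2 and d = x - y. Every tile other than the diamond (T2) is the
   part inside R of an octagon around a rectangular block of points (s, d); the
   dashed sides say that a block cut by R is symmetric with respect to a mirror,
   a line at distance 1 outside R. Looking at the lowest, then leftmost point of
   the tiles that are not placed like the tile in the corner of R, one finds
   that there are none: all blocks have their corners in one of the two colour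
   classes of the integer points. Call a point of this class solid if it is in
   no block. Every point of the other class has an even number of solid
   neighbours, so the solid points form a vector of the kernel over F_2 of the
   adjacency matrix of the m x n grid graph. By the wave equation such a vector
   is S(s, d) = h s + h d with h even and periodic of periods 2 (m + 1) and
   2 (n + 1), hence 2 gcd(m + 1, n + 1). Conversely the blocks of a nonconstant
   h are the products of maximal intervals on which h takes the same value, and
   the tiling is recovered from h. Counting such h up to complement gives
   2 ^ beta - 1 for one class and 2 ^ omega - 1 for the other. *)

Require Import Defs.
From mathcomp Require Import all_boot all_order all_algebra.
From mathcomp Require Import all_classical all_reals all_analysis.
From mathcomp Require Import unstable zify ring lra.

Set Implicit Arguments.
Unset Strict Implicit.
Unset Printing Implicit Defensive.

Import Order.TTheory GRing.Theory Num.Theory numFieldNormedType.Exports.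

Local Open Scope classical_set_scope.
Local Open Scope ring_scope.

(** * Convex hulls of the prototiles *)

Section Hulls.
Variable R : realType.
Local Notation plane := (R * R)%type.

(** An octagon is the Minkowski sum of its block with an axis-parallel square of side 2, so in the
    coordinates [s], [d] its vertices agree modulo 2 with the corners of the block; mirror symmetry
    keeps this true for the new vertices on a wall, right angles at corners of R excepted. Nothing
    says beforehand that tiles sit at integer positions. At the extremal point of the tiles out of
    step, a tile in step can have no vertex, so it looks like a half-plane; two half-planes that
    miss a common sector overlap, and this leaves no room for them. The parity of solid neighbours
    is local: a point of the other class sees a diamond, the inside of a block, an edge of a block,
    or a block corner with a nonsolid point opposite. The symmetries of [h] are the vanishing of S
    on the mirrors s + d = 0, s + d = 2 M and s - d = 2 N. With g = gcd(m + 1, n + 1), the class of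
    g has floor(g / 2) + 1 points in [0, g], the other class floor((g - 1) / 2) + 1; one value is
    spent on the complement, which gives the two exponents. *)

Definition octagon8 (x1 x2 y1 y2 s1 s2 d1 d2 : R) : set plane :=
  [set z | [/\ x1 <= z.1 <= x2, y1 <= z.2 <= y2,
               s1 <= z.1 + z.2 <= s2 & d1 <= z.1 - z.2 <= d2]].

(** Convexity along p + t e with a free direction e. The sides needed are horizontal, vertical or
    diagonal, so with entries of e in {-1, 0, 1} every membership becomes a linear condition. *)
Definition segment_closed (D : set plane) :=
  forall (px py ex ey t u : R), D (px, py) -> D (px + t * ex, py + t * ey) ->
    0 <= u <= t -> D (px + u * ex, py + u * ey).

Lemma convex_segment_closed (D : set plane) :
  @convex_set R plane D -> segment_closed D.
Proof.
move=> cD px py ex ey t u Dp Dq /andP[u0 ut].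
have [t0|t0] := eqVneq t 0.
  have -> : u = 0 by lra.
  by rewrite !mul0r !addr0.
have tp : 0 < t by lra.
have l0 : 0 <= u / t by rewrite divr_ge0 // ltW.
have l1 : u / t <= 1 by rewrite ler_pdivrMr // mul1r.
have := cD (px + t * ex, py + t * ey) (px, py) (Itv01 l0 l1) (mem_set Dq) (mem_set Dp).
rewrite inE /conv /=.
set w := (X in D X -> _).
suff -> : w = (px + u * ex, py + u * ey) by [].
rewrite /w /unstable.onem; apply: injective_projections => /=;
  rewrite /GRing.scale /=; field.
all: exact: t0.
Qed.

Lemma octagon8_convex x1 x2 y1 y2 s1 s2 d1 d2 :
  @convex_set R plane (octagon8 x1 x2 y1 y2 s1 s2 d1 d2).
Proof.
move=> [px py] [qx qy] l; rewrite !inE => -[/= a1 a2 a3 a4] [/= b1 b2 b3 b4].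
rewrite /octagon8 /= /GRing.scale /= ?/unstable.onem.
set t := l%:num; have t0 : 0 <= t by rewrite /t.
have t1 : t <= 1 by rewrite /t.
have H : forall a b c d : R, a <= c <= b -> a <= d <= b ->
   a <= t * c + (1 - t) * d <= b.
  by move=> a b c d /andP[ac cb] /andP[ad db]; apply/andP; split; nra.
split; [exact: H | exact: H | |].
- have -> : t * px + (1 - t) * qx + (t * py + (1 - t) * qy)
            = t * (px + py) + (1 - t) * (qx + qy) by ring.
  exact: H.
- have -> : t * px + (1 - t) * qx - (t * py + (1 - t) * qy)
            = t * (px - py) + (1 - t) * (qx - qy) by ring.
  exact: H.
Qed.

Lemma hull_eqP (s : seq plane) (O : set plane) :
  @convex_set R plane O -> {in s, forall p, O p} ->
  (forall D, segment_closed D -> {in s, forall p, D p} -> O `<=` D) ->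
  hull s = O.
Proof.
move=> cO sO minO; apply/seteqP; split.
  by apply: smallest_sub => // p /sO.
move=> z Oz D [cD sD].
by apply: (minO D) Oz => [|p /sD //]; exact: convex_segment_closed.
Qed.

(** Cut horizontally: both ends of the chord at height [y] lie on sides of the octagon, and which
    sides depends on [y] relative to [b], [b + 2] on the left and [a], [a + 2] on the right. The
    values 0 are allowed, so squares and hexagons are covered. *)
Lemma octagon_sub_segment_closed (a b : R) (D : set plane) :
  0 <= a -> 0 <= b -> segment_closed D ->
  D (0, 0) -> D (2, 0) -> D (2 + a, a) -> D (2 + a, a + 2) ->
  D (2 + a - b, a + b + 2) -> D (a - b, a + b + 2) -> D (- b, b + 2) ->
  D (- b, b) ->
  octagon8 (- b) (2 + a) 0 (a + b + 2) 0 (4 + 2 * a) (- 2 - 2 * b) 2 `<=` D.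
Proof.
move=> a0 b0 sD D1 D2 D3 D4 D5 D6 D7 D8 [x y] [/= hx hy hs hd].
have L : exists2 l, l <= x & D (l, y).
  have [yb|yb] := lerP y b.
    exists (- y); first by lra.
    have := sD 0 0 (-1) 1 b y; rewrite !add0r !mulr1 !mulrN1.
    by apply => //; lra.
  have [yb2|yb2] := lerP y (b + 2).
    exists (- b); first by lra.
    have := sD (- b) b 0 1 2 (y - b); rewrite !mulr0 !mulr1 !addr0.
    rewrite (_ : b + (y - b) = y); last by ring.
    by apply => //; lra.
  exists (y - 2 * b - 2); first by lra.
  have := sD (- b) (b + 2) 1 1 a (y - b - 2); rewrite !mulr1.
  rewrite (_ : - b + (y - b - 2) = y - 2 * b - 2); last by ring.
  rewrite (_ : b + 2 + (y - b - 2) = y); last by ring.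
  rewrite (_ : - b + a = a - b); last by ring.
  rewrite (_ : b + 2 + a = a + b + 2); last by ring.
  by apply => //; lra.
have U : exists2 r, x <= r & D (r, y).
  have [ya|ya] := lerP y a.
    exists (2 + y); first by lra.
    have := sD 2 0 1 1 a y; rewrite !add0r !mulr1.
    by apply => //; lra.
  have [ya2|ya2] := lerP y (a + 2).
    exists (2 + a); first by lra.
    have := sD (2 + a) a 0 1 2 (y - a); rewrite !mulr0 !mulr1 !addr0.
    rewrite (_ : a + (y - a) = y); last by ring.
    by apply => //; lra.
  exists (4 + 2 * a - y); first by lra.
  have := sD (2 + a) (a + 2) (-1) 1 b (y - a - 2); rewrite !mulr1 !mulrN1.
  rewrite (_ : 2 + a + - (y - a - 2) = 4 + 2 * a - y); last by ring.
  rewrite (_ : a + 2 + (y - a - 2) = y); last by ring.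
  rewrite (_ : a + 2 + b = a + b + 2); last by ring.
  by apply => //; lra.
case: L => l lx Dl; case: U => r xr Dr.
have := sD l y 1 0 (r - l) (x - l); rewrite !mulr1 !mulr0 !addr0.
rewrite (_ : l + (r - l) = r); last by ring.
rewrite (_ : l + (x - l) = x); last by ring.
by apply => //; lra.
Qed.

Let hsegE (D : set plane) (l r x y : R) : segment_closed D ->
  D (l, y) -> D (r, y) -> l <= x -> x <= r -> D (x, y).
Proof.
move=> sD Dl Dr lx xr.
have := sD l y 1 0 (r - l) (x - l); rewrite !mulr1 !mulr0 !addr0.
rewrite (_ : l + (r - l) = r); last by ring.
rewrite (_ : l + (x - l) = x); last by ring.
by apply => //; lra.
Qed.

Lemma hull_octagon (a b : nat) : hull (vertices R (Octagon a b)) =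
  octagon8 (- b%:R) (2 + a%:R) 0 (a%:R + b%:R + 2) 0 (4 + 2 * a%:R)
    (- 2 - 2 * b%:R) 2.
Proof.
have a0 : 0 <= a%:R :> R by rewrite ler0n.
have b0 : 0 <= b%:R :> R by rewrite ler0n.
apply: hull_eqP; first exact: octagon8_convex.
  move=> p; rewrite !inE.
  by repeat (case/orP => [/eqP->|]); last move=> /eqP->;
    rewrite /octagon8 /=; split; lra.
move=> D sD Ds; apply: octagon_sub_segment_closed => //.
all: by apply: Ds; rewrite !inE eqxx ?orbT.
Qed.

Lemma hull_square : hull (vertices R Square) =
  octagon8 0 2 0 2 0 4 (- 2) 2.
Proof.
apply: hull_eqP; first exact: octagon8_convex.
  move=> p; rewrite !inE.
  by repeat (case/orP => [/eqP->|]); last move=> /eqP->;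
    rewrite /octagon8 /=; split; lra.
move=> D sD Ds.
have D1 : D (0, 0) by apply: Ds; rewrite !inE eqxx ?orbT.
have D2 : D (2, 0) by apply: Ds; rewrite !inE eqxx ?orbT.
have D3 : D (2, 2) by apply: Ds; rewrite !inE eqxx ?orbT.
have D4 : D (0, 2) by apply: Ds; rewrite !inE eqxx ?orbT.
have := @octagon_sub_segment_closed 0 0 D (lexx _) (lexx _) sD.
by rewrite !(mulr0, addr0, add0r, subr0, oppr0); apply.
Qed.

Lemma hull_hexagon (a : nat) : hull (vertices R (Hexagon a)) =
  octagon8 (- a%:R) 2 0 (a%:R + 2) 0 4 (- 2 - 2 * a%:R) 2.
Proof.
have a0 : 0 <= a%:R :> R by rewrite ler0n.
apply: hull_eqP; first exact: octagon8_convex.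
  move=> p; rewrite !inE.
  by repeat (case/orP => [/eqP->|]); last move=> /eqP->;
    rewrite /octagon8 /=; split; lra.
move=> D sD Ds.
have D1 : D (0, 0) by apply: Ds; rewrite !inE eqxx ?orbT.
have D2 : D (2, 0) by apply: Ds; rewrite !inE eqxx ?orbT.
have D3 : D (2, 2) by apply: Ds; rewrite !inE eqxx ?orbT.
have D4 : D (2 - a%:R, 2 + a%:R) by apply: Ds; rewrite !inE eqxx ?orbT.
have D5 : D (- a%:R, 2 + a%:R) by apply: Ds; rewrite !inE eqxx ?orbT.
have D6 : D (- a%:R, a%:R) by apply: Ds; rewrite !inE eqxx ?orbT.
have := @octagon_sub_segment_closed 0 a%:R D (lexx _) a0 sD.
by rewrite !(mulr0, addr0, add0r, subr0, oppr0) (addrC a%:R 2); apply.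
Qed.

Lemma hull_diamond : hull (vertices R Diamond) =
  octagon8 (- 1) 1 0 2 0 2 (- 2) 0.
Proof.
apply: hull_eqP; first exact: octagon8_convex.
  move=> p; rewrite !inE.
  by repeat (case/orP => [/eqP->|]); last move=> /eqP->;
    rewrite /octagon8 /=; split; lra.
move=> D sD Ds.
have D1 : D (0, 0) by apply: Ds; rewrite !inE eqxx ?orbT.
have D2 : D (1, 1) by apply: Ds; rewrite !inE eqxx ?orbT.
have D3 : D (0, 2) by apply: Ds; rewrite !inE eqxx ?orbT.
have D4 : D (-1, 1) by apply: Ds; rewrite !inE eqxx ?orbT.
move=> [x y] [/= hx hy hs hd].
have [y1|y1] := lerP y 1.
  apply: (@hsegE D (- y) y) => //; try lra.
    have := sD 0 0 (-1) 1 1 y; rewrite !add0r !mulr1 !mulrN1.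
    by apply => //; lra.
  have := sD 0 0 1 1 1 y; rewrite !add0r !mulr1.
  by apply => //; lra.
apply: (@hsegE D (y - 2) (2 - y)) => //; try lra.
  have := sD (-1) 1 1 1 1 (y - 1); rewrite !mulr1.
  rewrite (_ : -1 + (y - 1) = y - 2); last by ring.
  rewrite (_ : 1 + (y - 1) = y); last by ring.
  rewrite (_ : -1 + 1 = 0 :> R); last by ring.
  by apply => //; lra.
have := sD 1 1 (-1) 1 1 (y - 1); rewrite !mulr1 !mulrN1.
rewrite (_ : 1 - (y - 1) = 2 - y); last by ring.
rewrite (_ : 1 + (y - 1) = y); last by ring.
rewrite (_ : 1 - 1 = 0 :> R); last by ring.
by apply => //; lra.
Qed.

Lemma hull_trapezoid (a : nat) : hull (vertices R (Trapezoid a)) =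
  octagon8 0 (2 * a%:R + 2) 0 a%:R 0 (2 * a%:R + 2) 0 (2 * a%:R + 2).
Proof.
have a0 : 0 <= a%:R :> R by rewrite ler0n.
apply: hull_eqP; first exact: octagon8_convex.
  move=> p; rewrite !inE.
  by repeat (case/orP => [/eqP->|]); last move=> /eqP->;
    rewrite /octagon8 /=; split; lra.
move=> D sD Ds.
have D1 : D (0, 0) by apply: Ds; rewrite !inE eqxx ?orbT.
have D2 : D (2 * a%:R + 2, 0) by apply: Ds; rewrite !inE eqxx ?orbT.
have D3 : D (a%:R + 2, a%:R) by apply: Ds; rewrite !inE eqxx ?orbT.
have D4 : D (a%:R, a%:R) by apply: Ds; rewrite !inE eqxx ?orbT.
move=> [x y] [/= hx hy hs hd].
apply: (@hsegE D y (2 * a%:R + 2 - y)) => //; try lra.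
  have := sD 0 0 1 1 a%:R y; rewrite !add0r !mulr1.
  by apply => //; lra.
have := sD (2 * a%:R + 2) 0 (-1) 1 a%:R y; rewrite !mulr1 !mulrN1 !add0r.
rewrite (_ : 2 * a%:R + 2 - a%:R = a%:R + 2); last by ring.
by apply => //; lra.
Qed.

Lemma hull_triangle (a : nat) : hull (vertices R (Triangle a)) =
  octagon8 0 a%:R 0 a%:R 0 a%:R (- a%:R) a%:R.
Proof.
have a0 : 0 <= a%:R :> R by rewrite ler0n.
apply: hull_eqP; first exact: octagon8_convex.
  move=> p; rewrite !inE.
  by repeat (case/orP => [/eqP->|]); last move=> /eqP->;
    rewrite /octagon8 /=; split; lra.
move=> D sD Ds.
have D1 : D (0, 0) by apply: Ds; rewrite !inE eqxx ?orbT.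
have D2 : D (a%:R, 0) by apply: Ds; rewrite !inE eqxx ?orbT.
have D3 : D (0, a%:R) by apply: Ds; rewrite !inE eqxx ?orbT.
move=> [x y] [/= hx hy hs hd].
apply: (@hsegE D 0 (a%:R - y)) => //; try lra.
  have := sD 0 0 0 1 a%:R y; rewrite !add0r !mulr1 !mulr0.
  by apply => //; lra.
have := sD a%:R 0 (-1) 1 a%:R y; rewrite !mulr1 !mulrN1 !add0r subrr.
by apply => //; lra.
Qed.

Lemma quarter_turn_octagon8 x1 x2 y1 y2 s1 s2 d1 d2 :
  @quarter_turn R @` octagon8 x1 x2 y1 y2 s1 s2 d1 d2 =
  octagon8 (- y2) (- y1) x1 x2 d1 d2 (- s2) (- s1).
Proof.
apply/seteqP; split=> [_ [[x y] [/= hx hy hs hd] <-]|[x y] [/= hx hy hs hd]].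
  by rewrite /quarter_turn /=; split => /=; lra.
exists (y, - x); last by rewrite /quarter_turn /= opprK.
by split => /=; lra.
Qed.

Lemma shift_octagon8 (v : plane) x1 x2 y1 y2 s1 s2 d1 d2 :
  (fun p => p + v) @` octagon8 x1 x2 y1 y2 s1 s2 d1 d2 =
  octagon8 (x1 + v.1) (x2 + v.1) (y1 + v.2) (y2 + v.2)
    (s1 + (v.1 + v.2)) (s2 + (v.1 + v.2)) (d1 + (v.1 - v.2)) (d2 + (v.1 - v.2)).
Proof.
case: v => vx vy.
apply/seteqP; split=> [_ [[x y] [/= hx hy hs hd] <-]|[x y] [/= hx hy hs hd]].
  by split => /=; lra.
exists (x - vx, y - vy); first by split => /=; lra.
by apply: injective_projections => /=; ring.
Qed.

Lemma octagon8_strict_interior x1 x2 y1 y2 s1 s2 d1 d2 (z : plane) :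
  x1 < z.1 < x2 -> y1 < z.2 < y2 -> s1 < z.1 + z.2 < s2 ->
  d1 < z.1 - z.2 < d2 -> interior (octagon8 x1 x2 y1 y2 s1 s2 d1 d2) z.
Proof.
case: z => x y /= /andP[hx1 hx2] /andP[hy1 hy2] /andP[hs1 hs2] /andP[hd1 hd2].
(* The factor 2 is there because x + y and x - y move by up to twice the change of a coordinate. *)
have [e e0 [H1 H2 H3 H4]] : exists2 e : R, 0 < e &
  [/\ 2 * e <= x - x1 /\ 2 * e <= x2 - x, 2 * e <= y - y1 /\ 2 * e <= y2 - y,
    2 * e <= x + y - s1 /\ 2 * e <= s2 - (x + y)
    & 2 * e <= x - y - d1 /\ 2 * e <= d2 - (x - y)].
  have mn : forall u v : R, 0 < u -> 0 < v -> exists2 e, 0 < e & e <= u /\ e <= v.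
    move=> u v u0 v0; have [uv|uv] := lerP u v; [exists u | exists v]; lra.
  have [] := mn (x - x1) (x2 - x); try lra; move=> a1 ? [? ?].
  have [] := mn (y - y1) (y2 - y); try lra; move=> a2 ? [? ?].
  have [] := mn (x + y - s1) (s2 - (x + y)); try lra; move=> a3 ? [? ?].
  have [] := mn (x - y - d1) (d2 - (x - y)); try lra; move=> a4 ? [? ?].
  have [] := mn a1 a2; try lra; move=> b1 ? [? ?].
  have [] := mn a3 a4; try lra; move=> b2 ? [? ?].
  have [] := mn b1 b2; try lra; move=> c1 ? [? ?].
  by exists (c1 / 2); [lra | split; lra].
apply/nbhs_ballP; exists e => //= -[x' y'] [/= bx by_].
move: bx by_; rewrite /ball /= !ltr_norml => /andP[? ?] /andP[? ?].
by split => /=; lra.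
Qed.

(** From an interior point one can still move along [e], where [L] grows at unit rate. *)
Lemma interior_strict (L : plane -> R) (e : plane) (A : set plane) (c : R) (z : plane) :
  (forall p t, L (p.1 + t * e.1, p.2 + t * e.2) = L p + t) ->
  (forall p, A p -> L p <= c) -> interior A z -> L z < c.
Proof.
move=> LE AL /nbhs_ballP[r /= r0 zA].
have [k k0 kr] : exists2 k : R, 0 < k & k * (`|e.1| + `|e.2| + 1) < r.
  exists (r / 2 / (`|e.1| + `|e.2| + 1)); first by rewrite !divr_gt0 // ltr_wpDl // addr_ge0.
  rewrite divfK; first by lra.
  by rewrite gt_eqF // ltr_wpDl // addr_ge0.
have /AL : A (z.1 + k * e.1, z.2 + k * e.2).
  apply: zA; split; rewrite /ball /= opprD addNKr normrN normrM (gtr0_norm k0);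
    apply: le_lt_trans kr; rewrite ler_pM2l //.
    by rewrite -addrA lerDl addr_ge0.
  by rewrite -addrA addrCA lerDl addr_ge0.
by rewrite LE; lra.
Qed.

End Hulls.

Local Ltac oct_eq := congr (octagon8 _ _ _ _ _ _ _ _); rewrite /=; lra.

(** * Tiles in the coordinates s and d *)

(* The coordinates are s = x + y + 2 and d = x - y, so that the rectangle is
   2 <= s + d <= 2 M - 2, 2 <= s - d <= 2 N - 2 with M = m + 1 and N = n + 1.
   [Dia ws wd] is the diamond of centre (ws, wd). [Blk a1 a2 b1 b2] is the
   octagon around the block [a1, a2] x [b1, b2], clipped to the rectangle: it is
   a square, hexagon or octagon of the paper when nothing is clipped, a
   trapezoid when the block is symmetric with respect to one of the mirrors
   s + d = 0, s + d = 2 M, s - d = 0, s - d = 2 N, which lie at distance 1 from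
   the sides of the rectangle, and a triangle when it is symmetric with respect
   to two of them. *)
Inductive tile (K : Type) := Dia of K & K | Blk of K & K & K & K.

Section TileData.
Variables (K : realDomainType) (M N : K).

Definition inrect (s d : K) :=
  [&& 2 <= s + d, s + d <= 2 * M - 2, 2 <= s - d & s - d <= 2 * N - 2].

Definition inoct (t : tile K) (s d : K) :=
  match t with
  | Dia ws wd => [&& ws - 1 <= s, s <= ws + 1, wd - 1 <= d & d <= wd + 1]
  | Blk a1 a2 b1 b2 =>
      [&& a1 - 2 <= s, s <= a2 + 2, b1 - 2 <= d, d <= b2 + 2,
          a1 + b1 - 2 <= s + d, s + d <= a2 + b2 + 2,
          a1 - b2 - 2 <= s - d & s - d <= a2 - b1 + 2]
  end.

Definition inC (t : tile K) (s d : K) := inrect s d && inoct t s d.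

Definition admissible (t : tile K) : bool :=
  match t with
  | Dia ws wd =>
      [&& 4 <= ws + wd, ws + wd <= 2 * M - 4, 4 <= ws - wd
        & ws - wd <= 2 * N - 4]
  | Blk a1 a2 b1 b2 =>
      [&& a1 <= a2, b1 <= b2,
          (4 <= a1 + b1) || [&& a1 == - b2, a2 == - b1 & a1 + 2 <= a2],
          (a2 + b2 <= 2 * M - 4) ||
            [&& a1 == 2 * M - b2, a2 == 2 * M - b1 & a1 + 2 <= a2],
          (4 <= a1 - b2) || [&& a1 == b1, a2 == b2 & a1 + 2 <= a2]
        & (a2 - b1 <= 2 * N - 4) ||
            [&& a1 == b1 + 2 * N, a2 == b2 + 2 * N & a1 + 2 <= a2]]
  end.

Definition steps (t : tile K) : Prop :=
  match t with
  | Dia _ _ => True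
  | Blk a1 a2 b1 b2 =>
      exists a b : nat, a2 = a1 + 2 * a%:R /\ b2 = b1 + 2 * b%:R
  end.

End TileData.

(** * Walls of the rectangle and moved prototiles *)

Section Boundary.
Variables (R : realType) (m n : nat).
Local Notation plane := (R * R)%type.
Local Notation M := (m%:R + 1 : R).
Local Notation N := (n%:R + 1 : R).
Local Notation Q := (rectangle R m n).

Definition sf (z : plane) : R := z.1 + z.2 + 2.
Definition df (z : plane) : R := z.1 - z.2.

Definition reg (t : tile R) : set plane := [set z | inC M N t (sf z) (df z)].

Lemma rectangleE (z : plane) : Q z = inrect M N (sf z) (df z) :> Prop.
Proof.
rewrite /rectangle /inrect /sf /df /=; apply/propext; split.
  by rewrite !in_itv /= => -[/andP[? ?] /andP[? ?]]; apply/and4P; split; lra.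
by case/and4P=> *; rewrite !in_itv /=; split; lra.
Qed.

Lemma rectangle_octagon8 : Q = octagon8 0 (m%:R - 1) 0 (n%:R - 1)
  0 (m%:R + n%:R - 2) (1 - n%:R) (m%:R - 1).
Proof.
apply/seteqP; split=> -[x y] ; rewrite /rectangle /= !in_itv /=.
  by move=> [/andP[? ?] /andP[? ?]]; split => /=; lra.
by move=> [/= /andP[? ?] /andP[? ?] _ _]; lra.
Qed.

Lemma boundary_wall (z : plane) : boundary Q z -> Q z ->
  [\/ z.1 = 0, z.1 = m%:R - 1, z.2 = 0 | z.2 = n%:R - 1].
Proof.
move=> [_ niz] Qz; apply: contrapT => nw; apply: niz.
move: Qz; rewrite rectangle_octagon8; case: z nw => x y nw [/= h1 h2 _ _].
have x0 : x != 0 by apply: contra_notN nw => /eqP ->; constructor 1.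
have x1 : x != m%:R - 1 by apply: contra_notN nw => /eqP ->; constructor 2.
have y0 : y != 0 by apply: contra_notN nw => /eqP ->; constructor 3.
have y1 : y != n%:R - 1 by apply: contra_notN nw => /eqP ->; constructor 4.
by apply: octagon8_strict_interior => /=; lra.
Qed.

Lemma wall_boundary (z : plane) : Q z ->
  [\/ z.1 = 0, z.1 = m%:R - 1, z.2 = 0 | z.2 = n%:R - 1] -> boundary Q z.
Proof.
move=> Qz w; split; first exact: subset_closure.
move=> iz.
have b1 : - z.1 < 0.
  apply: (@interior_strict R (fun p => - p.1) (-1, 0) Q) iz.
    by move=> p t /=; ring.
  by move=> p; rewrite rectangle_octagon8 => -[? ? ? ?]; lra.
have b2 : z.1 < m%:R - 1.
  apply: (@interior_strict R (fun p => p.1) (1, 0) Q) iz.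
    by move=> p t /=; ring.
  by move=> p; rewrite rectangle_octagon8 => -[? ? ? ?]; lra.
have b3 : - z.2 < 0.
  apply: (@interior_strict R (fun p => - p.2) (0, -1) Q) iz.
    by move=> p t /=; ring.
  by move=> p; rewrite rectangle_octagon8 => -[? ? ? ?]; lra.
have b4 : z.2 < n%:R - 1.
  apply: (@interior_strict R (fun p => p.2) (0, 1) Q) iz.
    by move=> p t /=; ring.
  by move=> p; rewrite rectangle_octagon8 => -[? ? ? ?]; lra.
by case: w; lra.
Qed.

(** A family of regions with two marked points, the midpoints of the dashed sides when there are
    any. Closure under one quarter turn and under translations makes the motions of a prototile an
    induction. *)
Definition turn_closed (F : set plane -> plane -> plane -> Prop) :=
  (forall P q r, F P q r -> F (@quarter_turn R @` P) (quarter_turn q) (quarter_turn r)) /\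
  (forall P q r v, F P q r -> F ((fun p => p + v) @` P) (q + v) (r + v)).

Lemma motion_image k v (A : set plane) :
  motion k v @` A =
  (fun p => p + v) @` iter k (fun B => @quarter_turn R @` B) A.
Proof.
have H : iter k (fun B => @quarter_turn R @` B) A = iter k (@quarter_turn R) @` A.
  elim: k => [|k IH] /=; first by rewrite image_id.
  by rewrite IH -image_comp.
by rewrite H image_comp.
Qed.

Lemma turn_closed_motion F k v P q r : turn_closed F -> F P q r ->
  F (motion k v @` P) (motion k v q) (motion k v r).
Proof.
move=> [Fq Fv] FP; rewrite motion_image; apply: Fv.
by elim: k => [//|k IH] /=; exact: Fq.
Qed.

(** Squares, hexagons and octagons at once, since [a] and [b] may be 0; a quarter turn exchanges
    them. *)
Definition octagon_at (P : set plane) (_ _ : plane) :=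
  exists (x y : R) (a b : nat), P = octagon8 x (x + 2 + a%:R + b%:R)
    y (y + 2 + a%:R + b%:R) (x + y + b%:R) (x + y + 4 + 2 * a%:R + b%:R)
    (x - y - 2 - b%:R) (x - y + 2 + b%:R).

Definition diamond_at (P : set plane) (_ _ : plane) :=
  exists x y : R, P = octagon8 (x - 1) (x + 1) (y - 1) (y + 1)
    (x + y - 1) (x + y + 1) (x - y - 1) (x - y + 1).

(** Here [q] is the midpoint of the long base, and [l1] to [l4] are its distances to the left,
    right, lower and upper ends of the bounding box. *)
Definition trapezoid_at (P : set plane) (q _ : plane) :=
  exists (a : nat) (l1 l2 l3 l4 : R),
  [/\ (0 < a)%N, P = octagon8 (q.1 - l1) (q.1 + l2) (q.2 - l3) (q.2 + l4)
    (q.1 + q.2 - a%:R - 1) (q.1 + q.2 + a%:R + 1)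
    (q.1 - q.2 - a%:R - 1) (q.1 - q.2 + a%:R + 1)
   & [\/ [/\ l1 = a%:R + 1, l2 = a%:R + 1, l3 = 0 & l4 = a%:R],
         [/\ l1 = a%:R, l2 = 0, l3 = a%:R + 1 & l4 = a%:R + 1],
         [/\ l1 = a%:R + 1, l2 = a%:R + 1, l3 = a%:R & l4 = 0]
       | [/\ l1 = 0, l2 = a%:R, l3 = a%:R + 1 & l4 = a%:R + 1]]].

Definition triangle_at (P : set plane) (q r : plane) :=
  exists (a : nat) (x y : R), (0 < a)%N /\
  [\/ [/\ P = octagon8 x (x + a%:R) y (y + a%:R) (x + y) (x + y + a%:R)
             (x - y - a%:R) (x - y + a%:R),
          q = (x + a%:R / 2, y) & r = (x, y + a%:R / 2)],
      [/\ P = octagon8 (x - a%:R) x y (y + a%:R) (x + y - a%:R) (x + y + a%:R)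
             (x - y - a%:R) (x - y),
          q = (x, y + a%:R / 2) & r = (x - a%:R / 2, y)],
      [/\ P = octagon8 (x - a%:R) x (y - a%:R) y (x + y - a%:R) (x + y)
             (x - y - a%:R) (x - y + a%:R),
          q = (x - a%:R / 2, y) & r = (x, y - a%:R / 2)]
    | [/\ P = octagon8 x (x + a%:R) (y - a%:R) y (x + y - a%:R) (x + y + a%:R)
             (x - y) (x - y + a%:R),
          q = (x, y - a%:R / 2) & r = (x + a%:R / 2, y)]].

Lemma octagon_at_closed : turn_closed octagon_at.
Proof.
split=> P ? ? => [|v] [x [y [a [b ->]]]].
  exists (- y - 2 - a%:R - b%:R), x, b, a.
  by rewrite quarter_turn_octagon8; oct_eq.
exists (x + v.1), (y + v.2), a, b.
by rewrite shift_octagon8; oct_eq.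
Qed.

Lemma diamond_at_closed : turn_closed diamond_at.
Proof.
split=> P ? ? => [|v] [x [y ->]].
  by exists (- y), x; rewrite quarter_turn_octagon8; oct_eq.
by exists (x + v.1), (y + v.2); rewrite shift_octagon8; oct_eq.
Qed.

Lemma trapezoid_at_closed : turn_closed trapezoid_at.
Proof.
split=> P q ? => [|v] [a [l1 [l2 [l3 [l4 [a0 -> h]]]]]].
  exists a, l4, l3, l1, l2; split => //.
    by rewrite quarter_turn_octagon8 /quarter_turn /=; oct_eq.
  case: h => -[h1 h2 h3 h4]; subst.
  - by constructor 2.
  - by constructor 3.
  - by constructor 4.
  - by constructor 1.
exists a, l1, l2, l3, l4; split => //.
by rewrite shift_octagon8 /=; oct_eq.
Qed.

Lemma triangle_at_closed : turn_closed triangle_at.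
Proof.
split=> P q r => [|v] [a [x [y [a0 h]]]].
  exists a, (- y), x; split => //.
  case: h => -[-> -> ->]; rewrite quarter_turn_octagon8 /quarter_turn /=;
  [constructor 2|constructor 3|constructor 4|constructor 1]; split;
  try (by oct_eq);
  by apply: injective_projections => /=; lra.
exists a, (x + v.1), (y + v.2); split => //.
case: h => -[-> -> ->]; rewrite shift_octagon8 /=;
  [constructor 1|constructor 2|constructor 3|constructor 4]; split;
  try (by oct_eq);
  by apply: injective_projections => /=; lra.
Qed.

Lemma octagon8_reg x1 x2 y1 y2 s1 s2 d1 d2 t :
  octagon8 x1 x2 y1 y2 s1 s2 d1 d2 `<=` Q ->
  (forall x y, octagon8 x1 x2 y1 y2 s1 s2 d1 d2 (x, y) ->
     inoct t (x + y + 2) (x - y)) ->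
  (forall x y, inC M N t (x + y + 2) (x - y) ->
     octagon8 x1 x2 y1 y2 s1 s2 d1 d2 (x, y)) ->
  octagon8 x1 x2 y1 y2 s1 s2 d1 d2 = reg t.
Proof.
move=> sQ H1 H2; apply/seteqP; split=> -[x y]; last exact: H2.
by move=> Pz; apply/andP; split; [rewrite -rectangleE; exact: sQ | exact: H1].
Qed.

End Boundary.

Local Ltac clear_ineqs := repeat match goal with H : is_true _ |- _ => clear H end.

Local Ltac reg_eq := apply: octagon8_reg => //; clear_ineqs => x' y'; rewrite /octagon8 /=;
  [by move=> [? ? ? ?]; lra
  |by rewrite /inC /inrect /inoct => ?; apply/and4P; lra].

(** * From moved prototiles to admissible tiles and back *)

Section TileRegions.
Variables (R : realType) (m n : nat).
Local Notation plane := (R * R)%type.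
Local Notation M := (m%:R + 1 : R).
Local Notation N := (n%:R + 1 : R).
Local Notation Q := (rectangle R m n).
Local Notation reg := (@reg R m n).
Local Notation adm := (@admissible R M N).

Lemma diamond_adm P q r : diamond_at P q r -> P `<=` Q ->
  exists t, [/\ adm t, steps t & P = reg t].
Proof.
move=> [x [y ->]] sQ.
have T : forall u v, octagon8 (x - 1) (x + 1) (y - 1) (y + 1)
    (x + y - 1) (x + y + 1) (x - y - 1) (x - y + 1) (u, v) ->
    [/\ 0 <= u, u <= m%:R - 1, 0 <= v & v <= n%:R - 1].
  move=> u v /sQ; rewrite rectangle_octagon8 => -[/= /andP[? ?] /andP[? ?] _ _].
  by [].
have [] := T (x - 1) y; first by split => /=; lra.
move=> ? ? ? ?.
have [] := T (x + 1) y; first by split => /=; lra.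
move=> ? ? ? ?.
have [] := T x (y - 1); first by split => /=; lra.
move=> ? ? ? ?.
have [] := T x (y + 1); first by split => /=; lra.
move=> ? ? ? ?.
exists (Dia (x + y + 2) (x - y)); split => //; first by rewrite /admissible; lra.
by reg_eq.
Qed.

Lemma octagon_adm P q r : octagon_at P q r -> P `<=` Q ->
  exists t, [/\ adm t, steps t & P = reg t].
Proof.
move=> [x [y [a [b ->]]]] sQ.
have a0 : 0 <= a%:R :> R by rewrite ler0n.
have b0 : 0 <= b%:R :> R by rewrite ler0n.
have T : forall u v, octagon8 x (x + 2 + a%:R + b%:R)
    y (y + 2 + a%:R + b%:R) (x + y + b%:R) (x + y + 4 + 2 * a%:R + b%:R)
    (x - y - 2 - b%:R) (x - y + 2 + b%:R) (u, v) ->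
    [/\ 0 <= u, u <= m%:R - 1, 0 <= v & v <= n%:R - 1].
  move=> u v /sQ; rewrite rectangle_octagon8 => -[/= /andP[? ?] /andP[? ?] _ _].
  by [].
have [] := T x (y + b%:R); first by split => /=; lra.
move=> ? ? ? ?.
have [] := T (x + 2 + a%:R + b%:R) (y + a%:R); first by split => /=; lra.
move=> ? ? ? ?.
have [] := T (x + b%:R) y; first by split => /=; lra.
move=> ? ? ? ?.
have [] := T (x + a%:R) (y + 2 + a%:R + b%:R); first by split => /=; lra.
move=> ? ? ? ?.
exists (Blk (x + y + b%:R + 4) (x + y + b%:R + 4 + 2 * a%:R)
   (x - y - b%:R) (x - y + b%:R)); split.
- by rewrite /admissible; lra.
- by exists a, b; split; lra.
- by reg_eq.
Qed.

(** The midpoint of the long base pins down the wall: points of the tile on both sides of it along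
    the base, and away from the base, exclude all walls but one. The block is centred on the mirror
    behind that wall. *)
Lemma trapezoid_adm P q r : trapezoid_at P q r -> P `<=` Q -> boundary Q q ->
  exists t, [/\ adm t, steps t & P = reg t].
Proof.
move=> [a [l1 [l2 [l3 [l4 [a0 -> h]]]]]] sQ bq.
have a1 : 1 <= a%:R :> R by rewrite (ler_nat R 1).
have T : forall u v, octagon8 (q.1 - l1) (q.1 + l2) (q.2 - l3) (q.2 + l4)
    (q.1 + q.2 - a%:R - 1) (q.1 + q.2 + a%:R + 1)
    (q.1 - q.2 - a%:R - 1) (q.1 - q.2 + a%:R + 1) (u, v) ->
    [/\ 0 <= u, u <= m%:R - 1, 0 <= v & v <= n%:R - 1].
  move=> u v /sQ; rewrite rectangle_octagon8 => -[/= /andP[? ?] /andP[? ?] _ _].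
  by [].
have qQ : Q q.
  apply: sQ; case: q bq T => x y _ _; rewrite /octagon8 /=.
  by case: h => -[-> -> -> ->]; split; lra.
have {}bq := boundary_wall bq qQ.
case: q bq T qQ sQ => x y /= bq T qQ sQ.
case: h => -[h1 h2 h3 h4]; subst.
- have [] := T (x - a%:R - 1) y; first by split => /=; lra.
  move=> ? ? ? ?.
  have [] := T (x + a%:R + 1) y; first by split => /=; lra.
  move=> ? ? ? ?.
  have [] := T x (y + a%:R); first by split => /=; lra.
  move=> ? ? ? ?.
  have y0 : y = 0 by case: bq; lra.
  subst; exists (Blk (x - a%:R + 1) (x + a%:R + 1) (x - a%:R + 1) (x + a%:R + 1)); split.
  + by rewrite /admissible; lra.
  + by exists a, a; split; lra.
  + by reg_eq.
- have [] := T x (y - a%:R - 1); first by split => /=; lra.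
  move=> ? ? ? ?.
  have [] := T x (y + a%:R + 1); first by split => /=; lra.
  move=> ? ? ? ?.
  have [] := T (x - a%:R) y; first by split => /=; lra.
  move=> ? ? ? ?.
  have y0 : x = m%:R - 1 by case: bq; lra.
  subst; exists (Blk (m%:R + 2 + y - a%:R) (m%:R + 2 + y + a%:R) (m%:R - y - a%:R) (m%:R - y + a%:R)); split.
  + by rewrite /admissible; lra.
  + by exists a, a; split; lra.
  + by reg_eq.
- have [] := T (x - a%:R - 1) y; first by split => /=; lra.
  move=> ? ? ? ?.
  have [] := T (x + a%:R + 1) y; first by split => /=; lra.
  move=> ? ? ? ?.
  have [] := T x (y - a%:R); first by split => /=; lra.
  move=> ? ? ? ?.
  have y0 : y = n%:R - 1 by case: bq; lra.
  subst; exists (Blk (x + n%:R + 2 - a%:R) (x + n%:R + 2 + a%:R) (x - n%:R - a%:R) (x - n%:R + a%:R)); split.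
  + by rewrite /admissible; lra.
  + by exists a, a; split; lra.
  + by reg_eq.
- have [] := T x (y - a%:R - 1); first by split => /=; lra.
  move=> ? ? ? ?.
  have [] := T x (y + a%:R + 1); first by split => /=; lra.
  move=> ? ? ? ?.
  have [] := T (x + a%:R) y; first by split => /=; lra.
  move=> ? ? ? ?.
  have y0 : x = 0 by case: bq; lra.
  subst; exists (Blk (y - a%:R + 1) (y + a%:R + 1) (- y - a%:R - 1) (- y + a%:R - 1)); split.
  + by rewrite /admissible; lra.
  + by exists a, a; split; lra.
  + by reg_eq.
Qed.

(** Each leg finds its own wall, so the right angle is a corner of the rectangle and the block is
    centred where two mirrors cross. *)
Lemma triangle_adm P q r : triangle_at P q r -> P `<=` Q ->
  boundary Q q -> boundary Q r ->
  exists t, [/\ adm t, steps t & P = reg t].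
Proof.
move=> [a [x [y [a0 h]]]] sQ bq br.
have a1 : 1 <= a%:R :> R by rewrite (ler_nat R 1).
have T : forall u v, P (u, v) ->
    [/\ 0 <= u, u <= m%:R - 1, 0 <= v & v <= n%:R - 1].
  move=> u v /sQ; rewrite rectangle_octagon8 => -[/= /andP[? ?] /andP[? ?] _ _].
  by [].
have qQ : Q q by apply: sQ; case: h => -[-> -> _]; split => /=; lra.
have rQ : Q r by apply: sQ; case: h => -[-> _ ->]; split => /=; lra.
have {}bq := boundary_wall bq qQ.
have {}br := boundary_wall br rQ.
clear qQ rQ.
case: h => -[? ? ?]; subst; rewrite /= in bq br.
- have [] := T (x + a%:R) y; first by split => /=; lra.
  move=> ? ? ? ?.
  have [] := T x (y + a%:R); first by split => /=; lra.
  move=> ? ? ? ?.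
  have ? : y = 0 by case: bq; lra.
  have ? : x = 0 by case: br; lra.
  subst; exists (Blk (- a%:R) a%:R (- a%:R) a%:R); split.
  + by rewrite /admissible; lra.
  + by exists a, a; split; lra.
  + by reg_eq.
- have [] := T (x - a%:R) y; first by split => /=; lra.
  move=> ? ? ? ?.
  have [] := T x (y + a%:R); first by split => /=; lra.
  move=> ? ? ? ?.
  have ? : y = 0 by case: br; lra.
  have ? : x = m%:R - 1 by case: bq; lra.
  subst; exists (Blk (m%:R + 1 - a%:R) (m%:R + 1 + a%:R) (m%:R + 1 - a%:R) (m%:R + 1 + a%:R)); split.
  + by rewrite /admissible; lra.
  + by exists a, a; split; lra.
  + by reg_eq.
- have [] := T (x - a%:R) y; first by split => /=; lra.
  move=> ? ? ? ?.
  have [] := T x (y - a%:R); first by split => /=; lra.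
  move=> ? ? ? ?.
  have ? : y = n%:R - 1 by case: bq; lra.
  have ? : x = m%:R - 1 by case: br; lra.
  subst; exists (Blk (m%:R + n%:R + 2 - a%:R) (m%:R + n%:R + 2 + a%:R)
     (m%:R - n%:R - a%:R) (m%:R - n%:R + a%:R)); split.
  + by rewrite /admissible; lra.
  + by exists a, a; split; lra.
  + by reg_eq.
- have [] := T (x + a%:R) y; first by split => /=; lra.
  move=> ? ? ? ?.
  have [] := T x (y - a%:R); first by split => /=; lra.
  move=> ? ? ? ?.
  have ? : y = n%:R - 1 by case: br; lra.
  have ? : x = 0 by case: bq; lra.
  subst; exists (Blk (n%:R + 1 - a%:R) (n%:R + 1 + a%:R)
     (- a%:R - n%:R - 1) (a%:R - n%:R - 1)); split.
  + by rewrite /admissible; lra.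
  + by exists a, a; split; lra.
  + by reg_eq.
Qed.

Lemma hull_midpoint (p q : plane) : hull [:: p; q] ((p.1 + q.1) / 2, (p.2 + q.2) / 2).
Proof.
move=> D [/convex_segment_closed cD pqD].
have [Dp Dq] : D p /\ D q by split; apply: pqD; rewrite /= !inE eqxx ?orbT.
case: p q Dp Dq {pqD} => [px py] [qx qy] Dp Dq /=.
have := cD px py (qx - px) (qy - py) 1 2^-1.
rewrite !mul1r !(addrC px) !(addrC py) !subrK.
move=> /(_ Dp Dq); rewrite (_ : (qx + px) / 2 = 2^-1 * (qx - px) + px); last by lra.
by rewrite (_ : (qy + py) / 2 = 2^-1 * (qy - py) + py); [apply; lra | lra].
Qed.

Lemma is_tile_adm P : is_tile Q P -> P `<=` Q ->
  exists t, [/\ adm t, steps t & P = reg t].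
Proof.
move=> [t [k [v [tp -> dsh]]]] sQ; case: t tp dsh sQ => [||a b|a|a|a] tp dsh sQ.
- have F : octagon_at (hull (vertices R Square)) 0 0.
    by exists 0, 0, 0%N, 0%N; rewrite hull_square; oct_eq.
  exact: octagon_adm (turn_closed_motion k v (octagon_at_closed R) F) sQ.
- have F : diamond_at (hull (vertices R Diamond)) 0 0.
    by exists 0, 1; rewrite hull_diamond; oct_eq.
  exact: diamond_adm (turn_closed_motion k v (diamond_at_closed R) F) sQ.
- have F : octagon_at (hull (vertices R (Octagon a b))) 0 0.
    by exists (- b%:R), 0, a, b; rewrite hull_octagon; oct_eq.
  exact: octagon_adm (turn_closed_motion k v (octagon_at_closed R) F) sQ.
- have F : octagon_at (hull (vertices R (Hexagon a))) 0 0.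
    by exists (- a%:R), 0, 0%N, a; rewrite hull_hexagon; oct_eq.
  exact: octagon_adm (turn_closed_motion k v (octagon_at_closed R) F) sQ.
- have F : trapezoid_at (hull (vertices R (Trapezoid a))) (a%:R + 1, 0) 0.
    exists a, (a%:R + 1), (a%:R + 1), 0, a%:R; split => //; last by constructor 1.
    by rewrite hull_trapezoid; oct_eq.
  apply: trapezoid_adm (turn_closed_motion k v (trapezoid_at_closed R) F) sQ _.
  apply: (dsh 0%N) => //; exists (a%:R + 1, 0) => //; rewrite /side /=.
  have := @hull_midpoint (0, 0) (2 * a%:R + 2, 0).
  by congr (hull _ (_, _)); rewrite /=; lra.
- have F : triangle_at (hull (vertices R (Triangle a))) (a%:R / 2, 0) (0, a%:R / 2).
    exists a, 0, 0; split => //; constructor 1; split; first by rewrite hull_triangle; oct_eq.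
      by rewrite add0r.
    by rewrite add0r.
  apply: triangle_adm (turn_closed_motion k v (triangle_at_closed R) F) sQ _ _.
    apply: (dsh 0%N) => //; exists (a%:R / 2, 0) => //; rewrite /side /=.
    have := @hull_midpoint (0, 0) (a%:R, 0).
    by congr (hull _ (_, _)); rewrite /=; lra.
  apply: (dsh 2%N) => //; exists (0, a%:R / 2) => //; rewrite /side /=.
  have := @hull_midpoint (0, a%:R) (0, 0).
  by congr (hull _ (_, _)); rewrite /=; lra.
Qed.

Lemma octagon8_sub_rectangle x1 x2 y1 y2 s1 s2 d1 d2 :
  0 <= x1 -> x2 <= m%:R - 1 -> 0 <= y1 -> y2 <= n%:R - 1 ->
  octagon8 x1 x2 y1 y2 s1 s2 d1 d2 `<=` Q.
Proof.
move=> ? ? ? ? [x y] [/= ? ? _ _]; rewrite rectangle_octagon8; split => /=; lra.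
Qed.

Lemma side_trapezoid a (w : plane) : side (vertices R (Trapezoid a)) 0 w ->
  0 <= w.1 <= 2 * a%:R + 2 /\ w.2 = 0.
Proof.
have a0 : @Order.le _ R 0 a%:R by rewrite ler0n.
move=> sw; have [] : octagon8 0 (2 * a%:R + 2) 0 0 0 (2 * a%:R + 2) 0 (2 * a%:R + 2) w.
  apply: sw; split; first exact: octagon8_convex.
  by move=> p; rewrite /= !inE => /orP[]/eqP ->; split => /=; lra.
by move=> ? ? _ _; split => //; lra.
Qed.

Lemma side_triangle0 a (w : plane) : side (vertices R (Triangle a)) 0 w ->
  0 <= w.1 <= a%:R /\ w.2 = 0.
Proof.
have a0 : @Order.le _ R 0 a%:R by rewrite ler0n.
move=> sw; have [] : octagon8 0 a%:R 0 0 0 a%:R 0 a%:R w.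
  apply: sw; split; first exact: octagon8_convex.
  by move=> p; rewrite /= !inE => /orP[]/eqP ->; split => /=; lra.
by move=> ? ? _ _; split => //; lra.
Qed.

Lemma side_triangle2 a (w : plane) : side (vertices R (Triangle a)) 2 w ->
  w.1 = 0 /\ 0 <= w.2 <= a%:R.
Proof.
have a0 : @Order.le _ R 0 a%:R by rewrite ler0n.
move=> sw; have [] : octagon8 0 0 0 a%:R 0 a%:R (- a%:R) 0 w.
  apply: sw; split; first exact: octagon8_convex.
  by move=> p; rewrite /= !inE => /orP[]/eqP ->; split => /=; lra.
by move=> ? ? _ _; split => //; lra.
Qed.

(** A vanishing diagonal side turns the octagon into a hexagon, in one of its two orientations, and
    two of them into a square. *)
Lemma is_tile_octagon x y (a b : nat) :
  is_tile Q (octagon8 x (x + 2 + a%:R + b%:R) y (y + 2 + a%:R + b%:R)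
    (x + y + b%:R) (x + y + 4 + 2 * a%:R + b%:R) (x - y - 2 - b%:R) (x - y + 2 + b%:R)).
Proof.
case: a b => [|a] [|b].
- exists Square, 0%N, (x, y); split => //.
  by rewrite motion_image /= hull_square shift_octagon8; oct_eq.
- exists (Hexagon b.+1), 0%N, (x + b.+1%:R, y); split => //.
  by rewrite motion_image /= hull_hexagon shift_octagon8; oct_eq.
- exists (Hexagon a.+1), 1%N, (x + a.+1%:R + 2, y + a.+1%:R); split => //.
  by rewrite motion_image /= hull_hexagon quarter_turn_octagon8 shift_octagon8; oct_eq.
- exists (Octagon a.+1 b.+1), 0%N, (x + b.+1%:R, y); split => //.
  by rewrite motion_image /= hull_octagon shift_octagon8; oct_eq.
Qed.

Lemma is_tile_diamond x y : is_tile Q (octagon8 (x - 1) (x + 1) (y - 1) (y + 1)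
    (x + y - 1) (x + y + 1) (x - y - 1) (x - y + 1)).
Proof.
exists Diamond, 0%N, (x, y - 1); split => //.
by rewrite motion_image /= hull_diamond shift_octagon8; oct_eq.
Qed.

Tactic Notation "wall" integer(c) := apply: wall_boundary; [rewrite rectangle_octagon8; split => /=; lra
  | constructor c; rewrite /=; lra].

Section Clipped.
Variable a : nat.
Hypothesis a0 : (0 < a)%N.

Let a1 : @Order.le _ R 1 a%:R. Proof. by rewrite (ler_nat R 1). Qed.

Lemma is_tile_trapezoid (q : plane) (l1 l2 l3 l4 : R) :
  let P := octagon8 (q.1 - l1) (q.1 + l2) (q.2 - l3) (q.2 + l4)
    (q.1 + q.2 - a%:R - 1) (q.1 + q.2 + a%:R + 1)
    (q.1 - q.2 - a%:R - 1) (q.1 - q.2 + a%:R + 1) in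
  P `<=` Q ->
  [\/ [/\ l1 = a%:R + 1, l2 = a%:R + 1, l3 = 0, l4 = a%:R & q.2 = 0],
      [/\ l1 = a%:R, l2 = 0, l3 = a%:R + 1, l4 = a%:R + 1 & q.1 = m%:R - 1],
      [/\ l1 = a%:R + 1, l2 = a%:R + 1, l3 = a%:R, l4 = 0 & q.2 = n%:R - 1]
    | [/\ l1 = 0, l2 = a%:R, l3 = a%:R + 1, l4 = a%:R + 1 & q.1 = 0]] ->
  is_tile Q P.
Proof.
have a1' := a1; case: q => x y P sQ h; have {}sQ u v : P (u, v) ->
    [/\ 0 <= u, u <= m%:R - 1, 0 <= v & v <= n%:R - 1].
  by move=> /sQ; rewrite rectangle_octagon8 => -[/= /andP[? ?] /andP[? ?] _ _].
move: sQ; rewrite /P; case: h => -[-> -> -> -> /= ->] sQ.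
- exists (Trapezoid a), 0%N, (x - a%:R - 1, 0); split => //.
    by rewrite motion_image /= hull_trapezoid shift_octagon8; oct_eq.
  have [] := sQ (x - a%:R - 1) 0; first by split => /=; lra.
  have [] := sQ (x + a%:R + 1) 0; first by split => /=; lra.
  move=> ? ? ? ? ? ? ? ? i; rewrite inE => /eqP -> _ [[u v] /side_trapezoid[/= ? ?] <-].
  by rewrite /motion /=; wall 3.
- exists (Trapezoid a), 1%N, (m%:R - 1, y - a%:R - 1); split => //.
    by rewrite motion_image /= hull_trapezoid quarter_turn_octagon8 shift_octagon8; oct_eq.
  have [] := sQ (m%:R - 1) (y - a%:R - 1); first by split => /=; lra.
  have [] := sQ (m%:R - 1) (y + a%:R + 1); first by split => /=; lra.
  move=> ? ? ? ? ? ? ? ? i; rewrite inE => /eqP -> _ [[u v] /side_trapezoid[/= ? ?] <-].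
  by rewrite /motion /=; wall 2.
- exists (Trapezoid a), 2%N, (x + a%:R + 1, n%:R - 1); split => //.
    by rewrite motion_image /= hull_trapezoid !quarter_turn_octagon8 shift_octagon8; oct_eq.
  have [] := sQ (x - a%:R - 1) (n%:R - 1); first by split => /=; lra.
  have [] := sQ (x + a%:R + 1) (n%:R - 1); first by split => /=; lra.
  move=> ? ? ? ? ? ? ? ? i; rewrite inE => /eqP -> _ [[u v] /side_trapezoid[/= ? ?] <-].
  by rewrite /motion /=; wall 4.
- exists (Trapezoid a), 3%N, (0, y + a%:R + 1); split => //.
    by rewrite motion_image /= hull_trapezoid !quarter_turn_octagon8 shift_octagon8; oct_eq.
  have [] := sQ 0 (y - a%:R - 1); first by split => /=; lra.
  have [] := sQ 0 (y + a%:R + 1); first by split => /=; lra.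
  move=> ? ? ? ? ? ? ? ? i; rewrite inE => /eqP -> _ [[u v] /side_trapezoid[/= ? ?] <-].
  by rewrite /motion /=; wall 1.
Qed.

Lemma is_tile_triangle : a%:R <= m%:R - 1 :> R -> a%:R <= n%:R - 1 :> R ->
  [/\ is_tile Q (octagon8 0 a%:R 0 a%:R 0 a%:R (- a%:R) a%:R),
      is_tile Q (octagon8 (m%:R - 1 - a%:R) (m%:R - 1) 0 a%:R
        (m%:R - 1 - a%:R) (m%:R - 1 + a%:R) (m%:R - 1 - a%:R) (m%:R - 1)),
      is_tile Q (octagon8 (m%:R - 1 - a%:R) (m%:R - 1) (n%:R - 1 - a%:R) (n%:R - 1)
        (m%:R + n%:R - 2 - a%:R) (m%:R + n%:R - 2)
        (m%:R - n%:R - a%:R) (m%:R - n%:R + a%:R))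
    & is_tile Q (octagon8 0 a%:R (n%:R - 1 - a%:R) (n%:R - 1)
        (n%:R - 1 - a%:R) (n%:R - 1 + a%:R) (1 - n%:R) (1 - n%:R + a%:R))].
Proof.
have a1' := a1 => am an; split.
- exists (Triangle a), 0%N, (0, 0); split => //.
    by rewrite motion_image /= hull_triangle shift_octagon8; oct_eq.
  move=> i; rewrite !inE => /orP[]/eqP -> z.
    by case=> [[u v] /side_triangle0[/= ? ?] <-]; rewrite /motion /=; wall 3.
  by case=> [[u v] /side_triangle2[/= ? ?] <-]; rewrite /motion /=; wall 1.
- exists (Triangle a), 1%N, (m%:R - 1, 0); split => //.
    by rewrite motion_image /= hull_triangle quarter_turn_octagon8 shift_octagon8; oct_eq.
  move=> i; rewrite !inE => /orP[]/eqP -> z.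
    by case=> [[u v] /side_triangle0[/= ? ?] <-]; rewrite /motion /=; wall 2.
  by case=> [[u v] /side_triangle2[/= ? ?] <-]; rewrite /motion /=; wall 3.
- exists (Triangle a), 2%N, (m%:R - 1, n%:R - 1); split => //.
    by rewrite motion_image /= hull_triangle !quarter_turn_octagon8 shift_octagon8; oct_eq.
  move=> i; rewrite !inE => /orP[]/eqP -> z.
    by case=> [[u v] /side_triangle0[/= ? ?] <-]; rewrite /motion /=; wall 4.
  by case=> [[u v] /side_triangle2[/= ? ?] <-]; rewrite /motion /=; wall 2.
- exists (Triangle a), 3%N, (0, n%:R - 1); split => //.
    by rewrite motion_image /= hull_triangle !quarter_turn_octagon8 shift_octagon8; oct_eq.
  move=> i; rewrite !inE => /orP[]/eqP -> z.
    by case=> [[u v] /side_triangle0[/= ? ?] <-]; rewrite /motion /=; wall 1.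
  by case=> [[u v] /side_triangle2[/= ? ?] <-]; rewrite /motion /=; wall 4.
Qed.

End Clipped.

Ltac region_eq := apply: octagon8_reg;
  [apply: octagon8_sub_rectangle; rewrite /=; lra
  |clear_ineqs => x' y' [/= ? ? ? ?]; rewrite /inoct; lra
  |clear_ineqs => x' y'; rewrite /inC /inrect /inoct => ?; apply/and4P; rewrite /=; lra].

Lemma is_tile_reg t : adm t -> steps t -> is_tile Q (reg t).
Proof.
case: t => [ws wd|a1 a2 b1 b2]; rewrite /admissible.
  move=> ? _; have := is_tile_diamond ((ws + wd) / 2 - 1) ((ws - wd) / 2 - 1).
  congr (is_tile Q _); apply: octagon8_reg.
  - by apply: octagon8_sub_rectangle; lra.
  - by clear_ineqs => x y [/= ? ? ? ?]; rewrite /inoct; lra.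
  - by clear_ineqs => x y; rewrite /inC /inrect /inoct => ?; apply/and4P; rewrite /=; lra.
case/and5P => hA hB HL HR /andP[HD HU] [a [b [ea eb]]].
have a_pos : a1 + 2 <= a2 -> (0 < a)%N by move=> ?; rewrite -(ltr_nat R); lra.
have m0 : @Order.le _ R 0 m%:R by rewrite ler0n.
have n0 : @Order.le _ R 0 n%:R by rewrite ler0n.
(* Of the sixteen ways of being clipped by the four walls, nine are consistent: no wall, one wall,
   or two adjacent walls. *)
case/orP: HL => [HL|/and3P[/eqP e1 /eqP e2 h]]; case/orP: HR => [HR|/and3P[/eqP e3 /eqP e4 hr]];
case/orP: HD => [HD|/and3P[/eqP e5 /eqP e6 hd]]; case/orP: HU => [HU|/and3P[/eqP e7 /eqP e8 hu]];
try (by exfalso; clear a_pos; lra).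
- have := is_tile_octagon ((a1 + b1) / 2 - 2) ((a1 - b2) / 2 - 2) a b.
  by congr (is_tile Q _); region_eq.
- rename hu into h.
  have := @is_tile_trapezoid a (a_pos h) (a1 - n%:R - 2 + a%:R, n%:R - 1) (a%:R + 1) (a%:R + 1) a%:R 0 _ _.
  move=> /(_ ltac:(by apply: octagon8_sub_rectangle => /=; lra)).
  move=> /(_ ltac:(by constructor 3)); congr (is_tile Q _).
  by region_eq.
- rename hd into h.
  have := @is_tile_trapezoid a (a_pos h) (a1 + a%:R - 1, 0) (a%:R + 1) (a%:R + 1) 0 a%:R _ _.
  move=> /(_ ltac:(by apply: octagon8_sub_rectangle => /=; lra)).
  move=> /(_ ltac:(by constructor 1)); congr (is_tile Q _).
  by region_eq.
- rename hr into h.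
  have := @is_tile_trapezoid a (a_pos h) (m%:R - 1, a1 - m%:R - 2 + a%:R) a%:R 0 (a%:R + 1) (a%:R + 1) _ _.
  move=> /(_ ltac:(by apply: octagon8_sub_rectangle => /=; lra)).
  move=> /(_ ltac:(by constructor 2)); congr (is_tile Q _).
  by region_eq.
- rename hr into h.
  have [_ _ T _] := is_tile_triangle (a_pos h) ltac:(lra) ltac:(lra).
  by move: T; congr (is_tile Q _); region_eq.
- rename hr into h.
  have [_ T _ _] := is_tile_triangle (a_pos h) ltac:(lra) ltac:(lra).
  by move: T; congr (is_tile Q _); region_eq.
- have := @is_tile_trapezoid a (a_pos h) (0, a1 + a%:R - 1) 0 a%:R (a%:R + 1) (a%:R + 1) _ _.
  move=> /(_ ltac:(by apply: octagon8_sub_rectangle => /=; lra)).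
  move=> /(_ ltac:(by constructor 4)); congr (is_tile Q _).
  by region_eq.
- have [_ _ _ T] := is_tile_triangle (a_pos h) ltac:(lra) ltac:(lra).
  by move: T; congr (is_tile Q _); region_eq.
- have [T _ _ _] := is_tile_triangle (a_pos h) ltac:(lra) ltac:(lra).
  by move: T; congr (is_tile Q _); region_eq.
Qed.

End TileRegions.

Local Ltac blra := try apply/eqP; lra.

(** * Germs of tiles at a point *)

Section Germs.
Variables (R : realType) (m n : nat).
Local Notation plane := (R * R)%type.
Local Notation M := (m%:R + 1 : R).
Local Notation N := (n%:R + 1 : R).
Local Notation Q := (rectangle R m n).
Local Notation reg := (@reg R m n).
(** The outer normals as indices, so that walls and tile sides are entries of one list of
    constraints. *)
Definition lform (i : nat) (s d : R) : R :=
  match i with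
  | 0 => - s | 1 => s | 2 => - d | 3 => d
  | 4 => - s - d | 5 => s + d | 6 => d - s | _ => s - d
  end.

Definition rect_constraints : seq (nat * R) :=
  [:: (4%N, - 2); (5%N, 2 * M - 2); (6%N, - 2); (7%N, 2 * N - 2)].

Definition tile_constraints (t : tile R) : seq (nat * R) :=
  match t with
  | Dia ws wd => [:: (0%N, 1 - ws); (1%N, ws + 1); (2%N, 1 - wd); (3%N, wd + 1)]
  | Blk a1 a2 b1 b2 =>
    [:: (0%N, 2 - a1); (1%N, a2 + 2); (2%N, 2 - b1); (3%N, b2 + 2);
        (4%N, 2 - a1 - b1); (5%N, a2 + b2 + 2); (6%N, 2 - a1 + b2); (7%N, a2 - b1 + 2)]
  end.

Definition constraints t := rect_constraints ++ tile_constraints t.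

Definition sat (z : plane) (c : nat * R) := lform c.1 (sf z) (df z) <= c.2.
Definition ssat (z : plane) (c : nat * R) := lform c.1 (sf z) (df z) < c.2.
Definition tight (z : plane) (c : nat * R) := lform c.1 (sf z) (df z) == c.2.

Lemma rectangle_sat z : Q z = all (sat z) rect_constraints :> Prop.
Proof.
rewrite rectangleE /inrect /sat /=; congr is_true.
by apply/idP/idP => [/and4P[? ? ? ?]|/and5P[? ? ? ? _]]; rewrite ?andbT;
  apply/and4P; split; lra.
Qed.

Lemma inoct_sat t z : inoct t (sf z) (df z) = all (sat z) (tile_constraints t).
Proof.
case: t => [ws wd|a1 a2 b1 b2]; rewrite /sat /=; apply/idP/idP.
- by case/and4P=> *; rewrite ?andbT; apply/and4P; split; lra.
- by case/and5P=> *; apply/and4P; split; lra.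
- by do 7 (case/andP=> ?); move=> ?; repeat (apply/andP; split) => //; lra.
- by do 8 (case/andP=> ?); move=> _; repeat (apply/andP; split); lra.
Qed.

Lemma reg_sat t z : reg t z = all (sat z) (constraints t) :> Prop.
Proof.
have E : inrect M N (sf z) (df z) = all (sat z) rect_constraints.
  by apply/idP/idP; rewrite -rectangleE rectangle_sat.
by rewrite -[reg t z]/(is_true (inC M N t (sf z) (df z))) /inC E inoct_sat -all_cat.
Qed.

Lemma reg_sub t : reg t `<=` Q.
Proof. by move=> z /andP[? _]; rewrite rectangleE. Qed.

Lemma formD i (s d s' d' : R) : lform i (s + s') (d + d') = lform i s d + lform i s' d'.
Proof. by move: i => [|[|[|[|[|[|[|i]]]]]]] /=; ring. Qed.

Lemma formZ i (e s d : R) : lform i (e * s) (e * d) = e * lform i s d.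
Proof. by move: i => [|[|[|[|[|[|[|i]]]]]]] /=; ring. Qed.

Definition slope i (u : plane) : R := lform i (u.1 + u.2) (u.1 - u.2).

Definition shiftp (z : plane) (e : R) (u : plane) : plane :=
  (z.1 + e * u.1, z.2 + e * u.2).

Lemma form_shiftp i z e u :
  lform i (sf (shiftp z e u)) (df (shiftp z e u)) = lform i (sf z) (df z) + e * slope i u.
Proof.
rewrite /slope -formZ -formD; congr lform; rewrite /sf /df /shiftp /=; ring.
Qed.

(** A germ at 0 from the right: asking for all small [e], not just some, lets finitely many such
    statements hold at a common [e]. *)
Definition small (P : R -> Prop) := exists2 e0, 0 < e0 & forall e, 0 < e <= e0 -> P e.

Lemma smallP (P : R -> Prop) : small P -> exists2 e, 0 < e & P e.
Proof. by case=> e e0 H; exists e => //; apply: H; rewrite e0 lexx. Qed.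

Lemma smallI P P' : small P -> small P' -> small (fun e => P e /\ P' e).
Proof.
move=> [e e0 H] [e' e0' H']; have [ee|ee] := lerP e e'.
  by exists e => // x xe; split; [apply: H | apply: H']; lra.
by exists e' => // x xe; split; [apply: H | apply: H']; lra.
Qed.

Lemma small_all (T : eqType) (s : seq T) (P : T -> R -> Prop) :
  (forall x, x \in s -> small (P x)) -> small (fun e => forall x, x \in s -> P x e).
Proof.
elim: s => [|x s IH] H; first by exists 1.
have [] := smallI (H x (mem_head _ _)) (IH _).
  by move=> y ys; apply: H; rewrite inE ys orbT.
move=> e e0 He; exists e => // e' /He[H1 H2] y; rewrite inE => /orP[/eqP->|] //.
exact: H2.
Qed.

Lemma small_lt (b x w : R) : x < b -> small (fun e => x + e * w < b).
Proof.
move=> xb; exists ((b - x) / (2 * (`|w| + 1))).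
  by rewrite divr_gt0 ?subr_gt0 // mulr_gt0 // ltr_wpDl.
move=> e /andP[e0]; rewrite ler_pdivlMr; last by rewrite mulr_gt0 // ltr_wpDl.
by have := ler_norm w; nra.
Qed.

(** A wall and a side of the tile with the same normal share the index [i]; either of them may be
    the tight one. *)
Definition active t (z : plane) i :=
  has (fun c => (c.1 == i) && tight z c) (constraints t).

Definition ractive (z : plane) i :=
  has (fun c => (c.1 == i) && tight z c) rect_constraints.

Lemma ractive_active t z i : ractive z i -> active t z i.
Proof. by rewrite /ractive /active has_cat => ->. Qed.

Lemma active_lt8 t z i : active t z i -> (i < 8)%N.
Proof.
case/hasP=> c + /andP[/eqP <- _]; rewrite mem_cat.
case/orP; first by rewrite !inE => /or4P[]/eqP->.
case: t => [ws wd|a1 a2 b1 b2].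
  by rewrite !inE => /or4P[]/eqP->.
by rewrite !inE; do 7 (case/orP; first by move/eqP->); move/eqP->.
Qed.

Lemma small_constraint (cs : seq (nat * R)) z u : all (sat z) cs ->
  (forall c, c \in cs -> tight z c -> slope c.1 u <= 0) ->
  small (fun e => all (sat (shiftp z e u)) cs).
Proof.
move=> zc H.
suff [e e0 He] : small (fun e => forall c, c \in cs -> sat (shiftp z e u) c).
  by exists e => // x /He xe; apply/allP.
apply: small_all => c cc; rewrite /sat.
have := allP zc _ cc; rewrite /sat le_eqVlt => /orP[tc|lc].
  exists 1 => // e /andP[e0 _]; rewrite form_shiftp (eqP tc).
  by have := H _ cc tc; nra.
have [e e0 He] := small_lt (slope c.1 u) lc.
by exists e => // x /He; rewrite form_shiftp => /ltW.
Qed.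

Lemma small_sconstraint (cs : seq (nat * R)) z u : all (sat z) cs ->
  (forall c, c \in cs -> tight z c -> slope c.1 u < 0) ->
  small (fun e => all (ssat (shiftp z e u)) cs).
Proof.
move=> zc H.
suff [e e0 He] : small (fun e => forall c, c \in cs -> ssat (shiftp z e u) c).
  by exists e => // x /He xe; apply/allP.
apply: small_all => c cc; rewrite /ssat.
have := allP zc _ cc; rewrite /sat le_eqVlt => /orP[tc|lc].
  exists 1 => // e /andP[e0 _]; rewrite form_shiftp (eqP tc).
  by have := H _ cc tc; nra.
have [e e0 He] := small_lt (slope c.1 u) lc.
by exists e => // x /He; rewrite form_shiftp.
Qed.

Lemma small_in t z u : reg t z -> (forall i, active t z i -> slope i u <= 0) ->
  small (fun e => reg t (shiftp z e u)).
Proof.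
rewrite reg_sat => zt H; have [] := @small_constraint (constraints t) z u zt.
  by move=> c cc tc; apply: H; apply/hasP; exists c => //; rewrite eqxx.
by move=> e e0 He; exists e => // x /He; rewrite reg_sat.
Qed.

Definition sreg t : set plane := [set z | all (ssat z) (constraints t)].

Lemma small_sreg t z u : reg t z -> (forall i, active t z i -> slope i u < 0) ->
  small (fun e => sreg t (shiftp z e u)).
Proof.
rewrite reg_sat => zt H; apply: small_sconstraint => // c cc tc.
by apply: H; apply/hasP; exists c => //; rewrite eqxx.
Qed.

Lemma sreg_reg t : sreg t `<=` reg t.
Proof.
by move=> z; rewrite reg_sat => /allP H; apply/allP => c /H /ltW.
Qed.

Lemma sreg_interior t : sreg t `<=` interior (reg t).
Proof.
move=> z /allP zt.
have [e e0 He] : small (fun e => forall c, c \in constraints t ->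
    forall z', `|z'.1 - z.1| < e -> `|z'.2 - z.2| < e -> sat z' c).
  apply: small_all => c /zt; rewrite /ssat => lt; exists ((c.2 - lform c.1 (sf z) (df z)) / 4).
    by rewrite divr_gt0 ?subr_gt0.
  move=> e; rewrite ler_pdivlMr // => /andP[e0 ee] z'.
  rewrite !ltr_norml /sat => /andP[? ?] /andP[? ?].
  move: ee lt; case: (c) => i k /=; rewrite /lform /sf /df.
  by move: i => [|[|[|[|[|[|[|i]]]]]]] /=; lra.
apply/nbhs_ballP; exists e => //= z' [/=]; rewrite /ball /= => z1 z2.
rewrite reg_sat; apply/allP => c cc.
by apply: (He e) => //; [rewrite e0 lexx | rewrite distrC | rewrite distrC].
Qed.

Lemma interior_sreg t : interior (reg t) `<=` sreg t.
Proof.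
move=> z iz; apply/allP => c cc.
pose L (p : plane) := lform c.1 (sf p) (df p).
have HL : forall p, reg t p -> L p <= c.2.
  by move=> p; rewrite reg_sat => /allP /(_ _ cc).
rewrite /ssat -/(L z).
have [w Lw] : exists w : plane, slope c.1 w = 1.
  rewrite /slope; case: (c.1) => [|[|[|[|[|[|[|i]]]]]]] /=;
    [exists (-1, 0)|exists (1, 0)|exists (0, 1)|exists (0, -1)
    |exists (-2^-1, 0)|exists (2^-1, 0)|exists (0, -2^-1)|exists (0, 2^-1)] => /=;
  lra.
apply: (@interior_strict R L w (reg t)) HL iz => p e.
by have := form_shiftp c.1 p e w; rewrite /shiftp /L Lw mulr1.
Qed.

(* The sector j at a point is the open angle between the directions of
   angles 45 j and 45 (j + 1) degrees; it is cut off by the half-planes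
   [lform i <= c] through the point with i in [cuts j]. *)
Definition cuts (j : nat) : seq nat :=
  match j with
  | 0 => [:: 1; 3; 5; 7] | 1 => [:: 1; 2; 5; 7] | 2 => [:: 1; 2; 4; 7]
  | 3 => [:: 0; 2; 4; 7] | 4 => [:: 0; 2; 4; 6] | 5 => [:: 0; 3; 4; 6]
  | 6 => [:: 0; 3; 5; 6] | _ => [:: 1; 3; 5; 6]
  end%N.

(** One direction inside each sector, off the eight axes, so that no form is constant along it. *)
Definition dir (j : nat) : plane :=
  match j with
  | 0 => (2, 1) | 1 => (1, 2) | 2 => (-1, 2) | 3 => (-2, 1)
  | 4 => (-2, -1) | 5 => (-1, -2) | 6 => (1, -2) | _ => (2, -1)
  end.

Lemma slope_dir i j : (i < 8)%N -> (slope i (dir j) < 0) = (i \notin cuts j) /\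
  (0 < slope i (dir j)) = (i \in cuts j).
Proof.
move=> i8; rewrite /slope.
do 8 (case: i i8 => [|i] i8;
  [by case: j => [|[|[|[|[|[|[|j]]]]]]] /=; split; apply/idP/idP => //; lra |]).
by [].
Qed.

(** Near one of its points a tile is the cone of its tight constraints. The boundary lines of this
    cone are axis-parallel or diagonal, so a sector is either inside the cone or disjoint from
    it. *)
Definition owns t z j := all (fun i => ~~ active t z i) (cuts j).
Definition rowns z j := all (fun i => ~~ ractive z i) (cuts j).

Lemma owns_rowns t z j : owns t z j -> rowns z j.
Proof.
by move=> /allP H; apply/allP => i /H; apply: contra; exact: ractive_active.
Qed.

Lemma owns_small t z j : reg t z -> owns t z j ->
  small (fun e => sreg t (shiftp z e (dir j))).
Proof.
move=> zt /allP H; apply: small_sreg => // i ai.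
rewrite (slope_dir j (active_lt8 ai)).1.
by apply/negP => /H; rewrite ai.
Qed.

Lemma nowns_small t z j : ~ (reg t z /\ owns t z j) ->
  small (fun e => ~ reg t (shiftp z e (dir j))).
Proof.
move=> H; have [zt|zt] := pselect (reg t z).
  have /allPn[i ij /negPn ai] : ~~ owns t z j by apply/negP => o; apply: H.
  exists 1 => // e /andP[e0 _]; rewrite reg_sat => /allP He.
  have := active_lt8 ai => i8; case/hasP: (ai) => c cc /andP[/eqP ci tc].
  have := He _ cc; rewrite /sat form_shiftp (eqP tc) ci.
  have := (slope_dir j i8).2; rewrite ij => sl.
  by nra.
move: zt; rewrite reg_sat => /negP /allPn[c cc]; rewrite /sat -ltNge => lc.
have lc' : - lform c.1 (sf z) (df z) < - c.2 by rewrite ltrN2.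
have [e e0 He] := small_lt (- slope c.1 (dir j)) lc'.
exists e => // x /He; rewrite reg_sat => lx /allP /(_ _ cc).
rewrite /sat form_shiftp; nra.
Qed.

Lemma rowns_small z j : Q z -> rowns z j ->
  small (fun e => Q (shiftp z e (dir j))).
Proof.
rewrite rectangle_sat => zt /allP H.
have [] := @small_constraint rect_constraints z (dir j) zt.
  move=> c cc tc; have ra : ractive z c.1 by apply/hasP; exists c; rewrite ?eqxx.
  have i8 : (c.1 < 8)%N by move: cc; rewrite !inE => /or4P[]/eqP->.
  by apply/ltW; rewrite (slope_dir j i8).1; apply/negP => /H; rewrite ra.
by move=> e e0 He; exists e => // x /He; rewrite rectangle_sat.
Qed.

End Germs.

(** * Points on two sides of a tile *)

Section Vertices.
Variables (F : realType) (M N a1 a2 b1 b2 s d : F).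

(* The half-planes are numbered as in [lform]. *)
Definition touches (i : nat) : bool :=
  match i with
  | 0 => s == a1 - 2 :> F | 1 => s == a2 + 2 :> F | 2 => d == b1 - 2 :> F | 3 => d == b2 + 2 :> F
  | 4 => (s + d == 2 :> F) || (s + d == a1 + b1 - 2 :> F)
  | 5 => (s + d == 2 * M - 2 :> F) || (s + d == a2 + b2 + 2 :> F)
  | 6 => (s - d == 2 :> F) || (s - d == a1 - b2 - 2 :> F)
  | _ => (s - d == 2 * N - 2 :> F) || (s - d == a2 - b1 + 2 :> F)
  end.

(** All sides of the tile through the point lie in walls; when there are two of them, the point is a
    corner of the rectangle. *)
Definition corner_like : bool :=
  [&& a1 - 2 < s < a2 + 2, b1 - 2 < d < b2 + 2,
   touches 4 ==> (s + d == 2 :> F), touches 5 ==> (s + d == 2 * M - 2 :> F),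
   touches 6 ==> (s - d == 2 :> F) & touches 7 ==> (s - d == 2 * N - 2 :> F)].

Definition vertex_like : bool :=
  [|| s == a1 - 2 :> F, s == a1 :> F, s == a2 :> F | s == a2 + 2 :> F] &&
  [|| d == b1 - 2 :> F, d == b1 :> F, d == b2 :> F | d == b2 + 2 :> F].

(** On the sides [s == a1 - 2] and [s == a2 + 2] the octagon has b1 <= d <= b2, so sides 0, 1 never
    meet sides 2, 3. Where a side meets a clipping wall, mirror symmetry supplies the missing
    coordinate: s + d = 2 and d = b2 + 2 give s = - b2 = a1. *)
Lemma touches_vertex i i' : 3 <= M -> 3 <= N ->
  admissible M N (Blk a1 a2 b1 b2) -> inC M N (Blk a1 a2 b1 b2) s d ->
  (i < i' < 8)%N -> touches i -> touches i' -> vertex_like || corner_like.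
Proof.
move=> hM hN; rewrite /admissible /inC /inrect /inoct.
case/and5P => hA hB HL HR /andP[HD HU].
case/andP => /and4P[r1 r2 r3 r4].
case/andP => c1; case/andP => c2; case/andP => c3; case/andP => c4.
case/andP => c5; case/andP => c6; case/andP => c7 c8.
have S : touches 0 || touches 1 -> b1 <= d <= b2.
  by clear hM hN hA hB HL HR HD HU r1 r2 r3 r4 c1 c2 c3 c4; rewrite /touches => ?; lra.
have D : touches 2 || touches 3 -> a1 <= s <= a2.
  by clear hM hN hA hB HL HR HD HU r1 r2 r3 r4 c1 c2 c3 c4; rewrite /touches => ?; lra.
have SX : touches 0 || touches 1 -> (4 <= i' < 8)%N -> touches i' -> vertex_like.
  move=> hs; move: (S hs) => hd; clear S D hM hN r1 r2 r3 r4 c1 c2 c3 c4 c5 c6 c7 c8.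
  move: hs; rewrite /vertex_like.
  case: i' => [|[|[|[|[|[|[|[|i']]]]]]]] //= hs _ t'.
  + by clear HR HD HU; lra.
  + by clear HL HD HU; lra.
  + by clear HL HR HU; lra.
  + by clear HL HR HD; lra.
have DX : touches 2 || touches 3 -> (4 <= i' < 8)%N -> touches i' -> vertex_like.
  move=> hs; move: (D hs) => hd; clear S D SX hM hN r1 r2 r3 r4 c1 c2 c3 c4 c5 c6 c7 c8.
  move: hs; rewrite /vertex_like.
  case: i' => [|[|[|[|[|[|[|[|i']]]]]]]] //= hs _ t'.
  + by clear HR HD HU; lra.
  + by clear HL HD HU; lra.
  + by clear HL HR HU; lra.
  + by clear HL HR HD; lra.
case: i => [|[|[|[|[|[|[|i]]]]]]] /andP[ii i8] t t'.
- have t01 : touches 0 || touches 1 by rewrite t.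
  case: (ltnP 3 i') => i3; first by rewrite SX // i3.
  move: (S t01); case: i' ii i3 {i8 S D SX DX HL HR HD HU} t' => [|[|[|[|i']]]] //= _ _ t' hd;
    move: t => /= t; clear hM hN hB r1 r2 r3 r4 c1 c2 c3 c4 c5 c6 c7 c8; lra.
- have t01 : touches 0 || touches 1 by rewrite t orbT.
  case: (ltnP 3 i') => i3; first by rewrite SX // i3.
  move: (S t01); case: i' ii i3 {i8 S D SX DX HL HR HD HU} t' => [|[|[|[|i']]]] //= _ _ t' hd;
    move: t => /= t; clear hM hN hB r1 r2 r3 r4 c1 c2 c3 c4 c5 c6 c7 c8; lra.
- have t01 : touches 2 || touches 3 by rewrite t.
  case: (ltnP 3 i') => i3; first by rewrite DX // i3.
  move: (D t01); case: i' ii i3 {i8 S D SX DX HL HR HD HU} t' => [|[|[|[|i']]]] //= _ _ t' hd;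
    move: t => /= t; clear hM hN hA r1 r2 r3 r4 c1 c2 c3 c4 c5 c6 c7 c8; lra.
- have t01 : touches 2 || touches 3 by rewrite t orbT.
  case: (ltnP 3 i') => i3; first by rewrite DX // i3.
  by case: i' ii i3 {i8 S D SX DX HL HR HD HU} t' => [|[|[|[|i']]]].
- case: i' ii i8 t' {S D SX DX} => [|[|[|[|[|[|[|[|i']]]]]]]] //= _ _ t';
    move: t => /= t; rewrite /vertex_like /corner_like /=.
  + by clear HD HU r3 r4 c1 c2 c3 c4 c7 c8; lra.
  + by clear HR HU hN r2 r4 c6 c8; lra.
  + by clear HR HD hN r2 r3 c6 c7; lra.
- case: i' ii i8 t' {S D SX DX} => [|[|[|[|[|[|[|[|i']]]]]]]] //= _ _ t';
    move: t => /= t; rewrite /vertex_like /corner_like /=.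
  + by clear HL HU hN r1 r4 c5 c8; lra.
  + by clear HL HD hN r1 r3 c5 c7; lra.
- case: i' ii i8 t' {S D SX DX} => [|[|[|[|[|[|[|[|i']]]]]]]] //= _ _ t';
    move: t => /= t; rewrite /vertex_like /corner_like /=.
  by clear HL HR r1 r2 c1 c2 c3 c4 c5 c6; lra.
- by case: i' ii i8 {S D SX DX} t' => [|[|[|[|[|[|[|[|i']]]]]]]].
Qed.

End Vertices.

(** * Vertices modulo 2 and extremal points of a tile *)

Section Corners.
Variables (R : realType) (m n : nat).
Local Notation plane := (R * R)%type.
Local Notation M := (m%:R + 1 : R).
Local Notation N := (n%:R + 1 : R).
Local Notation reg := (@reg R m n).

Hypothesis m2 : (2 <= m)%N.
Hypothesis n2 : (2 <= n)%N.

Local Notation adm := (@admissible R M N).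
Local Notation sreg := (@sreg R m n).
Local Notation active := (@active R m n).
Local Notation ractive := (@ractive R m n).
Local Notation owns := (@owns R m n).

Let m2r : @Order.le _ R 2 m%:R. Proof. by rewrite ler_nat. Qed.
Let n2r : @Order.le _ R 2 n%:R. Proof. by rewrite ler_nat. Qed.

Definition cong2 (x y : R) : Prop := exists k : int, x = y + 2 * k%:~R.

Lemma cong2_sym x y : cong2 x y -> cong2 y x.
Proof. by case=> k ->; exists (- k); rewrite intrN; ring. Qed.

Lemma cong2_trans y x z : cong2 x y -> cong2 y z -> cong2 x z.
Proof. by case=> k -> [l ->]; exists (k + l); rewrite intrD; ring. Qed.

(** A reference point for the vertices modulo 2. Those of a diamond differ from its centre by 1 in
    both coordinates, hence the shift. *)
Definition base (t : tile R) : R * R :=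
  match t with Dia ws wd => (ws + 1, wd + 1) | Blk a1 _ b1 _ => (a1, b1) end.

Definition congr_pt (p q : R * R) : Prop := cong2 p.1 q.1 /\ cong2 p.2 q.2.

Lemma congr_pt_sym p q : congr_pt p q -> congr_pt q p.
Proof. by case=> *; split; exact: cong2_sym. Qed.

Lemma congr_pt_trans q p r : congr_pt p q -> congr_pt q r -> congr_pt p r.
Proof. by move=> [h1 h2] [h3 h4]; split; [exact: cong2_trans h3 | exact: cong2_trans h4]. Qed.

Definition sd (z : plane) : R * R := (sf z, df z).

Lemma activeE a1 a2 b1 b2 z i : active (Blk a1 a2 b1 b2) z i ->
  touches M N a1 a2 b1 b2 (sf z) (df z) i.
Proof.
rewrite /active /tight.
move: i => [|[|[|[|[|[|[|[|i]]]]]]]] /=; rewrite ?orbF; set s := sf z; set d := df z.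
all: try by [].
- by move=> /eqP ?; apply/eqP; lra.
- by move=> /eqP ?; apply/eqP; lra.
- by case/orP => /eqP ?; apply/orP; [left|right]; apply/eqP; lra.
- by case/orP => /eqP ?; apply/orP; [left|right]; apply/eqP; lra.
Qed.

Lemma ractiveE z i : ractive z i = match i with
  | 4 => sf z + df z == 2 :> R | 5 => sf z + df z == 2 * M - 2 :> R
  | 6 => sf z - df z == 2 :> R | 7 => sf z - df z == 2 * N - 2 :> R | _ => false end.
Proof.
rewrite /ractive /tight.
move: i => [|[|[|[|[|[|[|[|i]]]]]]]] //=; rewrite ?orbF /=; apply/idP/idP => ?; blra.
Qed.

(** At such a point the tile occupies every sector that the rectangle does. *)
Definition right_corner t (z : plane) := forall i, active t z i -> ractive z i.

Lemma active_vertex t z i i' : adm t -> steps t -> reg t z -> i != i' ->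
  active t z i -> active t z i' -> congr_pt (sd z) (base t) \/ right_corner t z.
Proof.
move=> at_ st tz; wlog ii : i i' / (i < i')%N.
  by move=> H; rewrite neq_ltn => /orP[] ii ai ai'; [apply: (H i i') | apply: (H i' i)];
    rewrite ?neq_ltn ?ii ?orbT.
move=> _ ai ai'; have i8 := active_lt8 ai'.
case: t at_ st tz ai ai' => [ws wd|a1 a2 b1 b2] at_ st tz ai ai'.
  suff : ((sf z == ws - 1) || (sf z == ws + 1)) && ((df z == wd - 1) || (df z == wd + 1)).
    move=> /andP[h1 h2]; left; split => /=.
      case/orP: h1 => /eqP ->; first by exists (-1); rewrite intrN; ring.
      by exists 0; ring.
    case/orP: h2 => /eqP ->; first by exists (-1); rewrite intrN; ring.
    by exists 0; ring.
  move: tz ai ai'; rewrite /reg /= /inC /inrect /inoct /active /tight /=.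
  move: at_; rewrite /admissible; clear st; set s := sf z; set d := df z.
  case: i i' ii i8 => [|[|[|[|[|[|[|i]]]]]]] [|[|[|[|[|[|[|[|i']]]]]]]] // _ _;
    rewrite ?orbF /= => *; lra.
have M3 : 3 <= M by move: m2r => ?; lra.
have N3 : 3 <= N by move: n2r => ?; lra.
have ii8 : (i < i' < 8)%N by rewrite ii.
case/orP: (touches_vertex M3 N3 at_ tz ii8 (activeE ai) (activeE ai')).
  case: st => a [b [ea eb]] /andP[h1 h2]; left; split => /=.
    case/or4P: h1 => /eqP ->.
    - by exists (-1); rewrite intrN; ring.
    - by exists 0; ring.
    - by exists a%:Z; rewrite -pmulrn.
    - by exists (a%:Z + 1); rewrite ea intrD -pmulrn; ring.
  case/or4P: h2 => /eqP ->.
  - by exists (-1); rewrite intrN; ring.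
  - by exists 0; ring.
  - by exists b%:Z; rewrite -pmulrn.
  - by exists (b%:Z + 1); rewrite eb intrD -pmulrn; ring.
case/and5P => h1 h2 h4 h5 /andP[h6 h7]; right => j aj.
have := activeE aj; rewrite ractiveE.
have := active_lt8 aj.
case: j aj => [|[|[|[|[|[|[|[|j]]]]]]]] // _ _.
- by clear h4 h5 h6 h7; rewrite /= => ?; lra.
- by clear h4 h5 h6 h7; rewrite /= => ?; lra.
- by clear h4 h5 h6 h7; rewrite /= => ?; lra.
- by clear h4 h5 h6 h7; rewrite /= => ?; lra.
- exact: (implyP h4).
- exact: (implyP h5).
- exact: (implyP h6).
- exact: (implyP h7).
Qed.

Lemma plane_of_xy (X Y : R) (z := (X / 2 - 1, Y / 2 - 1) : plane) :
  sf z = (X + Y) / 2 /\ df z = (X - Y) / 2.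
Proof. by rewrite /sf /df /=; split; lra. Qed.

Lemma sreg_nonempty t : adm t -> exists z, sreg t z.
Proof.
have H (X Y : R) : all (fun c : nat * R => lform c.1 ((X + Y) / 2) ((X - Y) / 2) < c.2)
      (constraints m n t) -> exists z, sreg t z.
  move=> h; exists (X / 2 - 1, Y / 2 - 1); have [E1 E2] := plane_of_xy X Y.
  by rewrite /sreg /= /ssat E1 E2.
have m2' := m2r; have n2' := n2r.
case: t H => [ws wd|a1 a2 b1 b2] H; rewrite /admissible.
  by move=> ?; apply: (H (ws + wd) (ws - wd)); rewrite /=; lra.
case/and5P => hA hB HL HR /andP[HD HU].
(* [X] and [Y] are values of s + d and s - d: those of the centre of the block where no wall clips,
   otherwise values 1/2 inside the clipping wall. *)
pose X := if 4 <= a1 + b1 then if a2 + b2 <= 2 * M - 4 then (a1 + a2 + b1 + b2) / 2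
  else 2 * M - 5 / 2 else 5 / 2.
pose Y := if 4 <= a1 - b2 then if a2 - b1 <= 2 * N - 4 then (a1 + a2 - b1 - b2) / 2
  else 2 * N - 5 / 2 else 5 / 2.
apply: (H X Y) => {H}; rewrite {}/X {}/Y.
move: HL HR HD HU.
case: (4 <= a1 + b1) / idP => h1; case: (a2 + b2 <= 2 * M - 4) / idP => h2;
case: (4 <= a1 - b2) / idP => h3; case: (a2 - b1 <= 2 * N - 4) / idP => h4;
rewrite /= => *; lra.
Qed.

Lemma sreg_dir t z c : sreg t c -> forall i, active t z i -> slope i (c.1 - z.1, c.2 - z.2) < 0.
Proof.
move=> /allP tc i /hasP[k kc /andP[/eqP <- /eqP tk]].
have := tc _ kc; have := form_shiftp k.1 z 1 (c.1 - z.1, c.2 - z.2).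
have -> : shiftp z 1 (c.1 - z.1, c.2 - z.2) = c.
  by case: (c) => x y; rewrite /shiftp /= !mul1r !(addrC z.1) !(addrC z.2) !subrK.
by rewrite /ssat -tk => -> ?; lra.
Qed.

(** Take a sector whose closure contains the direction from [z] to an interior point of the tile:
    the forms that cut it do not decrease in that direction, while every tight form does. *)
Lemma owns_exists t z : adm t -> exists2 j, (j < 8)%N & owns t z j.
Proof.
move=> /sreg_nonempty[c tc]; have := sreg_dir (z := z) tc.
set u1 := c.1 - z.1; set u2 := c.2 - z.2 => H.
have H' j : (j < 8)%N -> all (fun i => 0 <= slope i (u1, u2)) (cuts j) ->
    exists2 j, (j < 8)%N & owns t z j.
  move=> j8 /allP nn; exists j => //; apply/allP => i /nn sl.
  by apply/negP => /H; rewrite ltNge sl.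
rewrite /slope /= in H'.
have [h1|h1] := lerP 0 u1; have [h2|h2] := lerP 0 u2;
have [h3|h3] := lerP 0 (u1 + u2); have [h4|h4] := lerP 0 (u1 - u2).
all: try (by apply: (H' 0%N) => //=; lra).
all: try (by apply: (H' 1%N) => //=; lra).
all: try (by apply: (H' 2%N) => //=; lra).
all: try (by apply: (H' 3%N) => //=; lra).
all: try (by apply: (H' 4%N) => //=; lra).
all: try (by apply: (H' 5%N) => //=; lra).
all: try (by apply: (H' 6%N) => //=; lra).
all: try (by apply: (H' 7%N) => //=; lra).
Qed.

Definition lexle (z z' : plane) := (z.2 < z'.2) || ((z.2 == z'.2) && (z.1 <= z'.1)).

Lemma lexle_trans : transitive lexle.
Proof.
move=> [x y] [x' y'] [x'' y'']; rewrite /lexle /= => h1 h2.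
by have [?|?|?] := ltrgtP y' y''; lra.
Qed.

Lemma lexle_total z z' : lexle z z' || lexle z' z.
Proof. by rewrite /lexle; lra. Qed.

Lemma lexmin_reg t : adm t -> exists2 z, reg t z & forall z', reg t z' -> lexle z z'.
Proof.
have H (X Y : R) : inC M N t ((X + Y) / 2) ((X - Y) / 2) ->
    (forall s d, inC M N t s d -> (Y < s - d) || ((Y == s - d) && (X <= s + d))) ->
    exists2 z, reg t z & forall z', reg t z' -> lexle z z'.
  move=> h hm; exists (X / 2 - 1, Y / 2 - 1); have [E1 E2] := plane_of_xy X Y.
    by rewrite /reg /= E1 E2.
  by move=> [x y] /hm; rewrite /lexle /sf /df /= => ?; lra.
have m2' := m2r; have n2' := n2r.
case: t H => [ws wd|a1 a2 b1 b2] H; rewrite /admissible.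
  move=> A; apply: (H (ws + wd) (ws - wd - 2)).
    by rewrite /inC /inrect /inoct; lra.
  by move=> s d; rewrite /inC /inrect /inoct => ?; clear A; lra.
case/and5P => hA hB HL HR /andP[HD HU].
(* The left end of the lowest side: in coordinates (s, d) it is (a1 - 2, b2), or (b1, b1 - 2) if
   only the lower wall clips, or a point of the left wall. *)
pose Y := if 4 <= a1 - b2 then a1 - b2 - 2 else 2.
pose X := if 4 <= a1 + b1 then if 4 <= a1 - b2 then a1 + b2 - 2 else 2 * b1 - 2 else 2.
apply: (H X Y); rewrite {}/X {}/Y; clear H.
  move: HL HR HD HU.
  case: (4 <= a1 + b1) / idP => h1; case: (4 <= a1 - b2) / idP => h2;
  rewrite /inC /inrect /inoct => *; lra.
move=> s d; rewrite /inC /inrect /inoct; clear HR HU; move: HL HD.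
case: (4 <= a1 + b1) / idP => h1; case: (4 <= a1 - b2) / idP => h2 => *; lra.
Qed.

End Corners.

(** * Integrality of the positions *)

Section Integrality.
Variables (R : realType) (m n : nat).
Local Notation plane := (R * R)%type.
Local Notation M := (m%:R + 1 : R).
Local Notation N := (n%:R + 1 : R).
Local Notation Q := (rectangle R m n).
Local Notation reg := (@reg R m n).

Hypothesis m2 : (2 <= m)%N.
Hypothesis n2 : (2 <= n)%N.

Local Notation adm := (@admissible R M N).
Local Notation sreg := (@sreg R m n).
Local Notation active := (@active R m n).
Local Notation ractive := (@ractive R m n).
Local Notation owns := (@owns R m n).
Local Notation rowns := (@rowns R m n).
Local Notation right_corner := (@right_corner R m n).

Variables (T : set (set plane)) (rep : set plane -> tile R).
Hypothesis Tfin : finite_set T.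
Hypothesis Trep : forall P, T P -> [/\ adm (rep P), steps (rep P) & P = reg (rep P)].
Hypothesis Tcov : \bigcup_(P in T) P = Q.
Hypothesis Ttriv : trivIset T (fun P => interior P).

Lemma tiling_eq P P' z : T P -> T P' -> sreg (rep P) z -> sreg (rep P') z -> P = P'.
Proof.
move=> TP TP' zP zP'; apply: Ttriv => //; exists z; split.
  by have [_ _ ->] := Trep TP; exact: sreg_interior.
by have [_ _ ->] := Trep TP'; exact: sreg_interior.
Qed.

(** Finiteness gives a common small [e] for which the point at [e] in the sector avoids every tile
    that does not own it; the tile covering that point is the owner. *)
Lemma owner z j : Q z -> rowns z j ->
  exists P, [/\ T P, reg (rep P) z & owns (rep P) z j].
Proof.
move=> Qz rz; apply: contrapT => H.
have [l El] := (finite_seqP T).1 Tfin.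
have lT P : P \in l -> T P by rewrite El.
have [|e e0 [Qe Ne]] := smallP (smallI (rowns_small Qz rz)
  (@small_all R _ l (fun P e => ~ reg (rep P) (shiftp z e (dir R j))) _)).
  move=> P /lT TP; apply: nowns_small => -[Pz oz]; apply: H.
  by exists P.
move: Qe; rewrite -Tcov => -[P TP Pz].
have [_ _ EP] := Trep TP.
by apply: (Ne P); [rewrite El in TP | rewrite -EP].
Qed.

Lemma owner_unique P P' z j : T P -> T P' -> reg (rep P) z -> reg (rep P') z ->
  owns (rep P) z j -> owns (rep P') z j -> P = P'.
Proof.
move=> TP TP' Pz P'z o o'.
have [e e0 [s s']] := smallP (smallI (owns_small Pz o) (owns_small P'z o')).
exact: tiling_eq s s'.
Qed.

(** Each half-plane leaves out four consecutive sectors. If both leave out [j], together they leave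
    out at most seven, and a sector remains in both. *)
Let halfplanes_check : forall i, (i < 8)%N -> forall i', (i' < 8)%N ->
  forall j, (j < 8)%N -> i \in cuts j -> i' \in cuts j ->
  exists2 k, (k < 8)%N & (i \notin cuts k) && (i' \notin cuts k).
Proof.
have : all (fun i => all (fun i' => all (fun j => (i \in cuts j) ==> (i' \in cuts j) ==>
    has (fun k => (i \notin cuts k) && (i' \notin cuts k)) (iota 0 8)) (iota 0 8))
    (iota 0 8)) (iota 0 8) by vm_compute.
move=> /allP H i i8 i' i'8 j j8 h h'.
have := H i; rewrite mem_iota => /(_ i8) /allP /(_ i').
rewrite mem_iota => /(_ i'8) /allP /(_ j); rewrite mem_iota => /(_ j8).
by rewrite h h' => /hasP[k]; rewrite mem_iota; exists k.
Qed.

(** A half-plane leaves out four sectors, and at most three of them are among 0, 1, 2. *)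
Let upper_cut : forall i, (i < 8)%N -> exists2 j, (3 <= j < 8)%N & i \in cuts j.
Proof.
have : all (fun i => has (fun j => i \in cuts j) (iota 3 5)) (iota 0 8) by vm_compute.
move=> /allP H i i8; have := H i; rewrite mem_iota => /(_ i8) /hasP[j].
by rewrite mem_iota => ? ?; exists j.
Qed.

(** With at most one tight side one could still move down, or to the left along a horizontal lower
    side. *)
Lemma two_active t z : reg t z -> (forall z', reg t z' -> lexle z z') ->
  exists i i', [/\ i != i', active t z i & active t z i'].
Proof.
move=> tz zmin; apply: contrapT => H.
have single i i' : active t z i -> active t z i' -> i = i'.
  by move=> ai ai'; apply/eqP/negPn/negP => ii; apply: H; exists i, i'.
have bad (u : plane) : (u.2 < 0) || ((u.2 == 0) && (u.1 < 0)) ->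
    ~ (forall i, active t z i -> slope i u <= 0).
  move=> hu hi; have [e e0 /zmin] := smallP (small_in tz hi).
  by rewrite /lexle /shiftp /=; nra.
have [[i ai]|na] := pselect (exists i, active t z i); last first.
  by apply: (bad (0, -1)) => [/=|i ai]; [lra | case: na; exists i].
have i8 := active_lt8 ai.
have bad' (u : plane) : (u.2 < 0) || ((u.2 == 0) && (u.1 < 0)) -> slope i u <= 0 -> False.
  by move=> hu sl; apply: (bad u hu) => i' /(single _ _ ai) <-.
move: i8 bad'; rewrite /slope; case: (i) => [|[|[|[|[|[|[|[|]]]]]]]] //= _ bad'.
- by apply: (bad' (1, -1)) => /=; lra.
- by apply: (bad' (1, -1)) => /=; lra.
- by apply: (bad' (-1, -1)) => /=; lra.
- by apply: (bad' (-1, -1)) => /=; lra.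
- by apply: (bad' (0, -1)) => /=; lra.
- by apply: (bad' (0, -1)) => /=; lra.
- by apply: (bad' (-1, 0)) => /=; lra.
- by apply: (bad' (0, -1)) => /=; lra.
Qed.

Lemma lexmin_seq (l : seq (set plane)) : l != [::] ->
  (forall P, P \in l -> exists2 z, P z & forall z', P z' -> lexle z z') ->
  exists P z, [/\ P \in l, P z & forall P' z', P' \in l -> P' z' -> lexle z z'].
Proof.
elim: l => [//|P l IH] _ H.
have [z Pz zmin] := H P (mem_head _ _).
have [->|ln] := eqVneq l [::].
  by exists P, z; split=> // [|P' z']; rewrite inE // => /eqP ->; exact: zmin.
have [|P' [z' [P'l P'z' z'min]]] := IH ln.
  by move=> P' P'l; apply: H; rewrite inE P'l orbT.
case/orP: (lexle_total z z') => zz'.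
  exists P, z; split=> // [|P2 z2]; rewrite inE ?eqxx //.
  case/orP => [/eqP ->|P2l P2z]; first exact: zmin.
  by apply: lexle_trans zz' _; exact: z'min P2l P2z.
exists P', z'; split=> // [|P2 z2]; rewrite inE ?P'l ?orbT //.
case/orP => [/eqP -> /zmin|P2l P2z]; first exact: lexle_trans.
exact: z'min P2l P2z.
Qed.

(** Sectors 4 to 7 lie below [z]. Owning sector 3 would bring in its boundary ray to the left as
    well, because the tile is closed. *)
Lemma owns_lexmin t z j : reg t z -> (forall z', reg t z' -> lexle z z') ->
  (j < 8)%N -> owns t z j -> (j < 3)%N.
Proof.
move=> tz zmin j8 o; rewrite ltnNge; apply/negP => j3.
have [j4|j4] := leqP 4 j.
  have [e e0 /sreg_reg /zmin] := smallP (owns_small tz o).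
  rewrite /lexle /shiftp.
  by move: j j8 j4 {o j3} => [|[|[|[|[|[|[|[|j]]]]]]]] //= _ _; nra.
have {j4 j3 j8} j3 : j = 3%N by apply/eqP; rewrite eqn_leq j3 -ltnS j4.
have sl i : active t z i -> @slope R i (-1, 0) <= 0.
  move=> ai; have := allP o i; rewrite j3 ai.
  move: (active_lt8 ai); rewrite /slope.
  by move: i {ai} => [|[|[|[|[|[|[|[|i]]]]]]]] //= _; try (by move=> /(_ isT)); lra.
have [e e0 /zmin] := smallP (small_in tz sl).
by rewrite /lexle /shiftp /=; nra.
Qed.

Lemma rowns_upper z : Q z -> (exists2 j, (3 <= j < 8)%N & rowns z j) \/ z = (0, 0).
Proof.
have m2' : @Order.le _ R 2 m%:R by rewrite ler_nat.
have n2' : @Order.le _ R 2 n%:R by rewrite ler_nat.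
rewrite rectangleE => Qz.
have H j : (3 <= j < 8)%N -> rowns z j -> (exists2 j, (3 <= j < 8)%N & rowns z j) \/ z = (0, 0).
  by move=> j8 rj; left; exists j.
move: Qz H; rewrite /rowns /inrect => Qz H.
have [h4|h4] := boolP (ractive z 4); have [h6|h6] := boolP (ractive z 6).
- right; move: h4 h6; rewrite !ractiveE; case: (z) => x y; rewrite /sf /df /=.
  by move=> /eqP ? /eqP ?; apply: injective_projections => /=; lra.
- apply: (H 7%N) => //=; move: h4 h6 Qz {H}; rewrite !ractiveE; case: (z) => x y.
  by rewrite /sf /df /=; lra.
- apply: (H 3%N) => //=; move: h4 h6 Qz {H}; rewrite !ractiveE; case: (z) => x y.
  by rewrite /sf /df /=; lra.
- by apply: (H 4%N) => //=; move: h4 h6 {H}; rewrite !ractiveE => -> ->.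
Qed.

Lemma corner_owns t z j : right_corner t z -> rowns z j -> owns t z j.
Proof. by move=> rc /allP rj; apply/allP => i /rj; apply: contra; exact: rc. Qed.

(** Call the tiles congruent to [P0] in step; [V] consists of the others, and [B] in [V] has the
    lowest, then leftmost point [z]. Sectors 3 to 7 at [z] that lie in the rectangle are owned by
    tiles in step. Such a tile has at most one tight side at [z]: a vertex there would make the
    class of [z], which is that of [B], the class of [P0]. *)
Lemma base_congr P0 : T P0 -> reg (rep P0) (0, 0) -> owns (rep P0) (0, 0) 0 ->
  forall P, T P -> congr_pt (base (rep P)) (base (rep P0)).
Proof.
move=> TP0 P00 o0.
pose V := [set P | T P /\ ~ congr_pt (base (rep P)) (base (rep P0))].
apply: contrapT => /existsNP[P1 /not_implyP[TP1 nP1]].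
have [l El] : exists l : seq (set plane), V = [set` l].
  by apply/finite_seqP; apply: sub_finite_set Tfin => P [].
have lV P : P \in l <-> V P by rewrite El.
have [||B [z [Bl Bz zmin]]] := @lexmin_seq l.
- by apply/eqP => l0; have /lV : V P1; rewrite ?l0.
- move=> P /lV[TP _]; have [aP _ ->] := Trep TP; have [z Pz zm] := lexmin_reg m2 n2 aP.
  by exists z.
have [TB nB] := (lV B).1 Bl.
have [aB sB EB] := Trep TB.
have Bz' : reg (rep B) z by rewrite -EB.
have Qz : Q z := reg_sub Bz'.
have zminV P z' : V P -> reg (rep P) z' -> lexle z z'.
  by move=> VP Pz'; apply: (zmin P); [apply/lV | have [_ _ ->] := Trep VP.1].
have zminB z' : reg (rep B) z' -> lexle z z' by apply: zminV.
have [jB jB8 oB] := owns_exists m2 n2 z aB.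
have jB3 := owns_lexmin Bz' zminB jB8 oB.
have rB := owns_rowns oB.
(* An extremal point has two tight sides, so [z] has the class of [B] unless [B] fills the germ of
   the rectangle. *)
have clsB j : rowns z j -> ~ owns (rep B) z j -> congr_pt (sd z) (base (rep B)).
  move=> rj noj; have [i [i' [ii ai ai']]] := two_active Bz' zminB.
  case: (active_vertex m2 n2 aB sB Bz' ii ai ai') => // rc.
  by case: noj; exact: corner_owns.
have clsU P j i i' : T P -> reg (rep P) z -> P <> B -> rowns z j -> ~ owns (rep B) z j ->
    congr_pt (base (rep P)) (base (rep P0)) ->
    active (rep P) z i -> active (rep P) z i' -> i = i'.
  move=> TP Pz PB rj noj cP ai ai'; apply/eqP/negPn/negP => ii.
  have [aP sP _] := Trep TP.
  case: (active_vertex m2 n2 aP sP Pz ii ai ai') => [zP|rc].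
    by apply: nB; apply: congr_pt_trans cP; apply: congr_pt_trans zP;
      apply: congr_pt_sym; exact: clsB rj noj.
  by apply: PB; apply: (owner_unique TP TB Pz Bz' _ oB); exact: corner_owns.
have [[j0 j08 rj0]|z0] := rowns_upper Qz; last first.
  (* At the origin two walls are tight for [P0], which is in step: one too many. *)
  subst z.
  have PB : P0 <> B.
    by move=> E; apply: nB; rewrite -E; split; exists 0; ring.
  have nb0 : ~ owns (rep B) (0, 0) 0 by move=> o; apply: PB; exact: owner_unique o0 o.
  have r0 := owns_rowns o0.
  have a4 P : active (rep P) (0, 0) 4.
    by apply: ractive_active; rewrite ractiveE /sf /df /=; blra.
  have a6 P : active (rep P) (0, 0) 6.
    by apply: ractive_active; rewrite ractiveE /sf /df /=; blra.
  have c0 : congr_pt (base (rep P0)) (base (rep P0)) by split; exists 0; ring.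
  by have := clsU P0 0%N 4%N 6%N TP0 P00 PB r0 nb0 c0 (a4 _) (a6 _).
have upper j : (3 <= j < 8)%N -> rowns z j -> exists P,
   [/\ T P, reg (rep P) z, P <> B, owns (rep P) z j
   & forall i i', active (rep P) z i -> active (rep P) z i' -> i = i'].
  move=> /andP[j3 j8] rj; have [P [TP Pz oP]] := owner Qz rj.
  have nV : ~ V P.
    move=> VP; have := owns_lexmin Pz (fun z' => zminV P z' VP) j8 oP.
    by rewrite ltnNge j3.
  have PB : P <> B by move=> E; apply: nV; rewrite E; apply/lV.
  have noB : ~ owns (rep B) z j by move=> o; apply: PB; exact: owner_unique oP o.
  exists P; split => // i i'; apply: (clsU P j) => //.
  by apply: contrapT => nc; apply: nV.
have [A [TA Az AB oA sA]] := upper j0 j08 rj0.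
have noA : ~ owns (rep A) z jB by move=> o; apply: AB; exact: owner_unique o oB.
have /allPn[iA iAB /negPn aA] : ~~ owns (rep A) z jB by apply/negP.
have iA8 := active_lt8 aA.
(* A wall through [z] would be the only tight side of [A], which would then own [jB] too. *)
have nr i : ~ ractive z i.
  move=> ri; apply: noA; apply/allP => i' i'B; apply/negP => ai'.
  have E := sA _ _ ai' (ractive_active (rep A) ri); subst i'.
  by have := allP rB _ i'B; rewrite ri.
have rall j : rowns z j by apply/allP => i _; apply/negP => /nr.
(* Near [z] the tile [A] is a half-plane. A sector from 3 to 7 outside it has an owner [A'], again a
   half-plane. Both miss [jB], hence they share a sector and are equal, although [A] does not own
   [j1]. *)
have [j1 j18 iA1] := upper_cut iA8.
have [A' [TA' A'z A'B oA' sA']] := upper j1 j18 (rall j1).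
have noA' : ~ owns (rep A') z jB by move=> o; apply: A'B; exact: owner_unique o oB.
have /allPn[iA' iA'B /negPn aA'] : ~~ owns (rep A') z jB by apply/negP.
have [k k8 /andP[h h']] := halfplanes_check iA8 (active_lt8 aA') jB8 iAB iA'B.
have AA' : A = A'.
  apply: (owner_unique TA TA' Az A'z (j := k)); apply/allP => i ik; apply/negP => ai.
    by move: h; rewrite -(sA _ _ ai aA) ik.
  by move: h'; rewrite -(sA' _ _ ai aA') ik.
have := allP oA' _ iA1; rewrite -AA' aA.
by [].
Qed.

(** The corner tile has at the origin, which is (2, 0) in the coordinates (s, d), either an ordinary
    vertex, whose class is 0, or the right angle of a triangle with block [-a, a] x [-a, a], whose
    class is that of a. *)
Lemma base_integral : exists p : int, forall P, T P ->
  congr_pt (base (rep P)) (p%:~R, p%:~R).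
Proof.
have m2' : @Order.le _ R 2 m%:R by rewrite ler_nat.
have n2' : @Order.le _ R 2 n%:R by rewrite ler_nat.
have Q0 : Q (0, 0) by rewrite rectangleE /inrect /sf /df /=; lra.
have r0 : rowns (0, 0) 0.
  by rewrite /rowns /= !ractiveE /sf /df /=; lra.
have [P0 [TP0 P00 o0]] := owner Q0 r0.
have H := base_congr TP0 P00 o0.
have [aP sP _] := Trep TP0.
suff [p Hp] : exists p : int, congr_pt (base (rep P0)) (p%:~R, p%:~R).
  by exists p => P /H cP; exact: congr_pt_trans Hp.
have a4 : active (rep P0) (0, 0) 4.
  by apply: ractive_active; rewrite ractiveE /sf /df /=; blra.
have a6 : active (rep P0) (0, 0) 6.
  by apply: ractive_active; rewrite ractiveE /sf /df /=; blra.
case: (active_vertex m2 n2 aP sP P00 _ a4 a6) => // [cz|rc].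
  exists 0; apply: congr_pt_trans (congr_pt_sym cz) _.
  by split; [exists 1 | exists 0]; rewrite /= /sf /df /= ?(mulr0z, mulr1z); lra.
case: (rep P0) aP sP P00 rc {H o0 a4 a6} => [ws wd|a1 a2 b1 b2] aP sP P00 rc.
  by move: aP P00; rewrite /reg /= /inC /inrect /inoct /sf /df /=; lra.
case: sP => a [b [ea eb]]; exists (- a%:Z).
have [h1 h2] : a1 = - a%:R /\ b1 = - a%:R.
  have nra i : ~~ ractive (0, 0) i -> ~~ active (Blk a1 a2 b1 b2) (0, 0) i.
    by apply: contra; exact: rc.
  have := nra 0%N; have := nra 1%N; have := nra 2%N; have := nra 3%N.
  rewrite !ractiveE => /(_ isT) h3 /(_ isT) h2 /(_ isT) h1 /(_ isT) h0.
  move: h0 h1 h2 h3 aP P00; rewrite /active /tight /reg /= /inC /inrect /inoct /sf /df /=.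
  rewrite !orbF => *; split; lra.
by rewrite /= h1 h2 intrN -pmulrn; split; exists 0; ring.
Qed.

End Integrality.

(* In coordinates (s, d) the integer points (x, y) are those with s and d of the
   same parity; the class p consists of those with s and d congruent to p. *)
Definition par (p x : int) : bool := (x %% 2 == p %% 2)%Z.

Definition cls (p : int) (t : tile int) : bool :=
  match t with
  | Dia ws wd => par p (ws + 1) && par p (wd + 1)
  | Blk a1 a2 b1 b2 => [&& par p a1, par p a2, par p b1 & par p b2]
  end.

Definition inBlk (t : tile int) (s d : int) : bool :=
  match t with
  | Dia _ _ => false
  | Blk a1 a2 b1 b2 => [&& a1 <= s, s <= a2, b1 <= d & d <= b2]
  end.

Definition tile_map (K L : Type) (f : K -> L) (t : tile K) : tile L :=
  match t with
  | Dia ws wd => Dia (f ws) (f wd)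
  | Blk a1 a2 b1 b2 => Blk (f a1) (f a2) (f b1) (f b2)
  end.

(** * Tiles at integer positions and half unit squares *)

Section IntegerTiles.
Variables (R : realType) (m n : nat).
Local Notation plane := (R * R)%type.
Local Notation M := (m%:R + 1 : R).
Local Notation N := (n%:R + 1 : R).
Local Notation Q := (rectangle R m n).
Local Notation reg := (@reg R m n).

Hypothesis m2 : (2 <= m)%N.
Hypothesis n2 : (2 <= n)%N.

Local Notation adm := (@admissible R M N).
Local Notation sreg := (@sreg R m n).
Local Notation Mz := (m%:Z + 1 : int).
Local Notation Nz := (n%:Z + 1 : int).
Definition rtile (t : tile int) : tile R := tile_map intr t.
Local Notation inCz := (inC Mz Nz).
Local Notation admz := (admissible Mz Nz).

Lemma adm_rtile t : adm (rtile t) = admz t.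
Proof.
case: t => [ws wd|a1 a2 b1 b2]; rewrite /admissible /= -!(ler_int R).
  by apply/idP/idP => *; lra.
rewrite -!(eqr_int R); congr [&& _, _, _, _, _ & _]; apply/idP/idP => *; lra.
Qed.

Lemma inC_rtile t (s d : int) : inC M N (rtile t) s%:~R d%:~R = inCz t s d.
Proof.
rewrite /inC /inrect /inoct; case: t => [ws wd|a1 a2 b1 b2];
  rewrite /= -!(ler_int R); apply/idP/idP => *; lra.
Qed.

Lemma cong2_int (x : R) (p : int) : cong2 x p%:~R -> exists2 k : int, x = k%:~R & par p k.
Proof.
case=> k ->; exists (p + 2 * k); first by rewrite intrD intrM.
by rewrite /par; lia.
Qed.

Lemma int_tile t (p : int) : adm t -> steps t -> congr_pt (base t) (p%:~R, p%:~R) ->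
  exists u, [/\ t = rtile u, admz u & cls p u].
Proof.
move=> at_ st [] /= /cong2_int[k ek pk] /cong2_int[l el pl].
case: t at_ st ek el => [ws wd|a1 a2 b1 b2] at_ st /= ek el.
  have E : Dia ws wd = rtile (Dia (k - 1) (l - 1)).
    by congr Dia; rewrite intrB -?ek -?el addrK.
  exists (Dia (k - 1) (l - 1)); split=> //; first by rewrite -adm_rtile -E.
  by rewrite /cls /par in pk pl *; lia.
case: st => a [b [ea eb]].
have E : Blk a1 a2 b1 b2 = rtile (Blk k (k + 2 * a%:Z) l (l + 2 * b%:Z)).
  by congr Blk; rewrite ?ea ?eb ?ek ?el // intrD intrM -pmulrn.
exists (Blk k (k + 2 * a%:Z) l (l + 2 * b%:Z)); split=> //; first by rewrite -adm_rtile -E.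
by rewrite /cls /par in pk pl *; lia.
Qed.

(* The half unit square with right angle at the point w (of the class other
   than p) and acute vertices (ws + e, wd + e) and (ws + f, wd - f), which are
   the neighbours of w in the horizontal direction e and the vertical
   direction f. *)
Definition cell_in (t : tile int) (ws wd e f : int) : bool :=
  [&& inCz t ws wd, inCz t (ws + e) (wd + e) & inCz t (ws + f) (wd - f)].

Definition sign (e : int) : bool := (e == 1) || (e == -1).

(** The extents of cell and tile overlap strictly in every form. The extents of the cell in [s] and
    [d] are widened to [ws - 1, ws + 1] and [wd - 1, wd + 1], which parity makes harmless. *)
Definition cell_bounds (t : tile int) (ws wd e f : int) : bool :=
  [&& 2 < ws + wd + e + 1, ws + wd + e - 1 < 2 * Mz - 2,
      2 < ws - wd + f + 1 & ws - wd + f - 1 < 2 * Nz - 2] &&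
  match t with
  | Dia us ud => [&& ws - 1 < us + 1, us - 1 < ws + 1, wd - 1 < ud + 1 & ud - 1 < wd + 1]
  | Blk a1 a2 b1 b2 =>
    [&& ws - 1 < a2 + 2, a1 - 2 < ws + 1, wd - 1 < b2 + 2, b1 - 2 < wd + 1,
        ws + wd + e - 1 < a2 + b2 + 2, a1 + b1 - 2 < ws + wd + e + 1,
        ws - wd + f - 1 < a2 - b1 + 2 & a1 - b2 - 2 < ws - wd + f + 1]
  end.

(** The bounds of a tile of class [p] have the parity of the ends of these extents, whose length is
    2, so no bound passes through the inside of an extent: strict overlap forces inclusion. *)
Lemma cell_inP p t ws wd e f : cls p t -> par (p + 1) ws -> par (p + 1) wd ->
  sign e -> sign f -> cell_bounds t ws wd e f -> cell_in t ws wd e f.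
Proof.
rewrite /cell_in /cell_bounds /inC /inrect /inoct /cls /par /sign => c pw pd se sf.
case: t c => [us ud|a1 a2 b1 b2] c; case/orP: se => /eqP ->; case/orP: sf => /eqP ->; lia.
Qed.

Definition incell (ws wd e f : int) (s d : R) : bool :=
  [&& 0 <= e%:~R * (s + d - (ws + wd)%:~R), 0 <= f%:~R * (s - d - (ws - wd)%:~R)
    & e%:~R * (s + d - (ws + wd)%:~R) + f%:~R * (s - d - (ws - wd)%:~R) <= 2].

Lemma incell_bounds ws wd e f s d : sign e -> sign f -> incell ws wd e f s d ->
  [&& ws%:~R - 1 <= s, s <= ws%:~R + 1, wd%:~R - 1 <= d, d <= wd%:~R + 1,
      ws%:~R + wd%:~R + e%:~R - 1 <= s + d, s + d <= ws%:~R + wd%:~R + e%:~R + 1,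
      ws%:~R - wd%:~R + f%:~R - 1 <= s - d & s - d <= ws%:~R - wd%:~R + f%:~R + 1].
Proof.
by rewrite /sign /incell => /orP[]/eqP-> /orP[]/eqP->; rewrite !intrD; lra.
Qed.

Lemma cell_in_sreg p t ws wd e f z : cls p t -> par (p + 1) ws -> par (p + 1) wd ->
  sign e -> sign f -> incell ws wd e f (sf z) (df z) -> sreg (rtile t) z ->
  cell_in t ws wd e f.
Proof.
move=> c pw pd se sf_ /(incell_bounds se sf_) hb hz.
apply: (cell_inP c) => //; clear c pw pd se sf_; rewrite /cell_bounds.
move: hz hb; rewrite /sreg /= /ssat /=; set s := sf z; set d := df z.
case: t => [us ud|a1 a2 b1 b2] /= hz hb; rewrite -!(ltr_int R); lra.
Qed.

Lemma cell_in_reg t ws wd e f z : sign e -> sign f ->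
  incell ws wd e f (sf z) (df z) -> cell_in t ws wd e f -> reg (rtile t) z.
Proof.
move=> se sf_ hz; rewrite /cell_in -!inC_rtile !intrD intrN.
(* Barycentric coordinates of the point at the two acute vertices of the cell. *)
set u := e%:~R * (sf z + df z - (ws + wd)%:~R) / 2.
set v := f%:~R * (sf z - df z - (ws - wd)%:~R) / 2.
have [u0 v0 uv] : [/\ 0 <= u, 0 <= v & u + v <= 1].
  by move: hz; rewrite /incell /u /v; split; lra.
have es : sf z = ws%:~R + u * e%:~R + v * f%:~R.
  by rewrite /u /v !intrD intrN; case/orP: se => /eqP ->; case/orP: sf_ => /eqP ->; lra.
have ed : df z = wd%:~R + u * e%:~R - v * f%:~R.
  by rewrite /u /v !intrD intrN; case/orP: se => /eqP ->; case/orP: sf_ => /eqP ->; lra.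
rewrite /reg /= es ed; clearbody u v; clear hz es ed.
move: (e%:~R) (f%:~R) (ws%:~R) (wd%:~R) => e' f' w1 w2.
have L (a b c k : R) : a <= k -> b <= k -> c <= k ->
    (1 - u - v) * a + u * b + v * c <= k.
  move=> ha hb hc.
  have -> : k = (1 - u - v) * k + u * k + v * k by ring.
  by rewrite !lerD // ler_wpM2l //; lra.
have LL (i : nat) c : lform i w1 w2 <= c -> lform i (w1 + e') (w2 + e') <= c ->
    lform i (w1 + f') (w2 - f') <= c ->
    lform i (w1 + u * e' + v * f') (w2 + u * e' - v * f') <= c.
  move=> h1 h2 h3; apply: le_trans (L _ _ _ _ h1 h2 h3); rewrite le_eqVlt.
  apply/orP; left; apply/eqP; clear.
  by case: i => [|[|[|[|[|[|[|i]]]]]]] /=; ring.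
have E (s d : R) (z' := ((s + d) / 2 - 1, (s - d) / 2 - 1) : plane) :
    inC M N (rtile t) s d = all (fun k => lform k.1 s d <= k.2) (constraints m n (rtile t)).
  have := reg_sat m n (rtile t) z'.
  move=> H'; have e1 : sf z' = s by rewrite /sf /z' /=; lra.
  have e2 : df z' = d by rewrite /df /z' /=; lra.
  move: H'; rewrite /reg /= /sat e1 e2 => H'.
  by apply/idP/idP; rewrite H'.
rewrite !E => /and3P[/allP h1 /allP h2 /allP h3]; apply/allP => k kc.
by apply: LL; [apply: h1 | apply: h2 | apply: h3].
Qed.

Lemma cell_of_point p z : Q z -> exists ws wd e f,
  [/\ par (p + 1) ws && par (p + 1) wd, sign e && sign f, incell ws wd e f (sf z) (df z)
   & [&& inrect Mz Nz ws wd, inrect Mz Nz (ws + e) (wd + e) & inrect Mz Nz (ws + f) (wd - f)]].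
Proof.
rewrite rectangleE => Qz.
(* On the far wall the floor is lowered by 1, so that the unit square stays inside the rectangle. *)
have fl (k : nat) (x : R) : (2 <= k)%N -> 1 <= x <= k%:R ->
    exists i : int, [/\ 1 <= i, i <= k%:Z - 1, i%:~R <= x & x <= i%:~R + 1].
  move=> k2 /andP[x1 xk]; have [xlt|xge] := ltrP x k%:R.
    have f1 := ge_floor x; have f2 := lt_succ_floor x.
    exists (Num.floor x); split => //.
    - by rewrite floor_ge_int.
    - have : Num.floor x < k%:Z by rewrite floor_lt_int -pmulrn.
      by lia.
    - by move: f2; rewrite intrD => /ltW.
  exists (k%:Z - 1); split; [lia|lia| |]; rewrite intrB -pmulrn; lra.
move: Qz; rewrite /inrect => Qz.
have [i [i1 im xi1 xi2]] := fl m (z.1 + 1) m2 ltac:(move: Qz; rewrite /sf /df; lra).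
have [j [j1 jn yj1 yj2]] := fl n (z.2 + 1) n2 ltac:(move: Qz; rewrite /sf /df; lra).
clear fl Qz; case: z xi1 xi2 yj1 yj2 => x y /= xi1 xi2 yj1 yj2.
rewrite /sf /df /=.
(* The lower left vertex of the unit square is (i + j, i - j) in (s, d). Its parity tells which two
   opposite vertices are of the other class; the diagonal through the remaining two selects the
   right angle. *)
have [pij|pij] := boolP (par (p + 1) (i + j)).
  have [h|h] := lerP (x + 1 - i%:~R + (y + 1 - j%:~R)) 1.
    exists (i + j), (i - j), 1, 1; split => //.
    - by move: pij; rewrite /par; lia.
    - by rewrite /incell !intrD !intrN; lra.
    - by lia.
  exists (i + j + 2), (i - j), (-1), (-1); split => //.
  - by move: pij; rewrite /par; lia.
  - by rewrite /incell !intrD !intrN; lra.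
  - by lia.
have [h|h] := lerP (y + 1 - j%:~R) (x + 1 - i%:~R).
  exists (i + j + 1), (i - j + 1), (-1), 1; split => //.
  - by move: pij; rewrite /par; lia.
  - by rewrite /incell !intrD !intrN; lra.
  - by lia.
exists (i + j + 1), (i - j - 1), 1, (-1); split => //.
- by move: pij; rewrite /par; lia.
- by rewrite /incell !intrD !intrN; lra.
- by lia.
Qed.

End IntegerTiles.

(** * Solid points *)

Section Solid.
Variables (R : realType) (m n : nat).
Local Notation plane := (R * R)%type.
Local Notation M := (m%:R + 1 : R).
Local Notation N := (n%:R + 1 : R).
Local Notation Q := (rectangle R m n).
Local Notation reg := (@reg R m n).

Hypothesis m2 : (2 <= m)%N.
Hypothesis n2 : (2 <= n)%N.

Local Notation adm := (@admissible R M N).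
Local Notation active := (@active R m n).
Local Notation right_corner := (@right_corner R m n).
Local Notation Mz := (m%:Z + 1 : int).
Local Notation Nz := (n%:Z + 1 : int).
Local Notation rtile := (@rtile R).
Local Notation inCz := (inC Mz Nz).
Local Notation admz := (admissible Mz Nz).
Local Notation cell_in := (@cell_in m n).
Local Notation cell_bounds := (@cell_bounds m n).

Lemma steps_rtile p u : admz u -> cls p u -> steps (rtile u).
Proof.
case: u => [//|a1 a2 b1 b2] au cu.
exists `|((a2 - a1) %/ 2)%Z|%N, `|((b2 - b1) %/ 2)%Z|%N.
have ea : a2 = a1 + 2 * `|((a2 - a1) %/ 2)%Z|%N%:Z.
  by move: au cu; rewrite /admissible /cls /par; lia.
have eb : b2 = b1 + 2 * `|((b2 - b1) %/ 2)%Z|%N%:Z.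
  by move: au cu; rewrite /admissible /cls /par; lia.
by split; [rewrite [in LHS]ea | rewrite [in LHS]eb]; rewrite intrD intrM -pmulrn.
Qed.

Lemma signN k : sign k -> sign (- k).
Proof. by rewrite /sign; lia. Qed.

(** In every form the bounds of the octagon are 2 beyond those of the block, so only walls pass
    through points of the block. *)
Lemma inBlk_right_corner u (z : plane) (s d : int) : sf z = s%:~R -> df z = d%:~R ->
  inBlk u s d -> right_corner (rtile u) z.
Proof.
case: u => [//|a1 a2 b1 b2] es ed /and4P[h1 h2 h3 h4] i ai.
have i8 := active_lt8 ai; have := activeE ai; rewrite ractiveE es ed.
move: h1 h2 h3 h4; rewrite -!(ler_int R) => h1 h2 h3 h4.
by move: i i8 {ai} => [|[|[|[|[|[|[|[|i]]]]]]]] //= _ ?; blra.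
Qed.

Lemma cell_block p a1 a2 b1 b2 ws wd e f : admz (Blk a1 a2 b1 b2) -> cls p (Blk a1 a2 b1 b2) ->
  par (p + 1) ws -> par (p + 1) wd -> cell_in (Blk a1 a2 b1 b2) ws wd e f ->
  exists k l, [/\ sign k, sign l, a1 <= ws + k <= a2 & b1 <= wd + l <= b2].
Proof.
move=> au cu pw pd cin.
move: au cu pw pd cin.
rewrite /admissible /cls /cell_in /inC /inrect /inoct /par /sign => au cu pw pd /and3P[w _ _].
have [h1|h1] := lerP (ws + 1) a2; have [h2|h2] := lerP (wd + 1) b2.
- by exists 1, 1; move: au cu pw pd w h1 h2; clear; split; lia.
- by exists 1, (-1); move: au cu pw pd w h1 h2; clear; split; lia.
- by exists (-1), 1; move: au cu pw pd w h1 h2; clear; split; lia.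
- by exists (-1), (-1); move: au cu pw pd w h1 h2; clear; split; lia.
Qed.

Variables (T : set (set plane)) (irep : set plane -> tile int) (p : int).

Hypothesis Tirep : forall P, T P ->
  [/\ admz (irep P), cls p (irep P) & P = reg (rtile (irep P))].
Hypothesis Tcov : \bigcup_(P in T) P = Q.
Hypothesis Ttriv : trivIset T (fun P => interior P).

Let Trep P : T P -> [/\ adm (rtile (irep P)), steps (rtile (irep P))
  & P = reg (rtile (irep P))].
Proof. by move=> /Tirep[au cu]; split=> //; [rewrite adm_rtile | exact: steps_rtile cu]. Qed.

Lemma point_of (s d : int) : exists z : plane, sf z = s%:~R /\ df z = d%:~R.
Proof.
exists ((s%:~R + d%:~R) / 2 - 1, (s%:~R - d%:~R) / 2 - 1).
by rewrite /sf /df /=; split; lra.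
Qed.

(** At a point of its block a tile is bounded by walls only, and these bound the other tile too.
    Hence a small step toward the interior of the other tile enters both interiors. *)
Lemma block_unique P P' s d : T P -> T P' -> inBlk (irep P) s d ->
  inCz (irep P) s d -> inCz (irep P') s d -> P = P'.
Proof.
move=> TP TP' bP iP iP'; have [z [es ed]] := point_of s d.
have Pz : reg (rtile (irep P)) z by rewrite /reg /= es ed inC_rtile.
have P'z : reg (rtile (irep P')) z by rewrite /reg /= es ed inC_rtile.
have [aP _ _] := Trep TP; have [aP' _ _] := Trep TP'.
have [c cP'] := sreg_nonempty m2 n2 aP'.
have sl' := sreg_dir (z := z) cP'.
have sl i : active (rtile (irep P)) z i -> slope i (c.1 - z.1, c.2 - z.2) < 0.
  move=> ai; apply: sl'; apply: ractive_active.
  exact: (inBlk_right_corner es ed bP).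
have [e e0 [h h']] := smallP (smallI (small_sreg Pz sl) (small_sreg P'z sl')).
exact: (tiling_eq Trep Ttriv TP TP' h h').
Qed.

(** False outside the rectangle, which provides the boundary values 0 on the mirrors. *)
Definition solid (s d : int) : bool :=
  `[< exists P, [/\ T P, inCz (irep P) s d, par p s && par p d & ~~ inBlk (irep P) s d] >].

Lemma solid_tile P s d : T P -> inCz (irep P) s d -> par p s -> par p d ->
  solid s d = ~~ inBlk (irep P) s d.
Proof.
move=> TP iP ps pd; apply/idP/idP => [/asboolP[P' [TP' iP' _ nb]]|nb].
  by apply/negP => b; move: nb; rewrite -(block_unique TP TP' b iP iP') b.
by apply/asboolP; exists P; rewrite ps pd.
Qed.

Lemma solid_in s d : solid s d -> [&& inrect Mz Nz s d, par p s & par p d].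
Proof. by case/asboolP => P [_ /andP[-> _] /andP[-> ->]]. Qed.

Lemma cell_cover ws wd e f : par (p + 1) ws -> par (p + 1) wd -> sign e -> sign f ->
  inrect Mz Nz ws wd -> inrect Mz Nz (ws + e) (wd + e) ->
  inrect Mz Nz (ws + f) (wd - f) -> exists2 P, T P & cell_in (irep P) ws wd e f.
Proof.
move=> pw pd se sf_ r1 r2 r3.
(* An interior point of the cell, with barycentric coordinates 1/2, 1/4, 1/4. *)
pose z : plane := ((ws%:~R + wd%:~R) / 2 + e%:~R / 4 - 1, (ws%:~R - wd%:~R) / 2 + f%:~R / 4 - 1).
have es : sf z = ws%:~R + (e%:~R + f%:~R) / 4 by rewrite /sf /z /=; lra.
have ed : df z = wd%:~R + (e%:~R - f%:~R) / 4 by rewrite /df /z /=; lra.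
have bf : (-1 <= f%:~R :> R) && (f%:~R <= 1 :> R) by case/orP: sf_ => /eqP ->; lra.
have be : (-1 <= e%:~R :> R) && (e%:~R <= 1 :> R) by case/orP: se => /eqP ->; lra.
have Qz : Q z.
  rewrite rectangleE es ed; move: r1 r2 r3; rewrite /inrect -!(ler_int R).
  by case/orP: sf_ => /eqP ->; case/orP: se => /eqP ->; lra.
move: Qz; rewrite -Tcov => -[P TP]; have [aP cP ->] := Tirep TP => Pz.
exists P => //; apply: (cell_inP m2 n2 cP) => //; clear aP cP TP r1 r2 r3 se sf_ pw pd.
move: Pz; rewrite /reg /= es ed {es ed z}.
case: (irep P) => [us ud|a1 a2 b1 b2]; rewrite /inC /inrect /inoct /cell_bounds /=;
  rewrite -!(ltr_int R) => ?; lra.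
Qed.

Lemma solid_block P s d : T P -> par p s -> par p d -> inBlk (irep P) s d ->
  solid s d = false.
Proof.
move=> TP ps pd b; apply/negbTE/negP => h; have /andP[r _] := solid_in h.
have [aP _ _] := Tirep TP.
move: (h); rewrite (solid_tile TP) // ?b // /inC r.
by move: b aP; case: (irep P) => // a1 a2 b1 b2 /=; lia.
Qed.

(** The solid neighbours number four at the centre of a diamond, none inside a block, two along an
    edge. Next to a block corner the point is the midpoint of a side of length 2; the two lateral
    neighbours are solid, and the opposite one is not, being off the rectangle or in the block of
    the tile beyond. *)
Lemma solid_parity ws wd : par (p + 1) ws -> par (p + 1) wd -> inrect Mz Nz ws wd ->
  solid (ws - 1) (wd - 1) (+) solid (ws - 1) (wd + 1) (+)
  solid (ws + 1) (wd - 1) (+) solid (ws + 1) (wd + 1) = false.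
Proof.
move=> pw pd rw.
have par1 x (k : int) : par (p + 1) x -> sign k -> par p (x + k).
  by rewrite /par /sign; lia.
have [e se re] : exists2 e, sign e & inrect Mz Nz (ws + e) (wd + e).
  have [h|h] := boolP (inrect Mz Nz (ws + 1) (wd + 1)); [exists 1 | exists (-1)] => //.
  by move: rw h pw pd; rewrite /inrect /par; lia.
have [f sf_ rf] : exists2 f, sign f & inrect Mz Nz (ws + f) (wd - f).
  have [h|h] := boolP (inrect Mz Nz (ws + 1) (wd - 1)); [exists 1 | exists (-1)] => //.
  by move: rw h pw pd; rewrite /inrect /par; lia.
have valF P k l : T P -> sign k -> sign l -> inBlk (irep P) (ws + k) (wd + l) ->
    solid (ws + k) (wd + l) = false.
  by move=> TP sk sl; apply: solid_block => //; exact: par1.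
have valT P k l : T P -> sign k -> sign l -> inCz (irep P) (ws + k) (wd + l) ->
    ~~ inBlk (irep P) (ws + k) (wd + l) -> solid (ws + k) (wd + l) = true.
  by move=> TP sk sl iP nb; rewrite (solid_tile TP) //; exact: par1.
have dia P us ud k l : T P -> irep P = Dia us ud -> inCz (irep P) ws wd ->
    sign k -> sign l -> solid (ws + k) (wd + l) = true.
  move=> TP EP Pw sk sl; have [aP cP _] := Tirep TP.
  apply: (valT P) => //; rewrite EP //.
  by move: sk sl aP cP Pw pw pd; rewrite EP /sign /inC /inrect /inoct /admissible /cls /par; clear; lia.
have [P TP Pc] := cell_cover pw pd se sf_ rw re rf; have /and3P[Pw _ _] := Pc.
have [aP cP _] := Tirep TP.
have s1 : sign 1 by []. have sm : sign (-1) by [].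
case EP : (irep P) => [us ud|a1 a2 b1 b2].
  by rewrite !(dia P us ud).
have vF k l := valF P k l TP; have vT k l := valT P k l TP.
move: aP cP Pc Pw vF vT; rewrite EP => aP cP Pc Pw vF vT.
have [hs|hs] := boolP ((a1 <= ws - 1) && (ws + 1 <= a2));
have [hd|hd] := boolP ((b1 <= wd - 1) && (wd + 1 <= b2)).
- by rewrite !vF // /inBlk; clear -hs hd; lia.
- have [hd'|hd'] := boolP (wd - 1 == b2).
    rewrite (vF (-1) (-1)) ?(vF 1 (-1)) ?(vT (-1) 1) ?(vT 1 1) //;
      move: aP cP Pw pw pd rw hs hd hd'; rewrite /inBlk /inC /inrect /inoct /admissible /cls /par; clear; lia.
  rewrite (vF (-1) 1) ?(vF 1 1) ?(vT (-1) (-1)) ?(vT 1 (-1)) //;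
      move: aP cP Pw pw pd rw hs hd hd'; rewrite /inBlk /inC /inrect /inoct /admissible /cls /par; clear; lia.
- have [hd'|hd'] := boolP (ws - 1 == a2).
    rewrite (vF (-1) (-1)) ?(vF (-1) 1) ?(vT 1 (-1)) ?(vT 1 1) //;
      move: aP cP Pw pw pd rw hs hd hd'; rewrite /inBlk /inC /inrect /inoct /admissible /cls /par; clear; lia.
  rewrite (vF 1 (-1)) ?(vF 1 1) ?(vT (-1) (-1)) ?(vT (-1) 1) //;
      move: aP cP Pw pw pd rw hs hd hd'; rewrite /inBlk /inC /inrect /inoct /admissible /cls /par; clear; lia.
have corner k l : sign k -> sign l -> inBlk (Blk a1 a2 b1 b2) (ws + k) (wd + l) ->
    [/\ solid (ws + k) (wd + l) = false, solid (ws - k) (wd + l) = true,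
        solid (ws + k) (wd - l) = true & solid (ws - k) (wd - l) = false].
  move=> sk sl bk; have skN := signN sk.
  have slN := signN sl.
  have F0 := vF k l sk sl bk.
  have Es : (k == 1) && (ws == a1 - 1) || (k == -1) && (ws == a2 + 1).
    by move: cP pw hs bk sk; rewrite /inBlk /cls /par /sign; clear; lia.
  have Ed : (l == 1) && (wd == b1 - 1) || (l == -1) && (wd == b2 + 1).
    by move: cP pd hd bk sl; rewrite /inBlk /cls /par /sign; clear; lia.
  have F1 : solid (ws - k) (wd + l) = true.
    apply: (vT (- k) l skN sl);
    move: aP rw; rewrite /inBlk /inC /inrect /inoct /admissible;
    move: m2 n2 Es Ed; clear => m2 n2 /orP[]/andP[/eqP-> /eqP->] /orP[]/andP[/eqP-> /eqP->]; lia.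
  have F2 : solid (ws + k) (wd - l) = true.
    apply: (vT k (- l) sk slN);
    move: aP rw; rewrite /inBlk /inC /inrect /inoct /admissible;
    move: m2 n2 Es Ed; clear => m2 n2 /orP[]/andP[/eqP-> /eqP->] /orP[]/andP[/eqP-> /eqP->]; lia.
  split => //; apply/negP => F3; have /andP[r3 _] := solid_in F3.
  (* A cell reaching to the opposite neighbour, which lies in the horizontal direction if [k] and
     [l] agree and in the vertical one otherwise. *)
  have [e' [f' [se' sf' re' rf' Ho]]] : exists e' f', [/\ sign e', sign f',
      inrect Mz Nz (ws + e') (wd + e'), inrect Mz Nz (ws + f') (wd - f')
    & (e' == - k) && (k == l) || (f' == - k) && (k == - l)].
    have [kl|kl] := eqVneq k l.
      exists (- k), f; rewrite eqxx; split => //.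
      by move: r3; rewrite -kl.
    have kl' : l = - k by move: sk sl kl; rewrite /sign; clear; lia.
    exists e, (- k); rewrite eqxx kl' opprK eqxx orbT; split => //.
    by move: r3; rewrite kl' opprK.
  have [P' TP' P'c] := cell_cover pw pd se' sf' rw re' rf'.
  have [aP' cP' _] := Tirep TP'.
  have nb k' l' : sign k' -> sign l' -> solid (ws + k') (wd + l') ->
      ~~ inBlk (irep P') (ws + k') (wd + l').
    by move=> sk' sl' h; apply/negP => b; move: h; rewrite (valF P').
  case EP' : (irep P') => [us ud|a1' a2' b1' b2'].
    by move: F0; have [P'w _ _] := and3P P'c; rewrite (dia P' us ud).
  have P'O : inCz (irep P') (ws - k) (wd - l).
    have [_ Pq Pq'] := and3P P'c; case/orP: Ho => /andP[/eqP Ee /eqP Ekl].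
      by move: Pq; rewrite Ee -Ekl.
    by move: Pq'; rewrite Ee Ekl !opprK.
  move: aP' cP' P'c P'O nb; rewrite EP' => aP' cP' P'c P'O nb.
  (* With the other three neighbours solid, the block of [P'] must contain the same corner neighbour
     as that of [P], and its octagon cannot reach the opposite one. *)
  have [k' [l' [sk' sl' ka lb]]] := cell_block aP' cP' pw pd P'c.
  move: (nb (- k) l skN sl F1) (nb k (- l) sk slN F2) (nb (- k) (- l) skN slN F3).
  move: cP' P'O pw pd sk sl sk' sl' ka lb; clear.
  rewrite /inBlk /sign /inC /inoct /cls /par => cP' /andP[_ P'O] pw pd sk sl sk' sl' ka lb.
  by case/orP: sk => /eqP ?; case/orP: sl => /eqP ?; subst; lia.
have [k [l [sk sl ka lb]]] := cell_block aP cP pw pd Pc.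
have bk : inBlk (Blk a1 a2 b1 b2) (ws + k) (wd + l) by move: ka lb; rewrite /inBlk; clear; lia.
have [] := corner k l sk sl bk.
by case/orP: sk => /eqP ->; case/orP: sl => /eqP ->; rewrite ?opprK => -> -> -> ->.
Qed.

End Solid.

(** * The wave equation over F_2 *)

Section Fold.
Variable g : int.
Hypothesis g0 : 0 < g.

(* Representative in [0, g] of t for the group generated by the reflections
   at 0 and at g. *)
Definition fold (t : int) : int :=
  let r := (t %% (2 * g))%Z in if r <= g then r else 2 * g - r.

Let g2 : 2 * g != 0. Proof. by lia. Qed.

Lemma fold_range t : 0 <= fold t <= g.
Proof.
have := modz_ge0 t g2; have := ltz_pmod t (_ : 0 < 2 * g).
rewrite /fold; set r := (t %% _)%Z => /(_ ltac:(lia)) h1 h2.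
by case: ifP; lia.
Qed.

Lemma foldD t (k : int) : fold (t + k * (2 * g)) = fold t.
Proof. by rewrite /fold addrC modzMDl. Qed.

Lemma fold_small t : 0 <= t <= g -> fold t = t.
Proof.
move=> tg; rewrite /fold modz_small; last by lia.
by case: ifP; lia.
Qed.

Lemma foldN t : fold (- t) = fold t.
Proof.
have et := divz_eq t (2 * g); have := modz_ge0 t g2; have := ltz_pmod t (_ : 0 < 2 * g).
move=> /(_ ltac:(lia)); move: et.
set r := (t %% _)%Z; set q := (t %/ _)%Z => et h1 h2.
have [r0|r0] := eqVneq r 0.
  have -> : - t = 0 + (- q) * (2 * g) by rewrite et r0; ring.
  by rewrite foldD /fold -/r r0 mod0z.
have -> : - t = (2 * g - r) + (- q - 1) * (2 * g) by rewrite et; ring.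
rewrite foldD /fold modz_small -/r; last by lia.
by case: ifP; case: ifP; lia.
Qed.

Lemma fold_par t p : par p (fold t) = par p t.
Proof.
have et := divz_eq t (2 * g).
rewrite /fold {3}et; set r := (t %% _)%Z; set q := (t %/ _)%Z.
have -> : q * (2 * g) = 2 * (q * g) by ring.
by rewrite /par; case: ifP; lia.
Qed.

Lemma fold_sym (B : Type) (p : int) (h : int -> B) t : (forall t, h (- t) = h t) ->
  (forall t, par p t -> h (t + 2 * g) = h t) -> par p t -> h (fold t) = h t.
Proof.
move=> hN hD pt.
have hk (k : nat) u : par p u -> h (u + k%:Z * (2 * g)) = h u.
  elim: k u => [|k IH] u pu; first by rewrite mul0r addr0.
  have -> : u + k.+1%:Z * (2 * g) = u + k%:Z * (2 * g) + 2 * g by rewrite -addn1 PoszD; ring.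
  rewrite hD ?IH //; have -> : k%:Z * (2 * g) = 2 * (k%:Z * g) by ring.
  by move: pu; rewrite /par; lia.
have hz (k : int) u : par p u -> h (u + k * (2 * g)) = h u.
  case: k => k pu; first exact: hk.
  have -> : u = u + Negz k * (2 * g) + k.+1%:Z * (2 * g) by rewrite NegzE; ring.
  rewrite hk; first by congr h; rewrite NegzE; ring.
  have -> : Negz k * (2 * g) = 2 * (Negz k * g) by ring.
  by move: pu; rewrite /par; lia.
have et := divz_eq t (2 * g); have pr : par p (t %% (2 * g))%Z.
  move: et pt; set r := (t %% _)%Z; set q := (t %/ _)%Z.
  have -> : q * (2 * g) = 2 * (q * g) by ring.
  by rewrite /par; lia.
have er : h (t %% (2 * g))%Z = h t by rewrite {2}et addrC hz.
rewrite /fold; case: ifP => // _; rewrite -er -[RHS]hN.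
have -> : 2 * g - (t %% (2 * g))%Z = - (t %% (2 * g))%Z + 1 * (2 * g) by ring.
by rewrite hz //; move: pr; rewrite /par; lia.
Qed.

End Fold.

(** * D'Alembert's formula *)

Section Wave.
Variables (m n : nat) (p : int) (S : int -> int -> bool).
Local Notation M := (m%:Z + 1 : int).
Local Notation N := (n%:Z + 1 : int).
Hypothesis S_in : forall s d, S s d -> [&& inrect M N s d, par p s & par p d].
Hypothesis S_wave : forall ws wd, par (p + 1) ws -> par (p + 1) wd -> inrect M N ws wd ->
  S (ws - 1) (wd - 1) (+) S (ws - 1) (wd + 1) (+)
  S (ws + 1) (wd - 1) (+) S (ws + 1) (wd + 1) = false.

(** Points with s - d = 2 form the bottom row; the profile sums S along it, each parity starting
    from 0. *)
Fixpoint wave_profile (k : nat) : bool :=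
  if k is k'.+2 then wave_profile k' (+) S k'.+2%:Z k'%:Z else false.

Let h (t : int) : bool := wave_profile `|fold M t|%N.

Let hN t : h (- t) = h t. Proof. by rewrite /h foldN. Qed.

Let hM t : h (t + 2 * M) = h t.
Proof. by rewrite /h -[2 * M]mul1r foldD. Qed.

Let hM' t : h (2 * M - t) = h t.
Proof. by rewrite addrC hM hN. Qed.

Let S_out s d : ~~ inrect M N s d -> S s d = false.
Proof. by move=> r; apply/negbTE/negP => /S_in /andP[]; rewrite (negbTE r). Qed.

Let h_step t : 0 <= t -> t + 2 <= M -> h (t + 2) = h t (+) S (t + 2) t.
Proof.
move=> t0 tM; rewrite /h !fold_small; try lia.
case: t t0 tM => [k|k] //= _ _.
have -> : (k + (1 + 1) = k.+2)%N by lia.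
by rewrite /= (_ : k%:Z + 2 = k.+2%:Z) //; lia.
Qed.

(** Here X = (s + d) / 2 and y = (s - d) / 2 are counted from the mirrors. Both sides satisfy the
    same recursion on two consecutive rows; they agree on y = 0 and y = 1 by the choice of [h], and
    on X = 0 and X = M by its symmetries. *)
Let wave_rows (y : nat) : y%:Z <= N -> forall X : int, 0 <= X <= M -> par p (X + y%:Z) ->
  S (X + y%:Z) (X - y%:Z) = h (X + y%:Z) (+) h (X - y%:Z).
Proof.
have edge (z X : int) : X = 0 \/ X = M -> S (X + z) (X - z) = h (X + z) (+) h (X - z).
  case=> ->; rewrite S_out; try (by rewrite /inrect; lia).
    by rewrite !add0r hN addbb.
  have -> : M + z = 2 * M - (M - z) by ring.
  by rewrite hM' addbb.
suff : (y%:Z <= N -> forall X : int, 0 <= X <= M -> par p (X + y%:Z) ->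
  S (X + y%:Z) (X - y%:Z) = h (X + y%:Z) (+) h (X - y%:Z)) /\
  (y.+1%:Z <= N -> forall X : int, 0 <= X <= M -> par p (X + y.+1%:Z) ->
  S (X + y.+1%:Z) (X - y.+1%:Z) = h (X + y.+1%:Z) (+) h (X - y.+1%:Z)) by case.
elim: y => [|y [IH0 IH1]].
  split=> _ X X0 pX; first by (have -> : X - 0%:Z = X + 0%:Z by lia); rewrite addbb S_out // /inrect; lia.
  have [XE|XE] := boolP ((X == 0) || (X == M)); first by apply: edge; lia.
  have := @h_step (X - 1); have -> : X - 1 + 2 = X + 1 by ring.
  by move=> -> //; try lia; rewrite addbC addbA addbb.
split=> [//|yN X X0 pX].
have [XE|XE] := boolP ((X == 0) || (X == M)); first by apply: edge; lia.
have := @S_wave (X + y.+1%:Z) (X - y.+1%:Z).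
have e1 : X + y.+1%:Z - 1 = X + y%:Z by lia.
have e2 : X - y.+1%:Z - 1 = X - y.+2%:Z by lia.
have e3 : X - y.+1%:Z + 1 = X - y%:Z by lia.
have e4 : X + y.+1%:Z + 1 = X + y.+2%:Z by lia.
rewrite e1 e2 e3 e4.
have := IH1 ltac:(lia) (X - 1) ltac:(lia) ltac:(move: pX; rewrite /par; lia).
have e5 : X - 1 + y.+1%:Z = X + y%:Z by lia.
have e6 : X - 1 - y.+1%:Z = X - y.+2%:Z by lia.
rewrite e5 e6 => ->.
rewrite (IH0 ltac:(lia) X) //; last by move: pX; rewrite /par; lia.
have := IH1 ltac:(lia) (X + 1) ltac:(lia) ltac:(move: pX; rewrite /par; lia).
have e7 : X + 1 + y.+1%:Z = X + y.+2%:Z by lia.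
have e8 : X + 1 - y.+1%:Z = X - y%:Z by lia.
rewrite e7 e8 => -> /(_ _ _ _) H.
have {}H := H ltac:(move: pX; clear; rewrite /par; lia) ltac:(move: pX; clear; rewrite /par; lia)
  ltac:(move: X0 XE yN; clear; rewrite /inrect; lia).
by move: H; case: (S _ _); case: (h (X + y%:Z)); case: (h (X - y%:Z));
  case: (h (X + y.+2%:Z)); case: (h (X - y.+2%:Z)).
Qed.

Lemma wave_solution : exists h : int -> bool,
  [/\ forall t, h (- t) = h t, forall t, h (t + 2 * M) = h t,
      forall t, par p t -> h (t + 2 * N) = h t
    & forall s d, par p s -> par p d -> inrect M N s d -> S s d = h s (+) h d].
Proof.
exists h; split => //.
(* On the upper mirror S vanishes, so h (X + N) = h (X - N) for 0 <= X <= M; folding extends this to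
   all X of the right parity. *)
- have top X : 0 <= X <= M -> par p (X + N) -> h (X + N) = h (X - N).
    move=> XM pX; have := @wave_rows n.+1 ltac:(lia) X XM.
    have -> : n.+1%:Z = N by lia.
    move=> /(_ pX); rewrite S_out; last by rewrite /inrect; lia.
    by case: (h _); case: (h _).
  move=> t pt; have M0 : 0 < M by lia.
  have := @fold_sym M M0 bool (p + N) (fun X => h (X + N) (+) h (X - N)) (t + N).
  have -> : t + N + N = t + 2 * N by ring.
  rewrite addrK top.
  + rewrite addbb => /(_ _ _ _) H.
    have {H} : false = h (t + 2 * N) (+) h t.
      apply: H.
      * move=> u; have -> : - u + N = - (u - N) by ring.
        have -> : - u - N = - (u + N) by ring.
        by rewrite !hN addbC.
      * move=> u _; have -> : u + 2 * M + N = u + N + 2 * M by ring.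
        have -> : u + 2 * M - N = u - N + 2 * M by ring.
        by rewrite !hM.
      * by move: pt; rewrite /par; lia.
    by case: (h _); case: (h _).
  + exact: fold_range.
  + have := fold_par M0 (t + N) (p + N); move: pt; rewrite /par; lia.
- move=> s d ps pd r.
  have := @wave_rows `|((s - d) %/ 2)%Z|%N _ ((s + d) %/ 2)%Z.
  have ey : `|((s - d) %/ 2)%Z|%N%:Z = ((s - d) %/ 2)%Z by move: r; rewrite /inrect; lia.
  rewrite ey; have -> : ((s + d) %/ 2)%Z + ((s - d) %/ 2)%Z = s by move: ps pd; rewrite /par; lia.
  have -> : ((s + d) %/ 2)%Z - ((s - d) %/ 2)%Z = d by move: ps pd; rewrite /par; lia.
  by apply=> //; move: r; rewrite /inrect; lia.
Qed.

End Wave.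

(** * The tiling of a function *)

Section Runs.
Variables (p : int) (h : int -> bool).

Definition run (c : bool) (a b : int) : Prop :=
  [/\ forall t, par p t -> a <= t <= b -> h t = c, h (a - 2) = ~~ c & h (b + 2) = ~~ c].

(** The tiles on which h s (+) h d has the right values: true at all vertices of a diamond; false
    exactly on a block and true at the class points next to its sides. *)
Definition hadm (t : tile int) : Prop :=
  match t with
  | Dia ws wd => [/\ h (ws - 1) = h (ws + 1), h (wd - 1) = h (wd + 1)
                  & h (wd - 1) = ~~ h (ws - 1)]
  | Blk a1 a2 b1 b2 => run (h a1) a1 a2 /\ run (h a1) b1 b2
  end.

(** Two different runs of one value are separated by a point of the other value, so they cannot
    overlap or come within 2 of each other. *)
Lemma run_eq c a b a' b' : par p a -> par p b -> par p a' -> par p b' ->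
  a <= b -> a' <= b' -> run c a b -> run c a' b' -> a' <= b + 2 -> a <= b' + 2 ->
  a = a' /\ b = b'.
Proof.
move=> pa pb pa' pb' ab ab' [H Ha Hb] [H' Ha' Hb'] h1 h2.
have nc : c <> ~~ c by case: (c).
have par2 x : par p x -> par p (x - 2) /\ par p (x + 2) by rewrite /par; clear; lia.
have q1 : ~ (a <= a' - 2 <= b) by move=> k; apply: nc; rewrite -Ha' H // (par2 _ pa').1.
have q2 : ~ (a' <= a - 2 <= b') by move=> k; apply: nc; rewrite -Ha H' // (par2 _ pa).1.
have q3 : ~ (a <= b' + 2 <= b) by move=> k; apply: nc; rewrite -Hb' H // (par2 _ pb').2.
have q4 : ~ (a' <= b + 2 <= b') by move=> k; apply: nc; rewrite -Hb H' // (par2 _ pb).2.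
by move: q1 q2 q3 q4 pa pb pa' pb' ab ab' h1 h2; clear; rewrite /par; lia.
Qed.

Lemma run_ext c a b t k : par p a -> par p b -> par p t -> run c a b -> sign k ->
  a <= t <= b -> h (t + 2 * k) = c -> a <= t + 2 * k <= b.
Proof.
move=> pa pb pt [_ Ha Hb] sk tab hc; apply: contrapT => n.
have [E|E] : t + 2 * k = a - 2 \/ t + 2 * k = b + 2.
- by move: pa pb pt sk tab n; clear; rewrite /par /sign; lia.
- by move: Ha; rewrite -E hc; case: (c).
- by move: Hb; rewrite -E hc; case: (c).
Qed.

Hypothesis hN : forall t, h (- t) = h t.

Lemma run_opp c a b : run c a b -> run c (- b) (- a).
Proof.
move=> [H Ha Hb]; split.
- move=> t pt tab; rewrite -hN; apply: H; move: pt tab; clear; rewrite /par; lia.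
- by rewrite -opprD hN.
- by rewrite addrC -opprB hN.
Qed.

Lemma run_shift c a b k : par 0 k -> (forall t, par p t -> h (t + k) = h t) -> par p a -> par p b ->
  run c a b -> run c (a + k) (b + k).
Proof.
move=> pk hk pa pb [H Ha Hb]; split.
- move=> t pt tab; have -> : t = t - k + k by ring.
  rewrite hk; last by move: pt pk; clear; rewrite /par; lia.
  by apply: H; move: pt pk tab; clear; rewrite /par; lia.
- have -> : a + k - 2 = a - 2 + k by ring.
  by rewrite hk //; move: pa; clear; rewrite /par; lia.
- have -> : b + k + 2 = b + 2 + k by ring.
  by rewrite hk //; move: pb; clear; rewrite /par; lia.
Qed.

Variable K : int.
Hypothesis K0 : 0 < K.
Hypothesis hK : forall t, h (t + 2 * K) = h t.
Hypothesis h_nonconst : exists t t', [/\ par p t, par p t' & h t != h t'].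

(** Periodicity brings a point with the other value above [t]; the run ends just before the first
    such point. *)
Let run_up t : par p t -> exists b, [/\ par p b, t <= b, h (b + 2) = ~~ h t &
  forall u, par p u -> t <= u <= b -> h u = h t].
Proof.
move=> pt; have [t' pt' ht'] : exists2 t', par p t' & h t' != h t.
  have [t1 [t2 [p1 p2 h12]]] := h_nonconst.
  have [E|E] := eqVneq (h t1) (h t); last by exists t1.
  by exists t2 => //; rewrite -E eq_sym.
have hk (k : nat) u : h (u + k%:Z * (2 * K)) = h u.
  elim: k u => [|k IH] u; first by rewrite mul0r addr0.
  have -> : u + k.+1%:Z * (2 * K) = u + k%:Z * (2 * K) + 2 * K by rewrite -addn1 PoszD; ring.
  by rewrite hK IH.
have ex : exists k : nat, h (t + 2 * k.+1%:Z) != h t.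
  set j := (`|t - t'|%N).+1.
  have le : j%:Z * 2 <= j%:Z * (2 * K).
    by rewrite ler_pM2l //; move: K0; clear; lia.
  have e2 : j%:Z * (2 * K) = 2 * (j%:Z * K) by ring.
  exists `|((t' + j%:Z * (2 * K) - t) %/ 2)%Z - 1|%N.
  have -> : t + 2 * (`|((t' + j%:Z * (2 * K) - t) %/ 2)%Z - 1|%N).+1%:Z = t' + j%:Z * (2 * K).
    move: le pt pt'; rewrite e2 /par /j; move: (_ * K) => x; clear; lia.
  by rewrite hk.
pose k0 := ex_minn ex; exists (t + 2 * k0%:Z); split.
- by move: pt; clear; rewrite /par; lia.
- by clear; lia.
- rewrite /k0; case: ex_minnP => k hk' _.
  have -> : t + 2 * k%:Z + 2 = t + 2 * k.+1%:Z by clear; lia.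
  by move: hk'; case: (h _); case: (h _).
- rewrite /k0; case: ex_minnP => k _ kmin u pu ub.
  have [-> //|ut] := eqVneq u t.
  apply/eqP/negPn/negP => hu.
  have := kmin `|((u - t) %/ 2)%Z - 1|%N.
  have -> : t + 2 * (`|((u - t) %/ 2)%Z - 1|%N).+1%:Z = u.
    by move: ub ut pu pt; clear; rewrite /par; lia.
  by move=> /(_ hu); move: ub ut pu pt; clear; rewrite /par; lia.
Qed.

Lemma run_exists t : par p t ->
  exists a b, [/\ par p a, par p b, a <= t <= b & run (h t) a b].
Proof.
move=> pt; have [b [pb tb hb Hb]] := run_up pt.
have pt' : par p (- t) by move: pt; clear; rewrite /par; lia.
have [a [pa ta ha Ha]] := run_up pt'.
exists (- a), b; split => //.
- by move: pa; clear; rewrite /par; lia.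
- by move: ta tb; clear; lia.
- split=> //; last by rewrite -opprD hN ha hN.
  move=> u pu uab; have [ut|ut] := lerP t u.
    by apply: Hb; move: uab ut => // /andP[_ ->] ->.
  by rewrite -hN Ha ?hN //; move: pu uab ut; clear; rewrite /par; lia.
Qed.

End Runs.

(** * The tiling attached to h *)

Section TilingOfFunction.
Variables (R : realType) (m n : nat).
Local Notation plane := (R * R)%type.
Local Notation M := (m%:R + 1 : R).
Local Notation N := (n%:R + 1 : R).
Local Notation Q := (rectangle R m n).
Local Notation reg := (@reg R m n).

Hypothesis m2 : (2 <= m)%N.
Hypothesis n2 : (2 <= n)%N.

Local Notation adm := (@admissible R M N).
Local Notation active := (@active R m n).
Local Notation Mz := (m%:Z + 1 : int).
Local Notation Nz := (n%:Z + 1 : int).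
Local Notation rtile := (@rtile R).
Local Notation admz := (admissible Mz Nz).
Local Notation cell_in := (@cell_in m n).
Variables (p : int) (h : int -> bool).
Hypothesis hN : forall t, h (- t) = h t.
Hypothesis hM : forall t, h (t + 2 * Mz) = h t.
Hypothesis hNz : forall t, par p t -> h (t + 2 * Nz) = h t.

Definition htile : set (tile int) := [set u | [/\ admz u, cls p u & hadm p h u]].

Definition hT : set (set plane) := [set reg (rtile u) | u in htile].

Let hMr t : h (2 * Mz - t) = h t.
Proof. by rewrite addrC hM hN. Qed.

Let signs : sign 1 /\ sign (-1). Proof. by []. Qed.

Lemma nbr_par x k : par (p + 1) x -> sign k -> par p (x + k).
Proof. by clear; rewrite /par /sign; lia. Qed.

(* h s (+) h d vanishes on the mirrors, so a point with four solid neighbours is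
   not adjacent to a mirror. *)
Lemma diamond_hadm ws wd : par (p + 1) ws -> par (p + 1) wd -> inrect Mz Nz ws wd ->
  h (ws - 1) = h (ws + 1) -> h (wd - 1) = h (wd + 1) -> h (wd - 1) = ~~ h (ws - 1) ->
  htile (Dia ws wd).
Proof.
move=> pw pd rw hs hd hsd.
have ne : h (wd - 1) <> h (ws - 1) by rewrite hsd; case: (h _).
split => //; last by rewrite /cls; move: pw pd; clear; rewrite /par; lia.
have n1 : ws + wd <> 2.
  by move=> E; apply: ne; rewrite -hN; congr h; move: E; clear; lia.
have n2' : ws + wd <> 2 * Mz - 2.
  move=> E; apply: ne; rewrite hd hs -[RHS]hMr; congr h; move: E; clear; lia.
have n3 : ws - wd <> 2.
  by move=> E; apply: ne; rewrite hd; congr h; move: E; clear; lia.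
have n4 : ws - wd <> 2 * Nz - 2.
  move=> E; apply: ne; rewrite hs -hNz; last by move: pd; clear; rewrite /par; lia.
  by congr h; move: E; clear; lia.
by move: rw pw pd n1 n2' n3 n4; rewrite /inrect /admissible /par; clear; lia.
Qed.

(** If the octagon crosses a wall, the run of [s] and the mirror image of the run of [d] come within
    2 of each other, so they coincide: this is the symmetry required there. The last hypothesis
    excludes a one-point block on a mirror, whose clipped octagon has no interior. *)
Lemma block_hadm a1 a2 b1 b2 s d c : cls p (Blk a1 a2 b1 b2) ->
  a1 <= s <= a2 -> b1 <= d <= b2 -> run p h c a1 a2 -> run p h c b1 b2 ->
  0 <= s + d <= 2 * Mz -> 0 <= s - d <= 2 * Nz ->
  (a1 < a2) || (b1 < b2) || inrect Mz Nz s d -> htile (Blk a1 a2 b1 b2).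
Proof.
move=> /and4P[p1 p2 p3 p4] sa db ra rb X Y ndeg.
split; last 1 first.
- have pa1 : h a1 = c.
    by have [H _ _] := ra; apply: H => //; move: sa; clear; lia.
  by rewrite /hadm pa1.
- have a12 : a1 <= a2 by move: sa; clear; lia.
  have b12 : b1 <= b2 by move: db; clear; lia.
  have parN x : par p x -> par p (- x) by clear; rewrite /par; lia.
  have parD x (k : int) : par p x -> par p (x + 2 * k) by clear; rewrite /par; lia.
  have e2 (x y : int) : x <= y -> - y <= - x by clear; lia.
  have L := run_eq p1 p2 (parN _ p4) (parN _ p3) a12 (e2 _ _ b12) ra (run_opp hN rb).
  have per0 (k : int) : par 0 (2 * k) by clear; rewrite /par; lia.
  have Rr := run_shift (per0 Mz) (fun t _ => hM t) (parN _ p4) (parN _ p3) (run_opp hN rb).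
  have le2 (x y z : int) : x <= y -> x + z <= y + z by clear; lia.
  have RR := run_eq p1 p2 (parD _ Mz (parN _ p4)) (parD _ Mz (parN _ p3)) a12
    (le2 _ _ _ (e2 _ _ b12)) ra Rr.
  have B := run_eq p1 p2 p3 p4 a12 b12 ra rb.
  have Tr := run_shift (per0 Nz) hNz p3 p4 rb.
  have TT := run_eq p1 p2 (parD _ Nz p3) (parD _ Nz p4) a12 (le2 _ _ _ b12) ra Tr.
  move: p1 p2 p3 p4 sa db X Y ndeg L RR B TT; clear; rewrite /par /inrect /admissible.
  move=> p1 p2 p3 p4 sa db X Y ndeg L RR B TT.
  apply/and5P; split; [lia|lia| | |apply/andP; split].
  + case: (boolP (4 <= a1 + b1)) => //= k; have [] := L; clear L RR B TT; lia.
  + case: (boolP (a2 + b2 <= 2 * (m%:Z + 1) - 4)) => //= k; have [] := RR; clear L RR B TT; lia.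
  + case: (boolP (4 <= a1 - b2)) => //= k; have [] := B; clear L RR B TT; lia.
  + case: (boolP (a2 - b1 <= 2 * (n%:Z + 1) - 4)) => //= k; have [] := TT; clear L RR B TT; lia.
- by rewrite /cls p1 p2 p3 p4.
Qed.

Hypothesis h_nonconst : exists t t', [/\ par p t, par p t' & h t != h t'].

(** The values of [h] at [ws - 1], [ws + 1] and at [wd - 1], [wd + 1] determine the tile: a diamond
    if both pairs are constant with different values, otherwise the product of the runs through a
    neighbour with equal values. *)
Lemma htile_cover z : Q z -> exists2 u, htile u & reg (rtile u) z.
Proof.
move=> /(cell_of_point m2 n2 p)[ws [wd [e [f [/andP[pw pd] /andP[se sf_] zc /and3P[r1 r2 r3]]]]]].
suff [u hu cu] : exists2 u, htile u & cell_in u ws wd e f.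
  by exists u => //; exact: cell_in_reg zc cu.
have M0 : 0 < Mz by clear; lia.
have [sN s1] := signs.
have [hs|hs] := eqVneq (h (ws - 1)) (h (ws + 1));
have [hd|hd] := eqVneq (h (wd - 1)) (h (wd + 1)).
- have [hsd|hsd] := eqVneq (h (wd - 1)) (h (ws - 1)); last first.
    have hu : htile (Dia ws wd).
      by apply: diamond_hadm => //; move: hsd; case: (h _); case: (h _).
    exists (Dia ws wd) => //; move: r1 r2 r3 se sf_; clear.
    by rewrite /cell_in /inC /inoct /sign => -> -> -> /orP[]/eqP-> /orP[]/eqP->; lia.
  have pk := nbr_par pw s1; have pl := nbr_par pd s1.
  have [a1 [a2 [p1 p2 ha ra]]] := run_exists hN M0 hM h_nonconst pk.
  have [b1 [b2 [p3 p4 hb rb]]] := run_exists hN M0 hM h_nonconst pl.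
  rewrite hsd in rb; have sa := run_ext p1 p2 pk ra sN ha _.
  have {}sa := sa ltac:(rewrite (_ : ws - 1 + 2 * 1 = ws + 1) -?hs //; clear; lia).
  have sb := run_ext p3 p4 pl rb sN hb _.
  have {}sb := sb ltac:(rewrite (_ : wd - 1 + 2 * 1 = wd + 1) -?hd ?hsd //; clear; lia).
  exists (Blk a1 a2 b1 b2).
    apply: (block_hadm (s := ws - 1) (d := wd - 1) (c := h (ws - 1))) => //.
    + by rewrite /cls p1 p2 p3 p4.
    + by move: r1; rewrite /inrect; clear; lia.
    + by move: r1; rewrite /inrect; clear; lia.
    + by apply/orP; left; apply/orP; left; move: ha sa; clear; lia.
  move: r1 r2 r3 se sf_ ha hb sa sb; clear.
  rewrite /cell_in /inC /inoct /sign => -> -> -> /orP[]/eqP-> /orP[]/eqP-> /=; lia.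
- have [l [sl hl]] : exists l, sign l /\ h (wd + l) = h (ws - 1).
    have [E|E] := eqVneq (h (wd + 1)) (h (ws - 1)); first by exists 1.
    by exists (-1); split => //; move: hd E; case: (h _); case: (h _); case: (h _).
  have pk := nbr_par pw s1; have pl := nbr_par pd sl.
  have [a1 [a2 [p1 p2 ha ra]]] := run_exists hN M0 hM h_nonconst pk.
  have [b1 [b2 [p3 p4 hb rb]]] := run_exists hN M0 hM h_nonconst pl.
  rewrite hl in rb; have sa := run_ext p1 p2 pk ra sN ha _.
  have {}sa := sa ltac:(rewrite (_ : ws - 1 + 2 * 1 = ws + 1) -?hs //; clear; lia).
  exists (Blk a1 a2 b1 b2).
    apply: (block_hadm (s := ws - 1) (d := wd + l) (c := h (ws - 1))) => //.
    + by rewrite /cls p1 p2 p3 p4.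
    + by move: r1 sl; rewrite /inrect /sign; clear; lia.
    + by move: r1 sl; rewrite /inrect /sign; clear; lia.
    + by apply/orP; left; apply/orP; left; move: ha sa; clear; lia.
  move: r1 r2 r3 se sf_ ha hb sa sl; clear.
  rewrite /cell_in /inC /inoct /sign => -> -> -> /orP[]/eqP-> /orP[]/eqP-> /=; lia.
- have [k [sk hk]] : exists k, sign k /\ h (ws + k) = h (wd - 1).
    have [E|E] := eqVneq (h (ws + 1)) (h (wd - 1)); first by exists 1.
    by exists (-1); split => //; move: hs E; case: (h _); case: (h _); case: (h _).
  have pk := nbr_par pw sk; have pl := nbr_par pd s1.
  have [a1 [a2 [p1 p2 ha ra]]] := run_exists hN M0 hM h_nonconst pk.
  have [b1 [b2 [p3 p4 hb rb]]] := run_exists hN M0 hM h_nonconst pl.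
  rewrite hk in ra; have sb := run_ext p3 p4 pl rb sN hb _.
  have {}sb := sb ltac:(rewrite (_ : wd - 1 + 2 * 1 = wd + 1) -?hd //; clear; lia).
  exists (Blk a1 a2 b1 b2).
    apply: (block_hadm (s := ws + k) (d := wd - 1) (c := h (wd - 1))) => //.
    + by rewrite /cls p1 p2 p3 p4.
    + by move: r1 sk; rewrite /inrect /sign; clear; lia.
    + by move: r1 sk; rewrite /inrect /sign; clear; lia.
    + by apply/orP; left; apply/orP; right; move: hb sb; clear; lia.
  move: r1 r2 r3 se sf_ ha hb sb sk; clear.
  rewrite /cell_in /inC /inoct /sign => -> -> -> /orP[]/eqP-> /orP[]/eqP-> /=; lia.
(* Neither pair is constant, so the values of [h] agree at exactly one pair of opposite neighbours.
   The acute vertices of the cell contain one point of each opposite pair. *)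
- have [k [l [sk sl hk rk kl]]] : exists k l, [/\ sign k, sign l, h (wd + l) = h (ws + k),
     inrect Mz Nz (ws + k) (wd + l) & ((k == e) && (l == e)) || ((k == f) && (l == - f))].
    have [E|E] := eqVneq (h (wd + e)) (h (ws + e)).
      by exists e, e; rewrite !eqxx.
    exists f, (- f); rewrite !eqxx orbT; split => //; first exact: signN.
    move: E hs hd; case/orP: se => /eqP ->; case/orP: sf_ => /eqP ->; rewrite ?opprK;
      by case: (h (ws - 1)); case: (h (ws + 1)); case: (h (wd - 1)); case: (h (wd + 1)).
  have pk := nbr_par pw sk; have pl := nbr_par pd sl.
  have [a1 [a2 [p1 p2 ha ra]]] := run_exists hN M0 hM h_nonconst pk.
  have [b1 [b2 [p3 p4 hb rb]]] := run_exists hN M0 hM h_nonconst pl.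
  rewrite hk in rb.
  exists (Blk a1 a2 b1 b2).
    apply: (block_hadm (s := ws + k) (d := wd + l) (c := h (ws + k))) => //.
    + by rewrite /cls p1 p2 p3 p4.
    + by move: rk; rewrite /inrect; clear; lia.
    + by move: rk; rewrite /inrect; clear; lia.
    + by rewrite rk orbT.
  move: r1 r2 r3 se sf_ ha hb kl; clear.
  rewrite /cell_in /inC /inoct /sign => -> -> -> /orP[]/eqP-> /orP[]/eqP-> /=; lia.
Qed.

Let run_in c a b t : run p h c a b -> par p t -> a <= t <= b -> h t = c.
Proof. by case=> H _ _; exact: H. Qed.

(** Both blocks contain a neighbour of the right angle of the cell. Blocks of the same value then
    agree by [run_eq]; blocks of different values could only hold opposite neighbours, and then no
    cell at this point is in both octagons. *)
Lemma htile_unique u u' ws wd e f : htile u -> htile u' ->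
  par (p + 1) ws -> par (p + 1) wd -> sign e -> sign f ->
  cell_in u ws wd e f -> cell_in u' ws wd e f -> u = u'.
Proof.
move=> [au cu hu] [au' cu' hu'] pw pd se sf_ iu iu'.
have diaE us ud : cls p (Dia us ud) -> cell_in (Dia us ud) ws wd e f -> us = ws /\ ud = wd.
  by move: pw pd se sf_; clear; rewrite /cell_in /cls /par /sign /inC /inoct; lia.
have dia_block us ud a1 a2 b1 b2 : hadm p h (Dia us ud) -> cls p (Dia us ud) ->
    cell_in (Dia us ud) ws wd e f -> hadm p h (Blk a1 a2 b1 b2) -> cls p (Blk a1 a2 b1 b2) ->
    admz (Blk a1 a2 b1 b2) -> cell_in (Blk a1 a2 b1 b2) ws wd e f -> False.
  move=> hD cD iD hB cB aB iB; have [E1 E2] := diaE _ _ cD iD; subst us ud.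
  have [k [l [sk sl ka lb]]] := cell_block aB cB pw pd iB.
  have [ra rb] := hB; have [d1 d2 d3] := hD.
  have E1 := run_in ra (nbr_par pw sk) ka; have E2 := run_in rb (nbr_par pd sl) lb.
  move: E1 E2 => <-; move: sk sl => /orP[]/eqP-> /orP[]/eqP->; rewrite -?d1 -?d2 d3;
    by case: (h _).
case: u au cu hu iu => [us ud|a1 a2 b1 b2] au cu hu iu;
case: u' au' cu' hu' iu' => [us' ud'|a1' a2' b1' b2'] au' cu' hu' iu'.
- by have [-> ->] := diaE _ _ cu iu; have [-> ->] := diaE _ _ cu' iu'.
- by case: (dia_block us ud a1' a2' b1' b2').
- by case: (dia_block us' ud' a1 a2 b1 b2).
have [k [l [sk sl ka lb]]] := cell_block au cu pw pd iu.
have [k' [l' [sk' sl' ka' lb']]] := cell_block au' cu' pw pd iu'.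
have [ra rb] := hu; have [ra' rb'] := hu'.
have [p1 p2 p3 p4] := and4P cu; have [p1' p2' p3' p4'] := and4P cu'.
have E1 := run_in ra (nbr_par pw sk) ka; have E2 := run_in rb (nbr_par pd sl) lb.
have E1' := run_in ra' (nbr_par pw sk') ka'; have E2' := run_in rb' (nbr_par pd sl') lb'.
have same : h a1 = h a1' -> Blk a1 a2 b1 b2 = Blk a1' a2' b1' b2'.
  move=> E; rewrite -E in ra' rb'.
  have [-> ->] : a1 = a1' /\ a2 = a2'.
    apply: run_eq ra ra' _ _ => //; move: ka ka' sk sk'; clear; rewrite /sign; lia.
  have [-> -> //] : b1 = b1' /\ b2 = b2'.
  apply: run_eq rb rb' _ _ => //; move: lb lb' sl sl'; clear; rewrite /sign; lia.
have [kk|kk] := eqVneq k k'; first by apply: same; rewrite -E1 -E1' kk.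
have [ll|ll] := eqVneq l l'; first by apply: same; rewrite -E2 -E2' ll.
have [E|E] := eqVneq (h a1) (h a1'); first exact: same.
have na : ~ (a1 <= ws + k' <= a2).
  by move=> H; move/eqP: E; apply; rewrite -(run_in ra (nbr_par pw sk') H).
have nb : ~ (b1 <= wd + l' <= b2).
  by move=> H; move/eqP: E; apply; rewrite -(run_in rb (nbr_par pd sl') H) -E2'.
have na' : ~ (a1' <= ws + k <= a2').
  by move=> H; move/eqP: E; apply; rewrite -(run_in ra' (nbr_par pw sk) H).
have nb' : ~ (b1' <= wd + l <= b2').
  by move=> H; move/eqP: E; apply; rewrite -(run_in rb' (nbr_par pd sl) H) -E2.
exfalso; move: p1 p2 p3 p4 p1' p2' p3' p4' pw pd.
move: iu iu' na nb na' nb' ka lb ka' lb' kk ll se sf_ sk sk' sl sl'.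
clear; rewrite /cell_in /inC /inoct /sign /par.
move=> /and3P[/andP[_ i1] /andP[_ i2] /andP[_ i3]] /and3P[/andP[_ j1] /andP[_ j2] /andP[_ j3]].
move=> na nb na' nb' ka lb ka' lb' kk ll se sf_ sk sk' sl sl'.
move=> p1 p2 p3 p4 p1' p2' p3' p4' pw pd.
have kE : k' = - k by move: kk sk sk'; clear; lia.
have lE : l' = - l by move: ll sl sl'; clear; lia.
subst k' l'; clear kk ll sk' sl'.
by case/orP: sk => /eqP ?; case/orP: sl => /eqP ?; subst; lia.
Qed.

Lemma hT_trivIset : trivIset hT (fun P => interior P).
Proof.
move=> _ _ [u hu <-] [u' hu' <-] [z [/interior_sreg zu /interior_sreg zu']].
have [au cu _] := hu; have [au' cu' _] := hu'.
have Qz : Q z := reg_sub (sreg_reg zu).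
have [ws [wd [e [f [/andP[pw pd] /andP[se sf_] zc _]]]]] := cell_of_point m2 n2 p Qz.
rewrite (@htile_unique u u' ws wd e f) //.
  exact: cell_in_sreg cu pw pd se sf_ zc zu.
exact: cell_in_sreg cu' pw pd se sf_ zc zu'.
Qed.

Lemma hT_cover : \bigcup_(P in hT) P = Q.
Proof.
apply/seteqP; split=> [z [_ [u _ <-]] /reg_sub //|z /htile_cover[u hu uz]].
by exists (reg (rtile u)) => //; exists u.
Qed.

Lemma hT_finite : finite_set hT.
Proof.
(* A crude bound for the entries of an admissible tile. *)
pose K := (8 * (m + n + 2))%N.
pose c (i : 'I_K.*2) : int := i%:Z - K%:Z.
pose F (x : bool * ('I_K.*2 * 'I_K.*2 * ('I_K.*2 * 'I_K.*2))) : tile int :=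
  if x.1 then Dia (c x.2.1.1) (c x.2.1.2)
  else Blk (c x.2.1.1) (c x.2.1.2) (c x.2.2.1) (c x.2.2.2).
apply: (@sub_finite_set _ _ ((fun x => reg (rtile (F x))) @` [set: _])); last first.
  exact/finite_image/finite_finset.
have cK (x : int) : - K%:Z <= x < K%:Z -> exists i, c i = x.
  move=> xK; have iK : (`|(x + K%:Z)%R| < K.*2)%N by move: xK; clear; lia.
  by exists (Ordinal iK); rewrite /c /=; move: xK; clear; lia.
move=> _ [u [au _ _] <-]; case: u au => [ws wd|a1 a2 b1 b2] au.
  have [i Ei] := cK ws ltac:(move: au; rewrite /admissible /K; clear; lia).
  have [j Ej] := cK wd ltac:(move: au; rewrite /admissible /K; clear; lia).
  by exists (true, ((i, j), (i, j))) => //; rewrite /F /= Ei Ej.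
have [i Ei] := cK a1 ltac:(move: au; rewrite /admissible /K; clear; lia).
have [j Ej] := cK a2 ltac:(move: au; rewrite /admissible /K; clear; lia).
have [k Ek] := cK b1 ltac:(move: au; rewrite /admissible /K; clear; lia).
have [l El] := cK b2 ltac:(move: au; rewrite /admissible /K; clear; lia).
by exists (false, ((i, j), (k, l))) => //; rewrite /F /= Ei Ej Ek El.
Qed.

(** * A given tiling is the one attached to its function *)

Section Given.
Variables (T : set (set plane)) (irep : set plane -> tile int).
Hypothesis Tirep : forall P, T P ->
  [/\ admz (irep P), cls p (irep P) & P = reg (rtile (irep P))].
Hypothesis Tcov : \bigcup_(P in T) P = Q.
Hypothesis Ttriv : trivIset T (fun P => interior P).
Local Notation solid := (@solid R m n T irep p).
Hypothesis solid_h : forall s d, par p s -> par p d -> inrect Mz Nz s d ->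
  solid s d = h s (+) h d.

(* Off the rectangle, reflections in the mirrors bring a point of the closed
   block back inside. *)
Lemma around_block P a1 a2 b1 b2 s d : T P -> irep P = Blk a1 a2 b1 b2 ->
  par p s -> par p d -> a1 - 2 <= s <= a2 + 2 -> b1 - 2 <= d <= b2 + 2 ->
  (a1 <= s <= a2) || (b1 <= d <= b2) ->
  h s (+) h d = ~~ inBlk (Blk a1 a2 b1 b2) s d.
Proof.
move=> TP EP; have [aP cP _] := Tirep TP; rewrite EP in aP cP.
have main s' d' : par p s' -> par p d' -> a1 - 2 <= s' <= a2 + 2 -> b1 - 2 <= d' <= b2 + 2 ->
    (a1 <= s' <= a2) || (b1 <= d' <= b2) -> 0 <= s' + d' <= 2 * Mz -> 0 <= s' - d' <= 2 * Nz ->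
    h s' (+) h d' = ~~ inBlk (Blk a1 a2 b1 b2) s' d'.
  move=> ps pd sa db sd X Y; have [r|r] := boolP (inrect Mz Nz s' d').
    rewrite -solid_h // (solid_tile m2 n2 Tirep Ttriv TP) // EP //.
    by move: aP r sa db sd; clear; rewrite /admissible /inC /inoct => aP ->; lia.
  have b : inBlk (Blk a1 a2 b1 b2) s' d'.
    by move: aP cP ps pd r sa db sd X Y; clear; rewrite /admissible /cls /par /inBlk /inrect; lia.
  rewrite b; have [E|[E|[E|E]]] : s' = d' \/ s' = d' + 2 * Nz \/ s' = - d' \/ s' = 2 * Mz - d'.
  - by move: ps pd r X Y; clear; rewrite /par /inrect; lia.
  - by rewrite E addbb.
  - by rewrite E hNz // addbb.
  - by rewrite E hN addbb.
  - by rewrite E hMr addbb.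
have horiz s' d' : par p s' -> par p d' -> a1 - 2 <= s' <= a2 + 2 -> b1 - 2 <= d' <= b2 + 2 ->
    (a1 <= s' <= a2) || (b1 <= d' <= b2) -> 0 <= s' - d' <= 2 * Nz ->
    h s' (+) h d' = ~~ inBlk (Blk a1 a2 b1 b2) s' d'.
  move=> ps pd sa db sd Y; have [X1|X1] := ltrP (s' + d') 0.
    have := main (- d') (- s'); rewrite !hN addbC => ->;
    move: aP ps pd sa db sd X1 Y; clear; rewrite /admissible /par /inBlk; lia.
  have [X2|X2] := lerP (s' + d') (2 * Mz).
    by apply: main => //; rewrite X1.
  have := main (2 * Mz - d') (2 * Mz - s'); rewrite !hMr addbC => ->;
    move: aP ps pd sa db sd X1 X2 Y; clear; rewrite /admissible /par /inBlk; lia.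
move=> ps pd sa db sd; have [Y1|Y1] := ltrP (s - d) 0.
  have := horiz d s; rewrite addbC => ->;
    move: aP ps pd sa db sd Y1; clear; rewrite /admissible /par /inBlk; lia.
have [Y2|Y2] := lerP (s - d) (2 * Nz).
  by apply: horiz => //; rewrite Y1.
have := horiz (d + 2 * Nz) (s - 2 * Nz); rewrite hNz //.
have -> : h (s - 2 * Nz) = h s.
  by rewrite -hNz ?subrK //; move: ps; clear; rewrite /par; lia.
rewrite addbC => ->;
    move: aP ps pd sa db sd Y1 Y2; clear; rewrite /admissible /par /inBlk; lia.
Qed.

Lemma tile_hadm P : T P -> hadm p h (irep P).
Proof.
move=> TP; have [aP cP _] := Tirep TP.
case EP : (irep P) => [ws wd|a1 a2 b1 b2]; rewrite EP in aP cP.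
  have nb k l : sign k -> sign l -> h (ws + k) (+) h (wd + l) = true.
    move=> sk sl; have pk : par p (ws + k).
      by move: cP sk; clear; rewrite /cls /par /sign; lia.
    have pl : par p (wd + l).
      by move: cP sl; clear; rewrite /cls /par /sign; lia.
    have r : inrect Mz Nz (ws + k) (wd + l).
      by move: aP sk sl; clear; rewrite /admissible /inrect /sign; lia.
    rewrite -solid_h // (solid_tile m2 n2 Tirep Ttriv TP) // EP //.
    by move: r sk sl; clear; rewrite /inC /inoct /sign => ->; lia.
  have [s1 sN] := signs.
  have := nb _ _ sN sN; have := nb _ _ sN s1; have := nb _ _ s1 sN; have := nb _ _ s1 s1.
  rewrite /hadm; case: (h (ws + 1)); case: (h (ws - 1)); case: (h (wd + 1));
    by case: (h (wd - 1)).
have A := around_block TP EP.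
have [p1 p2 p3 p4] := and4P cP.
have [a12 b12] : a1 <= a2 /\ b1 <= b2 by move: aP; clear; rewrite /admissible; lia.
have par2 x : par p x -> par p (x - 2) /\ par p (x + 2) by clear; rewrite /par; lia.
have inB t t' : par p t -> par p t' -> a1 <= t <= a2 -> b1 <= t' <= b2 -> h t = h t'.
  move=> pt pt' ta tb; have := A t t' pt pt' ltac:(move: ta; clear; lia)
    ltac:(move: tb; clear; lia) ltac:(by rewrite ta).
  rewrite /inBlk; move: ta tb => /andP[-> ->] /andP[-> ->].
  by case: (h t); case: (h t').
have e : h a1 = h b1 by apply: inB => //; rewrite ?lexx ?a12 ?b12.
have outB t t' : par p t -> par p t' -> a1 - 2 <= t <= a2 + 2 -> b1 - 2 <= t' <= b2 + 2 ->
    (a1 <= t <= a2) || (b1 <= t' <= b2) -> ~~ inBlk (Blk a1 a2 b1 b2) t t' -> h t = ~~ h t'.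
  move=> pt pt' ta tb o nB; have := A t t' pt pt' ta tb o; rewrite nB.
  by case: (h t); case: (h t').
split; split.
- by move=> t pt ta; rewrite e; apply: inB => //; rewrite lexx b12.
- rewrite e; apply: outB (par2 _ p1).1 p3 _ _ _ _; rewrite /inBlk; move: a12 b12; clear; lia.
- rewrite e; apply: outB (par2 _ p2).2 p3 _ _ _ _; rewrite /inBlk; move: a12 b12; clear; lia.
- by move=> t pt tb; apply/esym; apply: inB => //; rewrite lexx a12.
- have E : h a1 = ~~ h (b1 - 2).
    apply: outB p1 (par2 _ p3).1 _ _ _ _; rewrite /inBlk; move: a12 b12; clear; lia.
  by rewrite [in RHS]E negbK.
- have E : h a1 = ~~ h (b2 + 2).
    apply: outB p1 (par2 _ p4).2 _ _ _ _; rewrite /inBlk; move: a12 b12; clear; lia.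
  by rewrite [in RHS]E negbK.
Qed.

(** The tiles of [T] belong to [hT] and already cover the rectangle; distinct tiles of [hT] have
    disjoint interiors, so no further one fits. *)
Lemma tiling_hT : T = hT.
Proof.
have TT P : T P -> hT P.
  move=> TP; have [aP cP EP] := Tirep TP; rewrite EP; exists (irep P) => //.
  by split=> //; exact: tile_hadm.
apply/seteqP; split=> [P /TT //|_ [u hu <-]].
have [au cu _] := hu; have au' : adm (rtile u) by rewrite adm_rtile.
have [c cu'] := sreg_nonempty m2 n2 au'.
have := reg_sub (sreg_reg cu'); rewrite -Tcov => -[P TP Pc].
have [aP cP EP] := Tirep TP; have aP' : adm (rtile (irep P)) by rewrite adm_rtile.
have [c' cP'] := sreg_nonempty m2 n2 aP'.
rewrite EP in Pc; have sl := sreg_dir (z := c) cP'.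
have nact i : ~ active (rtile u) c i.
  by case/hasP => k kc /andP[_ /eqP tk]; have := allP cu' _ kc; rewrite /ssat tk ltxx.
have sl' i : active (rtile u) c i -> slope i (c'.1 - c.1, c'.2 - c.2) < 0.
  by move=> /nact.
have [e e0 [h1 h2]] := smallP (smallI (small_sreg Pc sl) (small_sreg (sreg_reg cu') sl')).
suff -> : reg (rtile u) = P by [].
apply: hT_trivIset; [by exists u | exact: TT |].
by exists (shiftp c e (c'.1 - c.1, c'.2 - c.2)); split;
  [exact: sreg_interior h2 | rewrite EP; exact: sreg_interior h1].
Qed.

End Given.

End TilingOfFunction.

(** * A tile is determined by its region *)

Section Extents.
Variables (M N : int).
Hypothesis M3 : 3 <= M.
Hypothesis N3 : 3 <= N.
Local Notation inCz := (inC M N).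
Local Notation admz := (admissible M N).

(** The support function of the integer points of a tile; eight directions suffice to identify the
    tile. *)
Definition is_max (t : tile int) (a b k : int) : Prop :=
  (exists s d, inCz t s d /\ a * s + b * d = k) /\
  forall s d, inCz t s d -> a * s + b * d <= k.

Lemma is_max_unique t t' a b k k' : (forall s d, inCz t s d = inCz t' s d) ->
  is_max t a b k -> is_max t' a b k' -> k = k'.
Proof.
move=> E [[s [d [i <-]]] h] [[s' [d' [i' <-]]] h'].
by have := h s' d'; have := h' s d; rewrite E i' -E i => /(_ isT) ? /(_ isT) ?; lia.
Qed.

(** The directions of [s] and [d] point toward corners of the rectangle; the value depends on
    whether none, one or both of the walls at that corner clip the tile. *)
Definition cut_value (u v : bool) (x y z : int) : int :=
  if u && v then x else if u || v then y else z.

(* Maxima over the clipped octagon of the linear forms of [directions]. *)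
Definition extents (t : tile int) : seq int :=
  match t with
  | Dia ws wd => [:: 1 - ws; ws + 1; 1 - wd; wd + 1; 2 - ws - wd; ws + wd + 2;
                     2 - ws + wd; ws - wd + 2]
  | Blk a1 a2 b1 b2 =>
    let l := 4 <= a1 + b1 in let r := a2 + b2 <= 2 * M - 4 in
    let b := 4 <= a1 - b2 in let t := a2 - b1 <= 2 * N - 4 in
    [:: cut_value l b (2 - a1) (- a1) (- 2);
        cut_value r t (a2 + 2) a2 (M + N - 2);
        cut_value l t (2 - b1) (- b1) (N - 2);
        cut_value r b (b2 + 2) b2 (M - 2);
        if l then 2 - a1 - b1 else - 2; if r then a2 + b2 + 2 else 2 * M - 2;
        if b then 2 - a1 + b2 else - 2; if t then a2 - b1 + 2 else 2 * N - 2]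
  end.

Definition directions : seq (int * int) :=
  [:: (-1, 0); (1, 0); (0, -1); (0, 1); (-1, -1); (1, 1); (-1, 1); (1, -1)].

Lemma is_maxI t a b k s d : inCz t s d -> a * s + b * d = k ->
  (forall s d, inCz t s d -> a * s + b * d <= k) -> is_max t a b k.
Proof. by move=> i e h; split=> //; exists s, d. Qed.

Ltac ext at_ u v := case: (boolP u); case: (boolP v);
  rewrite /u /v /= /inC /inrect /inoct; clear -at_ M3 N3 => *; lia.

Lemma extentsP t i : admz t -> (i < 8)%N ->
  is_max t (nth (0, 0) directions i).1 (nth (0, 0) directions i).2 (nth 0 (extents t) i).
Proof.
case: t => [ws wd|a1 a2 b1 b2] at_ i8.
  have [x [y [xs ys Hx]]] : exists x y : int, [/\ sign x, sign y &
      (nth (0, 0) directions i).1 * (ws + x) + (nth (0, 0) directions i).2 * (wd + y) =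
      nth 0 (extents (Dia ws wd)) i].
    case: i i8 => [|[|[|[|[|[|[|[|]]]]]]]] // _ /=.
    - by exists (-1), 1; split=> //; lia.
    - by exists 1, 1; split=> //; lia.
    - by exists 1, (-1); split=> //; lia.
    - by exists 1, 1; split=> //; lia.
    - by exists (-1), (-1); split=> //; lia.
    - by exists 1, 1; split=> //; lia.
    - by exists (-1), 1; split=> //; lia.
    - by exists 1, (-1); split=> //; lia.
  split.
    exists (ws + x), (wd + y); split => //; move: at_ xs ys; clear.
    by rewrite /admissible /sign /inC /inrect /inoct; lia.
  move=> s d; move: at_; rewrite /admissible /inC /inrect /inoct; clear x y xs ys Hx.
  by case: i i8 => [|[|[|[|[|[|[|[|]]]]]]]] // _ /= *; lia.
rewrite /admissible in at_; rewrite /extents; cbv zeta.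
set l := 4 <= a1 + b1; set r := a2 + b2 <= 2 * M - 4.
set b := 4 <= a1 - b2; set t := a2 - b1 <= 2 * N - 4.
pose S1 := cut_value l b (2 - a1) (- a1) (- 2).
pose S2 := cut_value r t (a2 + 2) a2 (M + N - 2).
pose D1 := cut_value l t (2 - b1) (- b1) (N - 2).
pose D2 := cut_value r b (b2 + 2) b2 (M - 2).
pose X1 := if l then 2 - a1 - b1 else - 2.
pose X2 := if r then a2 + b2 + 2 else 2 * M - 2.
pose Y1 := if b then 2 - a1 + b2 else - 2.
pose Y2 := if t then a2 - b1 + 2 else 2 * N - 2.
case: i i8 => [|[|[|[|[|[|[|[|]]]]]]]] // _ /=.
- apply: (is_maxI (s := - S1) (d := S1 - X1)); rewrite /S1 /X1 /cut_value; ext at_ l b.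
- apply: (is_maxI (s := S2) (d := X2 - S2)); rewrite /S2 /X2 /cut_value; ext at_ r t.
- apply: (is_maxI (s := D1 - X1) (d := - D1)); rewrite /D1 /X1 /cut_value; ext at_ l t.
- apply: (is_maxI (s := X2 - D2) (d := D2)); rewrite /D2 /X2 /cut_value; ext at_ r b.
- apply: (is_maxI (s := - S1) (d := S1 - X1)); rewrite /S1 /X1 /cut_value; ext at_ l b.
- apply: (is_maxI (s := S2) (d := X2 - S2)); rewrite /S2 /X2 /cut_value; ext at_ r t.
- apply: (is_maxI (s := - S1) (d := Y1 - S1)); rewrite /S1 /Y1 /cut_value; ext at_ l b.
- apply: (is_maxI (s := S2) (d := S2 - Y2)); rewrite /S2 /Y2 /cut_value; ext at_ r t.
Qed.

Ltac flags a1 a2 b1 b2 := case: (boolP (4 <= a1 + b1)); case: (boolP (a2 + b2 <= 2 * M - 4));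
  case: (boolP (4 <= a1 - b2)); case: (boolP (a2 - b1 <= 2 * N - 4)).

Lemma extents_dia_blk ws wd a1 a2 b1 b2 : admz (Dia ws wd) -> admz (Blk a1 a2 b1 b2) ->
  extents (Dia ws wd) != extents (Blk a1 a2 b1 b2).
Proof.
rewrite /admissible => aD aB; apply/eqP; rewrite /extents /cut_value; cbv zeta.
by flags a1 a2 b1 b2; rewrite /= => ? ? ? ? [] *; lia.
Qed.

Lemma extents_blk_inj a1 a2 b1 b2 a1' a2' b1' b2' :
  admz (Blk a1 a2 b1 b2) -> admz (Blk a1' a2' b1' b2') ->
  extents (Blk a1 a2 b1 b2) = extents (Blk a1' a2' b1' b2') ->
  [&& a1 == a1', a2 == a2', b1 == b1' & b2 == b2'].
Proof.
rewrite /admissible /extents /cut_value; cbv zeta => aB aB' E; move: aB aB' E.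
(* Inconsistent clippings are discarded first, which leaves at most nine for each tile. *)
flags a1 a2 b1 b2 => h1 h2 h3 h4 /= aB; try (by exfalso; clear -M3 N3 h1 h2 h3 h4 aB; lia);
(flags a1' a2' b1' b2' => h1' h2' h3' h4' /= aB';
  try (by exfalso; clear -M3 N3 h1' h2' h3' h4' aB'; lia);
  case; clear -M3 N3 aB aB' h1 h2 h3 h4 h1' h2' h3' h4' => *; lia).
Qed.

Lemma inC_inj t t' : admz t -> admz t' -> (forall s d, inCz t s d = inCz t' s d) -> t = t'.
Proof.
move=> at_ at' E.
have {}E : extents t = extents t'.
  apply: (@eq_from_nth _ 0); first by case: (t) (t') => [? ?|? ? ? ?] [? ?|? ? ? ?].
  have -> : size (extents t) = 8%N by case: (t).
  by move=> i i8; exact: is_max_unique E (extentsP at_ i8) (extentsP at' i8).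
case: t t' at_ at' E => [ws wd|a1 a2 b1 b2] [ws' wd'|a1' a2' b1' b2'] at_ at' E.
- by case: E => *; congr Dia; lia.
- by have := extents_dia_blk at_ at'; rewrite E eqxx.
- by have := extents_dia_blk at' at_; rewrite E eqxx.
- by have /and4P[/eqP-> /eqP-> /eqP-> /eqP->] := extents_blk_inj at_ at' E.
Qed.

End Extents.

Lemma hadm_value_Blk p h a1 a2 b1 b2 s d M N :
  cls p (Blk a1 a2 b1 b2) -> hadm p h (Blk a1 a2 b1 b2) ->
  inC M N (Blk a1 a2 b1 b2) s d -> par p s -> par p d ->
  h s (+) h d = ~~ inBlk (Blk a1 a2 b1 b2) s d.
Proof.
move=> c [[Ha Ha1 Ha2] [Hb Hb1 Hb2]] /andP[_ i] ps pd.
(* By parity a class point of the octagon is in the block or exactly 2 beyond one side; the sides of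
   length 2 exclude the diagonal positions. *)
have sE : [\/ a1 <= s <= a2 /\ b1 <= d <= b2, s = a1 - 2 /\ b1 <= d <= b2,
    s = a2 + 2 /\ b1 <= d <= b2 | (d = b1 - 2 \/ d = b2 + 2) /\ a1 <= s <= a2].
  move: c i ps pd; rewrite /cls /inoct /par => c i ps pd.
  have [h1|h1] := boolP (a1 <= s <= a2); last first.
    have [h2|h2] := boolP (s == a1 - 2); [constructor 2 | constructor 3];
      clear -c i ps pd h1 h2; split; lia.
  have [h2|h2] := boolP (b1 <= d <= b2); [by constructor 1 | constructor 4].
  clear -c i ps pd h1 h2; split; lia.
case: sE => [[sa db]|[-> db]|[-> db]|[de sa]].
- rewrite (Ha _ ps sa) (Hb _ pd db) addbb; apply/esym/negbTE; rewrite negbK.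
  by rewrite /inBlk; clear -sa db; lia.
- by rewrite Ha1 (Hb _ pd db) /inBlk; case: (h a1) => /=; clear; lia.
- by rewrite Ha2 (Hb _ pd db) /inBlk; case: (h a1) => /=; clear; lia.
- by rewrite (Ha _ ps sa); case: de => ->; rewrite ?Hb1 ?Hb2 /inBlk; case: (h a1) => /=; clear; lia.
Qed.

(** Reads h s (+) h d off the tiling; this makes the passage from functions to tilings injective. *)
Lemma hadm_value p h t s d M N : cls p t -> hadm p h t -> inC M N t s d -> par p s -> par p d ->
  h s (+) h d = ~~ inBlk t s d.
Proof.
case: t => [ws wd|a1 a2 b1 b2]; last exact: hadm_value_Blk.
move=> c [e1 e2 e3] /andP[_ i] ps pd.
have [sE dE] : (s = ws - 1 \/ s = ws + 1) /\ (d = wd - 1 \/ d = wd + 1).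
  by move: c i ps pd; rewrite /cls /inoct /par; clear; split; lia.
by case: sE => ->; case: dE => ->; rewrite -?e1 -?e2 e3; case: (h _).
Qed.

(** * Counting *)

Section Profiles.
Variables (g i K : nat).
Hypothesis g0 : (0 < g)%N.
Hypothesis EK : K = ((g - i) %/ 2)%N.
Hypothesis ig : (i <= g)%N.
Hypothesis i1 : (i <= 1)%N.
Local Notation p := (g%:Z - i%:Z : int).

(* The even function of period 2 g with h (g - i) = 0 and
   h (g - i - 2 (j + 1)) = u j. *)
Definition profile (u : {ffun 'I_K -> bool}) (t : int) : bool :=
  if ((g - i - `|fold g%:Z t|) %/ 2)%N is j.+1 then oapp u false (insub j) else false.

Let g0z : 0 < g%:Z. Proof. by move: g0; clear; lia. Qed.

Lemma profileN u t : profile u (- t) = profile u t.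
Proof. by rewrite /profile foldN. Qed.

Lemma profileD u t (k : int) : profile u (t + k * (2 * g%:Z)) = profile u t.
Proof. by rewrite /profile foldD. Qed.

Lemma profile_node u (j : 'I_K) : profile u (g%:Z - i%:Z - 2 * j.+1%:Z) = u j.
Proof.
have jK := ltn_ord j; rewrite /profile fold_small; last first.
- by move: jK EK ig; clear; lia.
- exact: g0z.
have -> : ((g - i - `|(g%:Z - i%:Z - 2 * j.+1%:Z)%R|) %/ 2)%N = j.+1.
  by move: jK EK ig; clear; lia.
by rewrite valK.
Qed.

Lemma profile_end u : profile u (g%:Z - i%:Z) = false.
Proof.
rewrite /profile fold_small; [|exact: g0z|by move: ig; clear; lia].
by have -> : ((g - i - `|(g%:Z - i%:Z)%R|) %/ 2)%N = 0%N by move: ig; clear; lia.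
Qed.

Lemma profile0 t : profile [ffun=> false] t = false.
Proof.
by rewrite /profile; case: (_ %/ _)%N => // j; case: insub => //= o; rewrite ffunE.
Qed.

Lemma profile_nonconst u : u != [ffun=> false] ->
  exists t t', [/\ par p t, par p t' & profile u t != profile u t'].
Proof.
move=> u0; have [j uj] : exists j, u j.
  apply: contrapT => nu; move/eqP: u0; apply; apply/ffunP => j; rewrite ffunE.
  by apply/negbTE/negP => uj; apply: nu; exists j.
exists (g%:Z - i%:Z), (g%:Z - i%:Z - 2 * j.+1%:Z); split.
- by rewrite /par.
- by clear; rewrite /par; lia.
- by rewrite profile_end profile_node uj.
Qed.

(** The values in [0, g] determine such a function on its class; the added constant selects, among
    [h] and its complement, the one that vanishes at g - i. *)
Lemma profile_of (h : int -> bool) : (forall t, h (- t) = h t) ->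
  (forall t, par p t -> h (t + 2 * g%:Z) = h t) ->
  exists u, forall t, par p t -> profile u t = h t (+) h (g%:Z - i%:Z).
Proof.
move=> hN hD.
exists [ffun j : 'I_K => h (g%:Z - i%:Z - 2 * j.+1%:Z) (+) h (g%:Z - i%:Z)] => t pt.
rewrite -(fold_sym g0z hN hD pt); have := fold_range g0z t; have := fold_par g0z t p.
rewrite pt; set r := fold _ t => pr rg; rewrite /profile -/r.
have e : r = g%:Z - i%:Z - 2 * ((g - i - `|r|) %/ 2)%N%:Z.
  by move: pr rg ig i1; clear; rewrite /par; lia.
case E : ((g - i - `|r|) %/ 2)%N => [|j].
  by rewrite e E mulr0 subr0 addbb.
have jK : (j < K)%N by move: E EK ig; clear; lia.
by rewrite insubT /= ffunE /= -E -e.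
Qed.

End Profiles.

(** Bezout's identity, combining multiples of both periods. The period 2 N is known on one class
    only, but even shifts preserve that class. *)
Lemma gcd_period (h : int -> bool) (M N : nat) (p : int) : (0 < M)%N ->
  (forall t, h (t + 2 * M%:Z) = h t) -> (forall t, par p t -> h (t + 2 * N%:Z) = h t) ->
  forall t, par p t -> h (t + 2 * (gcdn M N)%:Z) = h t.
Proof.
move=> M0 hM hN t pt.
have hMk (k : nat) u : h (u + k%:Z * (2 * M%:Z)) = h u.
  elim: k u => [|k IH] u; first by rewrite mul0r addr0.
  have -> : u + k.+1%:Z * (2 * M%:Z) = u + k%:Z * (2 * M%:Z) + 2 * M%:Z by rewrite -addn1 PoszD; ring.
  by rewrite hM IH.
have par2 u (x : int) : par p u -> par p (u + 2 * x) by clear; rewrite /par; lia.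
have hNk (k : nat) u : par p u -> h (u + k%:Z * (2 * N%:Z)) = h u.
  elim: k u => [|k IH] u pu; first by rewrite mul0r addr0.
  have -> : u + k.+1%:Z * (2 * N%:Z) = u + 2 * N%:Z + k%:Z * (2 * N%:Z) by rewrite -addn1 PoszD; ring.
  by rewrite IH ?hN //; exact: par2.
case: (egcdnP N M0) => km kn E _.
rewrite -(hNk kn); last exact: par2.
rewrite -[RHS](hMk km); congr h.
have Ez : km%:Z * M%:Z = kn%:Z * N%:Z + (gcdn M N)%:Z by rewrite -!PoszM E PoszD.
have -> : km%:Z * (2 * M%:Z) = 2 * (km%:Z * M%:Z) by ring.
by rewrite Ez; ring.
Qed.

Lemma card_image_fin (Z : finType) (X : Type) (F : Z -> X) (A : set X) (k : nat) :
  injective F -> A = range F -> #|Z| = k -> (A #= `I_k)%card.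
Proof.
move=> Fi -> <-; apply: card_eq_trans (inj_card_eq (A := [set: Z]) _) _.
  by move=> x y _ _; exact: Fi.
apply/card_set_bijP; exists (fun x => enum_rank x : nat); split.
- by move=> x _ /=; exact: ltn_ord.
- by move=> x y _ _ /ord_inj /enum_rank_inj.
- by move=> j /= jZ; exists (enum_val (Ordinal jZ)) => //; rewrite enum_valK.
Qed.

(** * From profiles to tilings *)

Section Count.
Variables (R : realType) (m n : nat).
Local Notation plane := (R * R)%type.
Local Notation M := (m%:R + 1 : R).
Local Notation N := (n%:R + 1 : R).
Local Notation Q := (rectangle R m n).
Local Notation reg := (@reg R m n).

Hypothesis m2 : (2 <= m)%N.
Hypothesis n2 : (2 <= n)%N.

Local Notation adm := (@admissible R M N).
Local Notation Mz := (m%:Z + 1 : int).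
Local Notation Nz := (n%:Z + 1 : int).
Local Notation rtile := (@rtile R).
Local Notation admz := (admissible Mz Nz).
Local Notation g := (gcdn (m + 1) (n + 1)).
Local Notation hT := (@hT R m n).
Local Notation htile := (@htile m n).

Let M3 : 3 <= Mz. Proof. by move: m2; clear; lia. Qed.
Let N3 : 3 <= Nz. Proof. by move: n2; clear; lia. Qed.

Let g0 : (0 < g)%N. Proof. by rewrite gcdn_gt0 addn1. Qed.

Let g_mul (k : nat) : (g %| k)%N -> exists q : int, 2 * k%:Z = q * (2 * g%:Z).
Proof. by move=> /dvdnP[q ->]; exists q%:Z; rewrite PoszM; ring. Qed.

Section Tilings.
Variables (i K : nat).
Hypothesis i1 : (i <= 1)%N.
Hypothesis EK : K = ((g - i) %/ 2)%N.
Local Notation p := (g%:Z - i%:Z : int).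

Let ig : (i <= g)%N. Proof. exact: leq_trans i1 g0. Qed.

Definition tiling_of (u : {ffun 'I_K -> bool}) : set (set plane) :=
  hT p (profile g i u).

Let profileM (u : {ffun 'I_K -> bool}) t : profile g i u (t + 2 * Mz) = profile g i u t.
Proof.
have [q E] := g_mul (dvdn_gcdl (m + 1) (n + 1)).
rewrite (_ : 2 * Mz = 2 * (m + 1)%N%:Z) ?E ?profileD //; clear; lia.
Qed.

Let profileNz (u : {ffun 'I_K -> bool}) t : par p t -> profile g i u (t + 2 * Nz) = profile g i u t.
Proof.
move=> _; have [q E] := g_mul (dvdn_gcdr (m + 1) (n + 1)).
rewrite (_ : 2 * Nz = 2 * (n + 1)%N%:Z) ?E ?profileD //; clear; lia.
Qed.

Lemma tiling_of_is_tiling (u : {ffun 'I_K -> bool}) :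
  u != [ffun=> false] -> is_tiling Q (tiling_of u).
Proof.
move=> u0; have nc := profile_nonconst g0 EK ig u0.
have hN := @profileN g i K g0 u.
split.
- exact: hT_finite.
- move=> _ [t [au cu _] <-]; apply: is_tile_reg; first by rewrite adm_rtile.
  exact: (@steps_rtile R m n m2 n2 _ _ au cu).
- exact: hT_cover m2 n2 p _ hN (profileM u) (profileNz u) nc.
- exact: hT_trivIset.
Qed.

Lemma tiling_of_surj T (irep : set plane -> tile int) : is_tiling Q T ->
  (forall P, T P -> [/\ admz (irep P), cls p (irep P) & P = reg (rtile (irep P))]) ->
  exists2 u, u != [ffun=> false] & T = tiling_of u.
Proof.
move=> [Tfin Ttile Tcov Ttriv] Tirep.
pose S := @solid R m n T irep p.
have [h [hN hM hNz hS]] := @wave_solution m n p S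
  (@solid_in R m n T irep p) (@solid_parity R m n m2 n2 T irep p Tirep Tcov Ttriv).
have hg t : par p t -> h (t + 2 * g%:Z) = h t.
  apply: gcd_period => [|t'|t' pt']; first by rewrite addn1.
    by rewrite PoszD; exact: hM.
  by rewrite PoszD; exact: hNz.
have [u hu] := profile_of g0 EK ig i1 hN hg.
have solid_u s d : par p s -> par p d -> inrect Mz Nz s d ->
    S s d = profile g i u s (+) profile g i u d.
  by move=> ps pd r; rewrite hS // !hu //; case: (h s); case: (h d); case: (h _).
have E : T = tiling_of u.
  exact: (tiling_hT m2 n2 (@profileN g i K g0 u) (profileM u) (profileNz u)
    Tirep Tcov Ttriv solid_u).
(* A constant function has no tiles at all: its runs never end, and a diamond needs two values. *)
exists u => //; apply/eqP => u0.
have Q0 : Q (0, 0).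
  have m2' : @Order.le _ R 2 m%:R by rewrite ler_nat.
  have n2' : @Order.le _ R 2 n%:R by rewrite ler_nat.
  by rewrite rectangleE /inrect /sf /df /=; lra.
move: Q0; rewrite -Tcov => -[P]; rewrite E u0 => -[t [_ _ ht] _] _.
case: t ht => [ws wd|a1 a2 b1 b2] [].
  by rewrite !profile0.
by case=> _; rewrite !profile0.
Qed.

(** Consecutive nodes are the coordinates of a point of the bottom row, so equality passes from the
    normalized end g - i to all nodes. *)
Lemma profile_eq (u u' : {ffun 'I_K -> bool}) :
  (forall s d, par p s -> par p d -> inrect Mz Nz s d ->
   profile g i u s (+) profile g i u d = profile g i u' s (+) profile g i u' d) -> u = u'.
Proof.
move=> H; have gm : (g <= m + 1)%N by apply: dvdn_leq; rewrite ?addn1 // -addn1 dvdn_gcdl.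
suff D (j : nat) : (j <= K)%N -> profile g i u (g%:Z - i%:Z - 2 * j%:Z) =
    profile g i u' (g%:Z - i%:Z - 2 * j%:Z).
  apply/ffunP => j; rewrite -(profile_node g0 EK ig u) -(profile_node g0 EK ig u').
  exact: D.
elim: j => [|j IH] jK; first by rewrite mulr0 subr0 !profile_end.
have {}IH := IH (ltnW jK).
have := H (g%:Z - i%:Z - 2 * j%:Z) (g%:Z - i%:Z - 2 * j.+1%:Z).
move=> /(_ ltac:(clear; rewrite /par; lia) ltac:(clear; rewrite /par; lia)).
have r : inrect Mz Nz (g%:Z - i%:Z - 2 * j%:Z) (g%:Z - i%:Z - 2 * j.+1%:Z).
  by move: gm jK EK ig n2; rewrite /inrect; move: (g) => g'; clear; lia.
by move=> /(_ r); rewrite IH; case: (profile _ _ u' _); case: (profile _ _ u _);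
  case: (profile _ _ u' _).
Qed.

End Tilings.

Lemma hT_reg_inj p p' h h' P : hT p h P -> hT p' h' P ->
  exists t, [/\ htile p h t, htile p' h' t & P = reg (rtile t)].
Proof.
move=> [t ht EP] [t' ht' EP']; exists t; split => //.
suff -> : t = t' by [].
have [at_ _ _] := ht; have [at' _ _] := ht'.
apply: (inC_inj M3 N3 at_ at') => s d.
have [z [es ed]] := point_of R s d.
have : reg (rtile t) z = reg (rtile t') z by rewrite EP EP'.
by rewrite /reg /= es ed !inC_rtile => E; apply/idP/idP; rewrite E.
Qed.

Lemma tiling_of_inj i i' K K' (u : {ffun 'I_K -> bool}) (u' : {ffun 'I_K' -> bool}) :
  (i <= 1)%N -> (i' <= 1)%N -> K = ((g - i) %/ 2)%N -> K' = ((g - i') %/ 2)%N ->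
  u != [ffun=> false] -> @tiling_of i K u = @tiling_of i' K' u' ->
  i = i' /\ (forall s d, par (g%:Z - i%:Z) s -> par (g%:Z - i%:Z) d -> inrect Mz Nz s d ->
    profile g i u s (+) profile g i u d = profile g i' u' s (+) profile g i' u' d).
Proof.
move=> i1 i1' EK EK' u0 E.
have [_ _ cov _] := tiling_of_is_tiling i1 EK u0.
have common s d : inrect Mz Nz s d -> exists t,
    [/\ htile (g%:Z - i%:Z) (profile g i u) t, htile (g%:Z - i'%:Z) (profile g i' u') t
      & inC Mz Nz t s d].
  move=> r; have [z [es ed]] := point_of R s d.
  have Qz : Q z.
    rewrite rectangleE es ed; move: r; rewrite /inrect -!(ler_int R) => r.
    by clear EK EK' u0 E cov; lra.
  move: Qz; rewrite -cov => -[P TP Pz].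
  have TP' : tiling_of i' u' P by rewrite -E.
  have [t [ht ht' EP]] := hT_reg_inj TP TP'; exists t; split=> //.
  by move: Pz; rewrite EP /reg /= es ed inC_rtile.
split.
  (* Any common tile reveals the class; this is the one at the corner (0, 0) of the rectangle. *)
  have r : inrect Mz Nz 2 0 by move: m2 n2; rewrite /inrect; clear; lia.
  have [t [[_ c _] [_ c' _] _]] := common _ _ r.
  by move: c c' i1 i1'; case: (t) => [? ?|? ? ? ?]; rewrite /cls /par; clear; lia.
move=> s d ps pd r; have [t [[_ c ha] [_ c' ha'] it]] := common s d r.
rewrite (hadm_value c ha it ps pd) (hadm_value c' ha' it) //.
  by case: (t) c c' ps => [? ?|? ? ? ?]; rewrite /cls /par; clear; lia.
by case: (t) c c' pd => [? ?|? ? ? ?]; rewrite /cls /par; clear; lia.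
Qed.

Lemma tiling_class T : is_tiling Q T -> exists i (irep : set plane -> tile int),
  (i <= 1)%N /\ forall P, T P ->
    [/\ admz (irep P), cls (g%:Z - i%:Z) (irep P) & P = reg (rtile (irep P))].
Proof.
move=> [Tfin Ttile Tcov Ttriv].
have sub P : T P -> P `<=` Q by move=> TP; rewrite -Tcov; exact: bigcup_sup.
have /choice[rep Hrep] P : exists t : tile R, T P -> [/\ adm t, steps t & P = reg t].
  have [TP|nTP] := pselect (T P); last by exists (Dia 0 0).
  by have [t Ht] := is_tile_adm (Ttile _ TP) (sub _ TP); exists t.
have [q Hq] := base_integral m2 n2 Tfin Hrep Tcov Ttriv.
(* Only the parity of the class matters, and it is measured from [g]: [i] is 0 exactly when [q] has
   the parity of [g]. *)
pose i := `|((g%:Z - q) %% 2)%Z|%N.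
exists i.
have Hi P : T P -> exists t, [/\ admz t, cls (g%:Z - i%:Z) t & P = reg (rtile t)].
  move=> TP; have [aP sP EP] := Hrep _ TP.
  have [t [Et at_ ct]] := int_tile m2 n2 aP sP (Hq _ TP).
  exists t; split => //; last by rewrite EP {1}Et.
  by move: ct; rewrite /i; case: (t) => [? ?|? ? ? ?]; rewrite /cls /par; clear; lia.
have /choice[irep Hirep] P : exists t : tile int,
    T P -> [/\ admz t, cls (g%:Z - i%:Z) t & P = reg (rtile t)].
  have [TP|nTP] := pselect (T P); last by exists (Dia 0 0).
  by have [t Ht] := Hi _ TP; exists t.
by exists irep; split => //; rewrite /i; clear; lia.
Qed.

End Count.

Local Close Scope ring_scope.
Local Open Scope card_scope.

Theorem theorem1 (R : realType) (m n c beta omega : nat)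
  (hm : (2 <= m)%N) (hn : (2 <= n)%N)
  (hc : c = (gcdn (m + 1) (n + 1) - 1)%N)
  (hbeta : (2 * beta)%N = (c + c %% 2)%N)
  (homega : (2 * omega)%N = (c - c %% 2)%N) :
  [set T : set (set (R * R)%type) | is_tiling (rectangle R m n) T]
    #= `I_(2 ^ beta + 2 ^ omega - 2).
Proof.
have g0 : (0 < gcdn (m + 1) (n + 1))%N by rewrite gcdn_gt0 addn1.
have eb : beta = ((gcdn (m + 1) (n + 1) - 0) %/ 2)%N.
  by move: g0 hc hbeta; move: (gcdn _ _) => g; clear; lia.
have eo : omega = ((gcdn (m + 1) (n + 1) - 1) %/ 2)%N.
  by move: g0 hc homega; move: (gcdn _ _) => g; clear; lia.
(* The first summand is the class of gcd(m + 1, n + 1), the second the other one; the zero vector,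
   which stands for the constant functions, is left out of each. *)
pose Z := ({u : {ffun 'I_beta -> bool} | u != [ffun=> false]} +
           {u : {ffun 'I_omega -> bool} | u != [ffun=> false]})%type.
pose F (z : Z) := match z with
  | inl u => @tiling_of R m n 0 beta (val u) | inr u => @tiling_of R m n 1 omega (val u) end.
apply: (@card_image_fin Z _ F).
- case=> [[u u0]|[u u0]] [[u' u0']|[u' u0']] E.
  + have [_ H] := tiling_of_inj hm hn (isT : (0 <= 1)%N) (isT : (0 <= 1)%N) eb eb u0 E.
    by congr inl; apply: val_inj; exact: profile_eq H.
  + by have [] := tiling_of_inj hm hn (isT : (0 <= 1)%N) (isT : (1 <= 1)%N) eb eo u0 E.
  + by have [] := tiling_of_inj hm hn (isT : (1 <= 1)%N) (isT : (0 <= 1)%N) eo eb u0 E.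
  + have [_ H] := tiling_of_inj hm hn (isT : (1 <= 1)%N) (isT : (1 <= 1)%N) eo eo u0 E.
    by congr inr; apply: val_inj; exact: profile_eq H.
- apply/seteqP; split=> [T tT|_ [[[u u0]|[u u0]] _ <-]].
  + have [i [irep [i1 H]]] := tiling_class hm hn tT.
    case: i i1 H => [|[|//]] i1 H.
      have [u u0 E] := tiling_of_surj hm hn i1 eb tT H.
      by exists (inl (exist _ u u0)).
    have [u u0 E] := tiling_of_surj hm hn i1 eo tT H.
    by exists (inr (exist _ u u0)).
  + have := @tiling_of_is_tiling R m n hm hn 0 _ (isT : (0 <= 1)%N) eb u u0. exact.
  + have := @tiling_of_is_tiling R m n hm hn 1 _ (isT : (1 <= 1)%N) eo u u0. exact.
- rewrite card_sum !card_sig.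
  have E k : #|[pred u : {ffun 'I_k -> bool} | u != [ffun=> false]]| = (2 ^ k - 1)%N.
    by rewrite -(eq_card (_ : predC1 [ffun=> false] =i _)) ?cardC1 ?card_ffun ?card_bool ?card_ord ?subn1.
  rewrite !E; have := expn_gt0 2 beta; have := expn_gt0 2 omega.
  by move: (2 ^ beta)%N (2 ^ omega)%N => x y /=; clear; lia.
Qed.
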